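(* Let $w,v\in\mathbb{C}$ and let $R\geq1$ be an integer. As real $n\to\infty$: \begin{align*} S_n(1;v)&=\sum_{r=0}^{R-1}\frac{1}{n^r}\left(\rho_r(v)+\frac{\gamma_r(v)}{2}\sqrt{2\pi n}\right)+O\!\left(\frac{1}{n^{R-1/2}}\right),\\ S_n(w;v)&=\sum_{r=0}^{R-1}\frac{U_r(w;v)}{n^r}+O\!\left(\frac1{n^R}\right)\qquad (w\in\mathcal{X}\cup\mathcal{Y}\cup\mathcal{S}),\\ S_n(w;v)&=\sum_{r=0}^{R-1}\frac{1}{n^r}\left(U_r(w;v)+\gamma_r(v)\frac{e^{ni\varphi(w)}}{w^v}\sqrt{2\pi n}\right)+O\!\left(\frac{1}{n^{R-1/2}}\right)\qquad (w\in\mathcal{T}),\\ S_n(w;v)&=\frac{\sqrt{2\pi n}}{(we^{1-w})^n w^v}\left(\sum_{r=0}^{R-1}\frac{\gamma_r(v)}{n^r}+O\!\left(\frac1{n^R}\right)\right)\qquad(w\in\mathcal{Z}). \end{align*}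
   Context: Logarithms use the principal branch with arguments in $(-\pi,\pi]$; $w^v=e^{v\log w}$, $(nw)^{-(n+v)}=e^{-(n+v)\log n}e^{-(n+v)\log w}$, and $(we^{1-w})^n:=e^{n\log w+n(1-w)}$. For real $n>0$, $v\in\mathbb{C}$ with $\mathrm{Re}(n+v)>-1$ and $w\in\mathbb{C}$, define $S_n(w;v)=1+nw\int_0^1 e^{nw(1-z)}z^{n+v}\,dz$ (for integers $n\geq1$, $n+v\geq0$, $w\ne0$ this is the number with $e^{nw}=\sum_{j=0}^{n+v-1}\frac{(nw)^j}{j!}+\frac{(nw)^{n+v}}{(n+v)!}S_n(w;v)$). Regions: $\mathcal{X}=\{w:|we^{1-w}|>1\}$; $\mathcal{Y}=\{w:|we^{1-w}|<1,\ \mathrm{Re}(w)<1\}$; $\mathcal{Z}=\{w:|we^{1-w}|<1,\ \mathrm{Re}(w)>1\}$; $\mathcal{S}=\{w:|we^{1-w}|=1,\ \mathrm{Re}(w)<1\}$; $\mathcal{T}=\{w:|we^{1-w}|=1,\ \mathrm{Re}(w)>1\}$. For $|we^{1-w}|=1$, $\varphi(w):=\mathrm{Im}(w)-\arg(w)$ (real, with $we^{1-w}=e^{-i\varphi(w)}$). De Moivre polynomial $\mathcal{A}_{n,k}(a_1,a_2,\dots)$: coefficient of $x^n$ in $(a_1x+a_2x^2+\cdots)^k$. Double factorial $n!!$ as usual with $0!!=(-1)!!=1$; $\binom{v}{j}=v(v-1)\cdots(v-j+1)/j!$; $\delta_{r,0}$ Kronecker delta. Coefficients: $\rho_r(v)=\delta_{r,0}-\sum_{m=0}^{2r+1}(-1)^m\binom{v}{2r+1-m}\sum_{k=0}^{m}\frac{(2r+2k)!!}{(-1)^k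 k!}\mathcal{A}_{m,k}(\frac13,\frac14,\frac15,\dots)$; $\gamma_r(v)=\sum_{m=0}^{2r}(-1)^m\binom{v}{2r-m}\sum_{k=0}^{m}\frac{(2r+2k-1)!!}{(-1)^k k!}\mathcal{A}_{m,k}(\frac13,\frac14,\frac15,\dots)$; $U_r(w;v)=\delta_{r,0}-\sum_{m=0}^{r}(-1)^m\binom{v}{r-m}\sum_{k=0}^{m}\frac{w}{(w-1)^{r+k+1}}\frac{(r+k)!}{k!}\mathcal{A}_{m,k}(\frac12,\frac13,\frac14,\dots)$. *)

(* Defs.v *)
From Stdlib Require Import Reals Arith.
From Coquelicot Require Import Coquelicot.
Open Scope R_scope.

Definition Cexp (z : C) : C :=
  (exp (Re z) * cos (Im z), exp (Re z) * sin (Im z)).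

(** Principal argument, with values in (-PI, PI] (and arg 0 = 0). *)
Definition Carg (z : C) : R :=
  let x := Re z in let y := Im z in
  if Rlt_dec 0 x then atan (y / x)
  else if Rlt_dec x 0 then
         (if Rle_dec 0 y then atan (y / x) + PI else atan (y / x) - PI)
  else (if Rlt_dec 0 y then PI / 2
        else if Rlt_dec y 0 then - (PI / 2) else 0).

(** Principal logarithm  log z = ln|z| + i arg z  (only used for z <> 0). *)
Definition Clog (z : C) : C := (ln (Cmod z), Carg z).

Definition Ccpow (w v : C) : C := Cexp (v * Clog w)%C.

Definition wepow (n : R) (w : C) : C :=
  Cexp (RtoC n * Clog w + RtoC n * (1 - w))%C.

Definition Sn (n : R) (w v : C) : C :=
  (1 + RtoC n * w *
     RInt (V := C_R_CompleteNormedModule)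
       (fun z : R => Cexp (RtoC n * w * RtoC (1 - z)) * Ccpow (RtoC z) (RtoC n + v))%C
       0 1)%C.

Fixpoint Csum (f : nat -> C) (n : nat) : C :=
  match n with O => RtoC 0 | S m => (Csum f m + f m)%C end.

Definition ps_mul (f g : nat -> C) : nat -> C :=
  fun n => Csum (fun i => f i * g (n - i)%nat)%C (S n).
Definition ps_one : nat -> C := fun n => if Nat.eqb n 0 then RtoC 1 else RtoC 0.
Fixpoint ps_pow (f : nat -> C) (k : nat) : nat -> C :=
  match k with O => ps_one | S k' => ps_mul f (ps_pow f k') end.

(** De Moivre polynomial A_{n,k}(a_1,a_2,...): coefficient of x^n in
    (a_1 x + a_2 x^2 + ...)^k; here [a j] is a_j for j >= 1 (a 0 is ignored). *)
Definition deMoivre (a : nat -> C) (n k : nat) : C :=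
  ps_pow (fun j => if Nat.eqb j 0 then RtoC 0 else a j) k n.

Definition seq3 (j : nat) : C := RtoC (/ INR (j + 2)).
Definition seq2 (j : nat) : C := RtoC (/ INR (j + 1)).

Fixpoint dfact (n : nat) : nat :=
  match n with O => 1%nat | S O => 1%nat | S (S m as p) => (S p * dfact m)%nat end.

Fixpoint falling (v : C) (j : nat) : C :=
  match j with O => RtoC 1 | S i => (falling v i * (v - RtoC (INR i)))%C end.
Definition Cbinom (v : C) (j : nat) : C := (falling v j / RtoC (INR (fact j)))%C.

Definition kdelta (r : nat) : C := if Nat.eqb r 0 then RtoC 1 else RtoC 0.
Definition msign (m : nat) : C := (RtoC (-1)) ^ m.

Definition rho (r : nat) (v : C) : C :=
  (kdelta r -
   Csum (fun m =>
     msign m * Cbinom v (2 * r + 1 - m) *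
     Csum (fun k => RtoC (INR (dfact (2 * r + 2 * k))) / (msign k * RtoC (INR (fact k)))
                    * deMoivre seq3 m k) (S m))
     (S (2 * r + 1)))%C.

(** gamma_r(v); note (2r+2k-1)!! with truncated subtraction gives 0!! = 1 = (-1)!!
    when r = k = 0. *)
Definition gam (r : nat) (v : C) : C :=
  (Csum (fun m =>
    msign m * Cbinom v (2 * r - m) *
    Csum (fun k => RtoC (INR (dfact (2 * r + 2 * k - 1))) / (msign k * RtoC (INR (fact k)))
                   * deMoivre seq3 m k) (S m))
    (S (2 * r)))%C.

Definition Ucoef (r : nat) (w v : C) : C :=
  (kdelta r -
   Csum (fun m =>
     msign m * Cbinom v (r - m) *
     Csum (fun k => w / ((w - 1) ^ (r + k + 1)) *
                    (RtoC (INR (fact (r + k))) / RtoC (INR (fact k)))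
                    * deMoivre seq2 m k) (S m))
     (S r))%C.

Definition modwe (w : C) : R := Cmod (w * Cexp (1 - w))%C.

Definition regX (w : C) : Prop := modwe w > 1.
Definition regY (w : C) : Prop := modwe w < 1 /\ Re w < 1.
Definition regZ (w : C) : Prop := modwe w < 1 /\ Re w > 1.
Definition regS (w : C) : Prop := modwe w = 1 /\ Re w < 1.
Definition regT (w : C) : Prop := modwe w = 1 /\ Re w > 1.

Definition phi (w : C) : R := Im w - Carg w.

Definition sq2pin (n : R) : C := RtoC (sqrt (2 * PI * n)).

(* Main.v *)
Require Import Defs.
From Stdlib Require Import Reals Arith Lra Lia.
From Coquelicot Require Import Coquelicot.
Open Scope R_scope.

(** The idea: [u^(n+v) e^(-nu)] has the primitive [F(e) = e^(n+v+1) * int_0^1 e^(-n e s) s^(n+v) ds]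
    on [Re e > 0], and [S_n(w;v) = 1 + n e^(nw) w^(-n-v) F(w)].  When [Re w < 1] the integral
    defining [S_n] is dominated by its endpoint [z = 1].  When [Re w >= 1] and [w <> 1], [F(w)] is reached by
    going from 0 along the real axis across the saddle [u = 1] to [Re w + delta], then up to
    [w + delta] (exponentially negligible), then back to [w].  The real axis contributes the series
    in the [gamma_r] with weight [(w e^(1-w))^(-n) w^(-v)], the last piece is an endpoint
    contribution and gives the [U_r]; the size of [w e^(1-w)] decides which of the two survives.
    At [w = 1] only the left half of the saddle is seen, so that its odd-order terms [rho_r]
    do not cancel.  Endpoint and half-saddle expansions are two instances of one lemma
    of Watson type, [watson_ray]. *)

(** * Complex-valued functions of a real variable *)

(** Because the primitive is explicit, path independence costs only the fundamental theorem of
    calculus: the paths are chains of straight segments, each a function of one real variable.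
    Complex differentiability and Cauchy's theorem never enter, and derivative, continuity and
    integral can be taken on real and imaginary parts. On a ray [z = s d] every local integrand is
    [e^(n (w z + log(1-z))) (1-z)^v]. Its phase starts with [-(1-w) z], and at [w = 1] with
    [-z^2/2]. Hence the exponent in [watson_ray]: degree 1 with large parameter [n], or degree 2
    with large parameter [sqrt n], which is where the half-integral error exponents come from. The
    detour through [w + delta] is forced. On the vertical line through [w], [|u^n e^(-nu)|] grows
    with [|Im u|], so a vertical side ending at [w] would not be negligible. To the right of [w] it
    decays, since the derivative [1/w - 1] of [log u - u] has negative real part there; this fails
    in [Re w >= 1] only at [w = 1]. *)

Definition Cder (f : R -> C) (x : R) (l : C) : Prop :=
  is_derive (fun t => Re (f t)) x (Re l) /\ is_derive (fun t => Im (f t)) x (Im l).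

Definition Ccont (f : R -> C) (x : R) : Prop :=
  continuous (fun t => Re (f t)) x /\ continuous (fun t => Im (f t)) x.

Definition Cint (f : R -> C) (a b : R) (l : C) : Prop :=
  is_RInt (fun t => Re (f t)) a b (Re l) /\ is_RInt (fun t => Im (f t)) a b (Im l).

Lemma Re_plus (x y : C) : Re (x + y)%C = Re x + Re y. Proof. reflexivity. Qed.
Lemma Im_plus (x y : C) : Im (x + y)%C = Im x + Im y. Proof. reflexivity. Qed.
Lemma Re_opp (x : C) : Re (- x)%C = - Re x. Proof. reflexivity. Qed.
Lemma Re_minus (x y : C) : Re (x - y)%C = Re x - Re y. Proof. reflexivity. Qed.
Lemma Re_mult (x y : C) : Re (x * y)%C = Re x * Re y - Im x * Im y. Proof. reflexivity. Qed.
Lemma Im_mult (x y : C) : Im (x * y)%C = Re x * Im y + Im x * Re y. Proof. reflexivity. Qed.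
Lemma Re_RtoC (x : R) : Re (RtoC x) = x. Proof. reflexivity. Qed.
Lemma Im_RtoC (x : R) : Im (RtoC x) = 0. Proof. reflexivity. Qed.

Lemma C_eq (x y : C) : Re x = Re y -> Im x = Im y -> x = y.
Proof. destruct x, y; simpl; congruence. Qed.

Lemma Re_le_Cmod (z : C) : Re z <= Cmod z.
Proof. generalize (re_le_Cmod z); intros H; apply Rle_trans with (2 := H); apply Rle_abs. Qed.

Lemma Cmod_pos (z : C) : z <> 0%C -> 0 < Cmod z.
Proof. apply Cmod_gt_0. Qed.

Lemma Cmod_RtoC_pos (x : R) : 0 <= x -> Cmod (RtoC x) = x.
Proof. intros; rewrite Cmod_R; apply Rabs_pos_eq; auto. Qed.

Lemma Cmod_triangle_minus (x y : C) : Cmod (x - y)%C <= Cmod x + Cmod y.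
Proof. unfold Cminus; rewrite <- (Cmod_opp y); apply Cmod_triangle. Qed.

Lemma RtoC_neq0 (x : R) : x <> 0 -> RtoC x <> 0%C.
Proof. intros H E; apply H; exact (f_equal fst E). Qed.

(** * The complex exponential *)

Lemma Cexp_plus (x y : C) : Cexp (x + y)%C = (Cexp x * Cexp y)%C.
Proof.
  unfold Cexp; apply C_eq; rewrite ?Re_mult, ?Im_mult; unfold Re, Im; simpl;
    rewrite exp_plus, ?cos_plus, ?sin_plus; ring.
Qed.

Lemma Cexp_0 : Cexp 0%C = 1%C.
Proof. unfold Cexp; simpl; rewrite exp_0, cos_0, sin_0; apply C_eq; simpl; ring. Qed.

Lemma Cexp_opp (x : C) : Cexp (- x)%C = (/ Cexp x)%C.
Proof.
  assert (H : (Cexp x * Cexp (- x) = 1)%C).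
  { rewrite <- Cexp_plus. replace (x + - x)%C with (RtoC 0) by ring. apply Cexp_0. }
  assert (Hx : Cexp x <> 0%C).
  { intros E; rewrite E in H. apply (f_equal fst) in H; simpl in H; lra. }
  apply (f_equal (fun z => / Cexp x * z)%C) in H. rewrite Cmult_assoc, Cinv_l in H by auto.
  rewrite Cmult_1_l, Cmult_1_r in H. exact H.
Qed.

Lemma Cexp_neq0 (x : C) : Cexp x <> 0%C.
Proof.
  intros E. assert (H : (Cexp x * Cexp (- x) = 1)%C).
  { rewrite <- Cexp_plus. replace (x + - x)%C with (RtoC 0) by ring. apply Cexp_0. }
  rewrite E in H. apply (f_equal fst) in H; simpl in H; lra.
Qed.

Lemma Cmod_Cexp (z : C) : Cmod (Cexp z) = exp (Re z).
Proof.
  unfold Cexp, Cmod; simpl.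
  replace (_ + _) with (exp (Re z) * exp (Re z) * (Rsqr (sin (Im z)) + Rsqr (cos (Im z))))
    by (unfold Rsqr; ring).
  rewrite sin2_cos2, Rmult_1_r, sqrt_square; auto. left; apply exp_pos.
Qed.

Lemma Cexp_RtoC (x : R) : Cexp (RtoC x) = RtoC (exp x).
Proof. unfold Cexp; simpl; rewrite cos_0, sin_0; apply C_eq; simpl; ring. Qed.

(** * Rules of differentiation *)

Lemma Cder_const (c : C) (x : R) : Cder (fun _ => c) x 0%C.
Proof. split; simpl; apply (is_derive_const (V := R_NormedModule)). Qed.

Lemma Cder_plus (f g : R -> C) (x : R) (l m : C) :
  Cder f x l -> Cder g x m -> Cder (fun t => f t + g t)%C x (l + m)%C.
Proof.
  intros [a b] [c d]; split; simpl.
  - apply (is_derive_plus (V := R_NormedModule) _ _ _ _ _ a c).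
  - apply (is_derive_plus (V := R_NormedModule) _ _ _ _ _ b d).
Qed.

Lemma Cder_ext_val (f : R -> C) (x : R) (l m : C) : Cder f x l -> l = m -> Cder f x m.
Proof. intros; subst; auto. Qed.

Lemma Cder_ext (f g : R -> C) (x : R) (l : C) :
  (forall t, f t = g t) -> Cder f x l -> Cder g x l.
Proof.
  intros H [a b]; split.
  - eapply is_derive_ext; [ | exact a]; intros; simpl; rewrite H; auto.
  - eapply is_derive_ext; [ | exact b]; intros; simpl; rewrite H; auto.
Qed.

Lemma Cder_ext_loc (f g : R -> C) (x : R) (l : C) :
  locally x (fun t => f t = g t) -> Cder f x l -> Cder g x l.
Proof.
  intros H [a b]; split.
  - eapply is_derive_ext_loc; [ | exact a].
    eapply filter_imp; [ | exact H]; intros t Ht; simpl; rewrite Ht; auto.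
  - eapply is_derive_ext_loc; [ | exact b].
    eapply filter_imp; [ | exact H]; intros t Ht; simpl; rewrite Ht; auto.
Qed.

Lemma Cder_mult (f g : R -> C) (x : R) (l m : C) :
  Cder f x l -> Cder g x m -> Cder (fun t => f t * g t)%C x (l * g x + f x * m)%C.
Proof.
  intros [a b] [c d]; split.
  - assert (H1 := is_derive_mult _ _ _ _ _ a c Rmult_comm).
    assert (H2 := is_derive_mult _ _ _ _ _ b d Rmult_comm).
    assert (H3 := is_derive_minus (V := R_NormedModule) _ _ _ _ _ H1 H2).
    match type of H3 with is_derive _ _ ?u => replace (Re (l * g x + f x * m)%C) with u end.
    exact H3. rewrite Re_plus, !Re_mult. unfold minus, plus, opp, mult; simpl; ring.
  - assert (H1 := is_derive_mult _ _ _ _ _ a d Rmult_comm).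
    assert (H2 := is_derive_mult _ _ _ _ _ b c Rmult_comm).
    assert (H3 := is_derive_plus (V := R_NormedModule) _ _ _ _ _ H1 H2).
    match type of H3 with is_derive _ _ ?u => replace (Im (l * g x + f x * m)%C) with u end.
    exact H3. rewrite Im_plus, !Im_mult. unfold minus, plus, opp, mult; simpl; ring.
Qed.

Lemma Cder_scal (c : C) (f : R -> C) (x : R) (l : C) :
  Cder f x l -> Cder (fun t => c * f t)%C x (c * l)%C.
Proof.
  intros H. eapply Cder_ext_val. apply (Cder_mult _ _ _ _ _ (Cder_const c x) H). cbv beta; ring.
Qed.

Lemma Cder_id (x : R) : Cder (fun t => RtoC t) x 1%C.
Proof.
  split; simpl. apply (is_derive_id (K := R_AbsRing)). apply (is_derive_const (V := R_NormedModule)).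
Qed.

Lemma Cder_lin (p q : C) (x : R) : Cder (fun t => p + RtoC t * q)%C x q.
Proof.
  eapply Cder_ext_val.
  apply Cder_plus. apply Cder_const. apply Cder_mult. apply Cder_id. apply Cder_const. cbv beta; ring.
Qed.

Lemma Cder_exp (f : R -> C) (x : R) (l : C) :
  Cder f x l -> Cder (fun t => Cexp (f t)) x (l * Cexp (f x))%C.
Proof.
  intros [a b]; split; unfold Cexp; simpl.
  - evar_last. apply (is_derive_mult (fun t => exp (Re (f t))) (fun t => cos (Im (f t)))).
    apply (is_derive_comp exp). apply is_derive_exp. exact a.
    apply (is_derive_comp cos). apply is_derive_cos. exact b. apply Rmult_comm.
    unfold plus, scal, mult; simpl; unfold mult; simpl. unfold Re, Im; ring.
  - evar_last. apply (is_derive_mult (fun t => exp (Re (f t))) (fun t => sin (Im (f t)))).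
    apply (is_derive_comp exp). apply is_derive_exp. exact a.
    apply (is_derive_comp sin). apply is_derive_sin. exact b. apply Rmult_comm.
    unfold plus, scal, mult; simpl; unfold mult; simpl. unfold Re, Im; ring.
Qed.

Lemma Ccont_der (f : R -> C) (x : R) (l : C) : Cder f x l -> Ccont f x.
Proof.
  intros [a b]; split; apply (ex_derive_continuous (K := R_AbsRing) (V := R_NormedModule));
    eexists; eassumption.
Qed.

(** On [Re > 0], which persists near [x], the principal logarithm is [ln(x^2+y^2)/2 + i atan(y/x)],
    and both parts are differentiated by real calculus. *)
Lemma Cder_log (f : R -> C) (x : R) (l : C) :
  0 < Re (f x) -> Cder f x l -> Cder (fun t => Clog (f t)) x (l / f x)%C.
Proof.
  intros Hp H. destruct (Ccont_der _ _ _ H) as [Hc _]. destruct H as [a b].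
  assert (Hl : locally x (fun t => 0 < Re (f t))).
  { apply Hc. apply open_gt. exact Hp. }
  set (u := fun t => Re (f t)) in *. set (w := fun t => Im (f t)) in *.
  change (0 < u x) in Hp.
  assert (Hs : 0 < u x * u x + w x * w x) by nra.
  assert (Hq : Re (l / f x)%C = (Re l * u x + Im l * w x) / (u x * u x + w x * w x)).
  { unfold u, w, Cdiv, Cinv, Re, Im in *; simpl; field. simpl in Hs; nra. }
  assert (Hr : Im (l / f x)%C = (Im l * u x - Re l * w x) / (u x * u x + w x * w x)).
  { unfold u, w, Cdiv, Cinv, Re, Im in *; simpl; field. simpl in Hs; nra. }
  split.
  - rewrite Hq.
    apply (is_derive_ext_loc (fun t => / 2 * ln (u t * u t + w t * w t))).
    + eapply filter_imp; [ | exact Hl]. intros t Ht. change (0 < u t) in Ht. simpl.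
      unfold Cmod. change (fst (f t)) with (u t). change (snd (f t)) with (w t).
      assert (0 < u t * u t + w t * w t) by nra.
      replace (u t ^ 2 + w t ^ 2) with (u t * u t + w t * w t) by ring.
      rewrite <- (sqrt_sqrt (u t * u t + w t * w t)) at 1 by lra.
      rewrite ln_mult by (apply sqrt_lt_R0; auto). lra.
    + assert (E1 : ex_derive u x) by (eexists; exact a).
      assert (E2 : ex_derive w x) by (eexists; exact b).
      auto_derive.
      * repeat split; auto.
      * replace (Derive (fun x0 => u x0) x) with (Re l) by (symmetry; apply is_derive_unique; exact a).
        replace (Derive (fun x0 => w x0) x) with (Im l) by (symmetry; apply is_derive_unique; exact b).
        field. lra.
  - rewrite Hr.
    apply (is_derive_ext_loc (fun t => atan (w t / u t))).
    + eapply filter_imp; [ | exact Hl]. intros t Ht. change (0 < u t) in Ht. simpl.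
      unfold Carg. change (Re (f t)) with (u t). change (Im (f t)) with (w t).
      destruct (Rlt_dec 0 (u t)); [reflexivity | contradiction].
    + assert (E1 : ex_derive u x) by (eexists; exact a).
      assert (E2 : ex_derive w x) by (eexists; exact b).
      auto_derive.
      * repeat split; auto. lra.
      * replace (Derive (fun x0 => u x0) x) with (Re l) by (symmetry; apply is_derive_unique; exact a).
        replace (Derive (fun x0 => w x0) x) with (Im l) by (symmetry; apply is_derive_unique; exact b).
        field. split; [ | lra]. nra.
Qed.

Lemma Ccont_const (c : C) (x : R) : Ccont (fun _ => c) x.
Proof. split; apply continuous_const. Qed.

Lemma Ccont_plus (f g : R -> C) (x : R) :
  Ccont f x -> Ccont g x -> Ccont (fun t => f t + g t)%C x.
Proof.
  intros [a b] [c d]; split.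
  - apply (continuous_plus (V := R_NormedModule) _ _ _ a c).
  - apply (continuous_plus (V := R_NormedModule) _ _ _ b d).
Qed.

Lemma Ccont_mult (f g : R -> C) (x : R) :
  Ccont f x -> Ccont g x -> Ccont (fun t => f t * g t)%C x.
Proof.
  intros [a b] [c d]; split.
  - apply (continuous_minus (V := R_NormedModule) (fun t => Re (f t) * Re (g t))
             (fun t => Im (f t) * Im (g t))).
    apply (continuous_mult (K := R_AbsRing) _ _ _ a c).
    apply (continuous_mult (K := R_AbsRing) _ _ _ b d).
  - apply (continuous_plus (V := R_NormedModule) (fun t => Re (f t) * Im (g t))
             (fun t => Im (f t) * Re (g t))).
    apply (continuous_mult (K := R_AbsRing) _ _ _ a d).
    apply (continuous_mult (K := R_AbsRing) _ _ _ b c).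
Qed.

Lemma Ccont_ext (f g : R -> C) (x : R) :
  (forall t, f t = g t) -> Ccont f x -> Ccont g x.
Proof.
  intros H [a b]; split.
  - apply (continuous_ext (fun t => Re (f t))); auto. intros; rewrite H; auto.
  - apply (continuous_ext (fun t => Im (f t))); auto. intros; rewrite H; auto.
Qed.

(** * Integrals and their bounds *)

Lemma Cint_RInt (f : R -> C) (a b : R) (l : C) :
  Cint f a b l -> RInt (V := C_R_CompleteNormedModule) f a b = l.
Proof.
  intros [H1 H2]. apply is_RInt_unique. destruct l.
  apply (is_RInt_fct_extend_pair (U := R_NormedModule) (V := R_NormedModule)); auto.
Qed.

Lemma Cint_unique (f : R -> C) (a b : R) (l m : C) : Cint f a b l -> Cint f a b m -> l = m.
Proof. intros H1 H2. rewrite <- (Cint_RInt _ _ _ _ H1). apply Cint_RInt; auto. Qed.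

Lemma Cint_ex (f : R -> C) (a b : R) :
  a <= b -> (forall x, a <= x <= b -> Ccont f x) -> exists l, Cint f a b l.
Proof.
  intros Hab H.
  destruct (ex_RInt_continuous (V := R_CompleteNormedModule) (fun t => Re (f t)) a b) as [l1 H1].
  { intros z; rewrite Rmin_left, Rmax_right by auto; intros; apply H; auto. }
  destruct (ex_RInt_continuous (V := R_CompleteNormedModule) (fun t => Im (f t)) a b) as [l2 H2].
  { intros z; rewrite Rmin_left, Rmax_right by auto; intros; apply H; auto. }
  exists (l1, l2); split; auto.
Qed.

Lemma Cint_FTC (F f : R -> C) (a b : R) :
  a <= b -> (forall x, a <= x <= b -> Cder F x (f x)) ->
  (forall x, a <= x <= b -> Ccont f x) -> Cint f a b (F b - F a)%C.
Proof.
  intros Hab H1 H2; split.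
  - apply (is_RInt_derive (V := R_CompleteNormedModule) (fun t => Re (F t)) (fun t => Re (f t)));
    intros x; rewrite Rmin_left, Rmax_right by auto; intros; [apply H1 | apply H2]; auto.
  - apply (is_RInt_derive (V := R_CompleteNormedModule) (fun t => Im (F t)) (fun t => Im (f t)));
    intros x; rewrite Rmin_left, Rmax_right by auto; intros; [apply H1 | apply H2]; auto.
Qed.

Lemma Cint_ext (f g : R -> C) (a b : R) (l : C) :
  a <= b -> (forall x, a < x < b -> f x = g x) -> Cint f a b l -> Cint g a b l.
Proof.
  intros Hab H [H1 H2]; split; eapply is_RInt_ext; try eassumption; simpl;
    intros x; rewrite Rmin_left, Rmax_right by auto; intros; rewrite H; auto.
Qed.

Lemma Cint_plus (f g : R -> C) (a b : R) (l m : C) :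
  Cint f a b l -> Cint g a b m -> Cint (fun t => f t + g t)%C a b (l + m)%C.
Proof.
  intros [H1 H2] [H3 H4]; split.
  - apply (is_RInt_plus (V := R_NormedModule) _ _ _ _ _ _ H1 H3).
  - apply (is_RInt_plus (V := R_NormedModule) _ _ _ _ _ _ H2 H4).
Qed.

Lemma Cint_scal (c : C) (f : R -> C) (a b : R) (l : C) :
  Cint f a b l -> Cint (fun t => c * f t)%C a b (c * l)%C.
Proof.
  intros [H1 H2]; split.
  - apply (is_RInt_minus (V := R_NormedModule) (fun t => Re c * Re (f t)) (fun t => Im c * Im (f t))).
    apply (is_RInt_scal (V := R_NormedModule) _ _ _ (Re c) _ H1).
    apply (is_RInt_scal (V := R_NormedModule) _ _ _ (Im c) _ H2).
  - apply (is_RInt_plus (V := R_NormedModule) (fun t => Re c * Im (f t)) (fun t => Im c * Re (f t))).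
    apply (is_RInt_scal (V := R_NormedModule) _ _ _ (Re c) _ H2).
    apply (is_RInt_scal (V := R_NormedModule) _ _ _ (Im c) _ H1).
Qed.

Lemma Cint_minus (f g : R -> C) (a b : R) (l m : C) :
  a <= b -> Cint f a b l -> Cint g a b m -> Cint (fun t => f t - g t)%C a b (l - m)%C.
Proof.
  intros Hab H1 H2.
  apply (Cint_ext (fun t => f t + (-1) * g t)%C); auto. intros; ring.
  replace (l - m)%C with (l + (-1) * m)%C by ring.
  apply Cint_plus; auto. apply Cint_scal; auto.
Qed.

Lemma Cint_Chasles (f : R -> C) (a b c : R) (l m : C) :
  Cint f a b l -> Cint f b c m -> Cint f a c (l + m)%C.
Proof.
  intros [H1 H2] [H3 H4]; split.
  - apply (is_RInt_Chasles (V := R_NormedModule) _ _ _ _ _ _ H1 H3).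
  - apply (is_RInt_Chasles (V := R_NormedModule) _ _ _ _ _ _ H2 H4).
Qed.

(* Rotating by the phase of [l] reduces this to the comparison of real integrals. *)
Lemma Cint_Cmod_le (f : R -> C) (g : R -> R) (a b : R) (l : C) (m : R) :
  a <= b -> (forall x, a < x < b -> Cmod (f x) <= g x) ->
  Cint f a b l -> is_RInt g a b m -> Cmod l <= m.
Proof.
  intros Hab H Hf Hg.
  set (u := (Cconj l / RtoC (Cmod l))%C).
  assert (Hm0 : 0 <= m).
  { replace 0 with (scal (b - a) 0 : R) by (unfold scal; simpl; unfold mult; simpl; ring).
    apply (is_RInt_le (fun _ => 0) g a b); auto. apply (is_RInt_const (V := R_NormedModule)).
    intros x Hx. apply Rle_trans with (2 := H x Hx). apply Cmod_ge_0. }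
  destruct (Req_dec (Cmod l) 0) as [E | E]. rewrite E; auto.
  assert (Hl : 0 < Cmod l) by (generalize (Cmod_ge_0 l); lra).
  assert (Hu : Cmod u = 1).
  { unfold u. rewrite Cmod_div by (apply RtoC_neq0; auto).
    rewrite Cmod_conj, Cmod_RtoC_pos by lra. field; auto. }
  assert (Hul : (u * l)%C = RtoC (Cmod l)).
  { unfold u. transitivity ((l * Cconj l) / RtoC (Cmod l))%C.
    field; apply RtoC_neq0; auto.
    rewrite <- Cmod2_conj, <- RtoC_div by auto. f_equal. simpl; field; auto. }
  destruct (Cint_scal u f a b l Hf) as [H1 _].
  rewrite Hul in H1. simpl in H1.
  apply (is_RInt_le (fun t => Re (u * f t)%C) g a b); auto.
  intros x Hx. apply Rle_trans with (2 := H x Hx).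
  apply Rle_trans with (1 := Re_le_Cmod _). rewrite Cmod_mult, Hu; lra.
Qed.

Lemma Cint_Cmod_le_const (f : R -> C) (a b : R) (l : C) (M : R) :
  a <= b -> (forall x, a < x < b -> Cmod (f x) <= M) -> Cint f a b l -> Cmod l <= M * (b - a).
Proof.
  intros Hab H Hf. apply (Cint_Cmod_le f (fun _ => M) a b); auto.
  replace (M * (b - a)) with (scal (b - a) M : R) by (unfold scal; simpl; unfold mult; simpl; ring).
  apply (is_RInt_const (V := R_NormedModule)).
Qed.

(** The mean value equality fails for complex values; the inequality comes from integrating the
    derivative. *)
Lemma Cder_mean_value (F f : R -> C) (a b M : R) :
  a <= b -> (forall x, a <= x <= b -> Cder F x (f x)) ->
  (forall x, a <= x <= b -> Ccont f x) -> (forall x, a < x < b -> Cmod (f x) <= M) ->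
  Cmod (F b - F a)%C <= M * (b - a).
Proof. intros. eapply Cint_Cmod_le_const; try eassumption. apply Cint_FTC; auto. Qed.

(** * Finite sums, Taylor expansions and truncated power series *)

Lemma Csum_ext (f g : nat -> C) (n : nat) :
  (forall i, (i < n)%nat -> f i = g i) -> Csum f n = Csum g n.
Proof. induction n; intros H; simpl; auto. rewrite IHn, H; auto. Qed.

Lemma Csum_plus (f g : nat -> C) (n : nat) :
  Csum (fun i => f i + g i)%C n = (Csum f n + Csum g n)%C.
Proof. induction n; simpl; [ | rewrite IHn]; ring. Qed.

Lemma Csum_scal (c : C) (f : nat -> C) (n : nat) :
  Csum (fun i => c * f i)%C n = (c * Csum f n)%C.
Proof. induction n; simpl; [ | rewrite IHn]; ring. Qed.

Lemma Csum_minus (f g : nat -> C) (n : nat) :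
  Csum (fun i => f i - g i)%C n = (Csum f n - Csum g n)%C.
Proof. induction n; simpl; [ | rewrite IHn]; ring. Qed.

Lemma Csum_zero (f : nat -> C) (n : nat) :
  (forall i, (i < n)%nat -> f i = 0%C) -> Csum f n = 0%C.
Proof. induction n; intros H; simpl; auto. rewrite IHn, H; auto. ring. Qed.

Lemma Csum_exchange (f : nat -> nat -> C) (n m : nat) :
  Csum (fun i => Csum (fun j => f i j) m) n = Csum (fun j => Csum (fun i => f i j) n) m.
Proof.
  induction n; simpl. symmetry; apply Csum_zero; auto.
  rewrite IHn, <- Csum_plus; auto.
Qed.

Lemma Csum_S_l (f : nat -> C) (n : nat) :
  Csum f (S n) = (f 0%nat + Csum (fun i => f (S i)) n)%C.
Proof.
  induction n. simpl; ring.
  change (Csum f (S (S n))) with (Csum f (S n) + f (S n))%C. rewrite IHn. simpl; ring.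
Qed.

Lemma Csum_extend (f : nat -> C) (n m : nat) :
  (n <= m)%nat -> (forall i, (n <= i < m)%nat -> f i = 0%C) -> Csum f m = Csum f n.
Proof.
  induction 1; intros Hz; auto. simpl. rewrite IHle, Hz by (intros; try apply Hz; lia). ring.
Qed.

Lemma Cmod_Csum (f : nat -> C) (B : R) (n : nat) :
  (forall i, (i < n)%nat -> Cmod (f i) <= B) -> Cmod (Csum f n) <= INR n * B.
Proof.
  induction n; intros H. simpl; rewrite Cmod_0; lra.
  rewrite S_INR. simpl Csum. apply Rle_trans with (1 := Cmod_triangle _ _).
  specialize (IHn (fun i Hi => H i (Nat.lt_lt_succ_r _ _ Hi))).
  generalize (H n (Nat.lt_succ_diag_r n)); lra.
Qed.

Lemma Cint_Csum (f : nat -> R -> C) (l : nat -> C) (a b : R) (n : nat) :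
  (forall i, (i < n)%nat -> Cint (f i) a b (l i)) ->
  Cint (fun t => Csum (fun i => f i t) n) a b (Csum l n).
Proof.
  induction n; intros H; simpl.
  - split; simpl; (evar_last; [apply (is_RInt_const (V := R_NormedModule)) | ];
      unfold scal; simpl; unfold mult; simpl; ring).
  - apply Cint_plus; auto.
Qed.

Lemma Cder_Csum (f : nat -> R -> C) (l : nat -> C) (x : R) (n : nat) :
  (forall i, (i < n)%nat -> Cder (f i) x (l i)) ->
  Cder (fun t => Csum (fun i => f i t) n) x (Csum l n).
Proof.
  induction n; intros H; simpl. apply Cder_const. apply Cder_plus; auto.
Qed.

Lemma Cder_pow (f : R -> C) (x : R) (l : C) (n : nat) :
  Cder f x l -> Cder (fun t => f t ^ S n)%C x (RtoC (INR (S n)) * f x ^ n * l)%C.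
Proof.
  intros H. induction n.
  - eapply Cder_ext_val. eapply Cder_ext; [ | exact H]. intros; simpl; ring. simpl; ring.
  - eapply Cder_ext_val. eapply Cder_ext; [ | exact (Cder_mult _ _ _ _ _ H IHn)].
    intros; reflexivity. cbv beta. rewrite (S_INR (S n)), RtoC_plus. rewrite !Cpow_S. ring.
Qed.

(** The decay rate is split into two halves: one absorbs a factor [y] through [x < e^x], the other
    goes to the induction hypothesis. *)
Lemma pow_exp_bound (i : nat) : forall b : R, 0 < b ->
  exists K, 0 < K /\ forall y, 0 <= y -> y ^ i * exp (- b * y) <= K.
Proof.
  induction i; intros b Hb.
  - exists 1; split; [lra | ]. intros y Hy. simpl. rewrite Rmult_1_l.
    rewrite <- exp_0. destruct (Req_dec y 0). subst; right; f_equal; ring.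
    left; apply exp_increasing; nra.
  - destruct (IHi (b / 2)) as [K [HK H]]. lra.
    exists (2 / b * K); split.
    + apply Rmult_lt_0_compat; auto. apply Rdiv_lt_0_compat; lra.
    + intros y Hy. replace (- b * y) with (- (b / 2) * y + - (b / 2) * y) by field.
      rewrite exp_plus. simpl.
      replace (y * y ^ i * (exp (- (b / 2) * y) * exp (- (b / 2) * y)))
        with ((y * exp (- (b / 2) * y)) * (y ^ i * exp (- (b / 2) * y))) by ring.
      apply Rmult_le_compat.
      * apply Rmult_le_pos; auto. left; apply exp_pos.
      * apply Rmult_le_pos. apply pow_le; auto. left; apply exp_pos.
      * replace (- (b / 2) * y) with (- (b / 2 * y)) by ring. rewrite exp_Ropp.
        assert (Hx : b / 2 * y < exp (b / 2 * y)).
        { destruct (Req_dec y 0). subst. rewrite Rmult_0_r, exp_0; lra.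
          assert (0 < b / 2 * y) by nra.
          generalize (exp_ineq1 (b / 2 * y)); lra. }
        apply (Rmult_le_reg_r (exp (b / 2 * y))). apply exp_pos.
        rewrite Rmult_assoc, Rinv_l, Rmult_1_r.
        2: generalize (exp_pos (b / 2 * y)); lra.
        apply (Rmult_le_reg_l (b / 2)). lra.
        replace (b / 2 * (2 / b * exp (b / 2 * y))) with (exp (b / 2 * y)) by (field; lra).
        lra.
      * apply H; auto.
Qed.

Definition expT (K : nat) (X : C) : C :=
  Csum (fun k => X ^ k / RtoC (INR (fact k)))%C K.

Lemma INR_fact_C_neq0 (k : nat) : RtoC (INR (fact k)) <> 0%C.
Proof. apply RtoC_neq0, INR_fact_neq_0. Qed.

Lemma expT_S_0 (K : nat) : expT (S K) 0%C = 1%C.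
Proof.
  unfold expT. rewrite Csum_S_l, Csum_zero.
  - simpl. field.
  - intros; simpl. field. apply (INR_fact_C_neq0 (S i)).
Qed.

Lemma Cder_expT (K : nat) (X : C) (t : R) :
  Cder (fun t => expT (S K) (RtoC t * X)%C) t (X * expT K (RtoC t * X))%C.
Proof.
  apply (Cder_ext (fun t => 1 + Csum (fun k => / RtoC (INR (fact (S k))) * (RtoC t * X) ^ S k) K)%C).
  { intros u. unfold expT. rewrite (Csum_S_l _ K). f_equal.
    - simpl. field.
    - apply Csum_ext; intros. unfold Cdiv; ring. }
  eapply Cder_ext_val. apply Cder_plus. apply Cder_const.
  apply Cder_Csum. intros. apply Cder_scal. apply Cder_pow.
  apply Cder_mult. apply Cder_id. apply Cder_const.
  cbv beta. unfold expT. rewrite Cplus_0_l, <- Csum_scal. apply Csum_ext. intros.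
  change (fact (S i)) with (S i * fact i)%nat. rewrite mult_INR, RtoC_mult. field.
  split. apply INR_fact_C_neq0. apply RtoC_neq0. apply not_0_INR; lia.
Qed.

(** [expT K] has [K] terms, so the remainder of order [S K] along [t X] vanishes at 0 and has [X]
    times the remainder of order [K] as derivative. The induction therefore runs over all [t] in
    [[0,1]]; bounding each integral by its supremum gives up the factor [1/K!]. *)
Lemma Cexp_Taylor (X : C) (K : nat) :
  Cmod (Cexp X - expT K X)%C <= Cmod X ^ K * exp (Cmod X).
Proof.
  assert (H : forall t, 0 <= t <= 1 ->
    Cmod (Cexp (RtoC t * X) - expT K (RtoC t * X))%C <= Cmod X ^ K * exp (Cmod X)).
  2: { generalize (H 1); rewrite Cmult_1_l; intros H1; apply H1; lra. }
  induction K; intros t Ht.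
  - unfold expT; simpl.
    replace (Cexp (RtoC t * X) - 0)%C with (Cexp (RtoC t * X)) by ring.
    rewrite Cmod_Cexp, Rmult_1_l. apply Rle_trans with (exp (Cmod (RtoC t * X)%C)).
    destruct (Req_dec (Re (RtoC t * X)%C) (Cmod (RtoC t * X)%C)) as [E | E].
    rewrite E; lra. left; apply exp_increasing. generalize (Re_le_Cmod (RtoC t * X)%C); lra.
    rewrite Cmod_mult, Cmod_RtoC_pos by lra.
    destruct (Req_dec (t * Cmod X) (Cmod X)) as [E | E]. rewrite E; lra.
    left; apply exp_increasing. generalize (Cmod_ge_0 X); nra.
  - set (F := fun t => (Cexp (RtoC t * X) + (-1) * expT (S K) (RtoC t * X))%C).
    set (f := fun t => (X * (Cexp (RtoC t * X) - expT K (RtoC t * X)))%C).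
    assert (HF : forall x, Cder F x (f x)).
    { intros x. unfold F, f. eapply Cder_ext_val. apply Cder_plus.
      apply Cder_exp. apply Cder_mult. apply Cder_id. apply Cder_const.
      apply Cder_scal. apply Cder_expT. cbv beta. ring. }
    assert (Hf : forall x, Ccont f x).
    { intros x. unfold f. apply Ccont_mult. apply Ccont_const.
      unfold Cminus. apply Ccont_plus.
      eapply Ccont_der. apply Cder_exp. apply Cder_mult. apply Cder_id. apply Cder_const.
      destruct K.
      - apply (Ccont_ext (fun _ => 0%C)). intros; unfold expT; simpl; ring. apply Ccont_const.
      - apply (Ccont_ext (fun t => (-1) * expT (S K) (RtoC t * X))%C). intros; ring.
        apply Ccont_mult. apply Ccont_const. eapply Ccont_der. apply Cder_expT. }
    replace (Cexp (RtoC t * X) - expT (S K) (RtoC t * X))%C with (F t - F 0)%C.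
    2: { unfold F. rewrite Cmult_0_l, expT_S_0, Cexp_0. ring. }
    apply Rle_trans with (Cmod X ^ S K * exp (Cmod X) * (t - 0)).
    apply (Cder_mean_value F f 0 t); auto; try lra.
    intros x Hx. unfold f. rewrite Cmod_mult. simpl. rewrite Rmult_assoc.
    apply Rmult_le_compat_l. apply Cmod_ge_0. apply IHK. lra.
    assert (0 <= Cmod X ^ S K * exp (Cmod X)).
    { apply Rmult_le_pos. apply pow_le, Cmod_ge_0. left; apply exp_pos. }
    nra.
Qed.

(** * Truncated power series and expansions along a ray *)

Definition psT (a : nat -> C) (J : nat) (z : C) : C := Csum (fun j => a j * z ^ j)%C J.

Lemma psT_S (a : nat -> C) (J : nat) (z : C) :
  psT a (S J) z = (a 0%nat + z * psT (fun j => a (S j)) J z)%C.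
Proof.
  unfold psT. rewrite Csum_S_l, <- Csum_scal. f_equal. simpl; ring.
  apply Csum_ext; intros; simpl; ring.
Qed.

Lemma psT_bounded (a : nat -> C) (J : nat) (rr : R) :
  exists K, 0 <= K /\ forall z, Cmod z <= rr -> Cmod (psT a J z) <= K.
Proof.
  induction J.
  - exists 0; split; [lra | ]. intros; unfold psT; simpl; rewrite Cmod_0; lra.
  - destruct IHJ as [K [HK H]]. exists (K + Cmod (a J) * Rabs rr ^ J). split.
    + apply Rplus_le_le_0_compat; auto. apply Rmult_le_pos. apply Cmod_ge_0.
      apply pow_le, Rabs_pos.
    + intros z Hz. unfold psT; simpl. apply Rle_trans with (1 := Cmod_triangle _ _).
      apply Rplus_le_compat. apply H; auto. rewrite Cmod_mult, Cmod_pow.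
      apply Rmult_le_compat_l. apply Cmod_ge_0. apply pow_incr. split. apply Cmod_ge_0.
      apply Rle_trans with (1 := Hz), Rle_abs.
Qed.

Lemma ps_mul_S (a b : nat -> C) (j : nat) :
  ps_mul a b (S j) = (a 0%nat * b (S j) + ps_mul (fun i => a (S i)) b j)%C.
Proof. unfold ps_mul. rewrite Csum_S_l. reflexivity. Qed.

(** Removing the constant term of [a] leaves [z] times the same statement for the shifted series,
    plus [z] times the single top term [b_J z^J] of the other factor. The radius [rr] serves only to
    bound the shifted polynomial. *)
Lemma psT_mult (J : nat) : forall (a b : nat -> C) (rr : R),
  exists K, 0 <= K /\ forall z, Cmod z <= rr ->
    Cmod (psT a J z * psT b J z - psT (ps_mul a b) J z)%C <= K * Cmod z ^ J.
Proof.
  induction J; intros a b rr.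
  - exists 0; split; [lra | ]. intros z Hz. unfold psT; simpl.
    replace (0 * 0 - 0)%C with (RtoC 0) by ring. rewrite Cmod_0; lra.
  - destruct (IHJ (fun j => a (S j)) b rr) as [K [HK H]].
    destruct (psT_bounded (fun j => a (S j)) J rr) as [L [HL HB]].
    exists (K + L * Cmod (b J)). split.
    apply Rplus_le_le_0_compat; auto. apply Rmult_le_pos; auto. apply Cmod_ge_0.
    intros z Hz.
    assert (E : (psT a (S J) z * psT b (S J) z - psT (ps_mul a b) (S J) z =
      z * (psT (fun j => a (S j)) J z * psT b J z - psT (ps_mul (fun j => a (S j)) b) J z)
      + z * (psT (fun j => a (S j)) J z * (b J * z ^ J)))%C).
    { rewrite (psT_S (ps_mul a b)).
      assert (E1 : psT (fun j => ps_mul a b (S j)) J z =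
        (a 0%nat * psT (fun j => b (S j)) J z + psT (ps_mul (fun j => a (S j)) b) J z)%C).
      { unfold psT. rewrite <- Csum_scal, <- Csum_plus. apply Csum_ext. intros.
        rewrite ps_mul_S. ring. }
      rewrite E1. rewrite (psT_S a).
      assert (E2 : psT b (S J) z = (b 0%nat + z * psT (fun j => b (S j)) J z)%C) by apply psT_S.
      assert (E3 : psT b (S J) z = (psT b J z + b J * z ^ J)%C) by reflexivity.
      assert (E4 : ps_mul a b 0%nat = (a 0%nat * b 0%nat)%C) by (unfold ps_mul; simpl; ring).
      rewrite E4, Cmult_plus_distr_r. rewrite E2 at 1. rewrite E3. ring. }
    rewrite E. apply Rle_trans with (1 := Cmod_triangle _ _).
    rewrite (Cmod_mult z), (Cmod_mult z), Cmod_mult, Cmod_mult, Cmod_pow.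
    specialize (H z Hz). specialize (HB z Hz).
    assert (Hz0 := Cmod_ge_0 z). assert (Hb0 := Cmod_ge_0 (b J)).
    assert (HP : 0 <= Cmod z ^ J) by (apply pow_le; auto).
    simpl. rewrite Rmult_plus_distr_r. apply Rplus_le_compat.
    + replace (K * (Cmod z * Cmod z ^ J)) with (Cmod z * (K * Cmod z ^ J)) by ring.
      apply Rmult_le_compat_l; auto.
    + replace (L * Cmod (b J) * (Cmod z * Cmod z ^ J))
        with (Cmod z * (L * (Cmod (b J) * Cmod z ^ J))) by ring.
      apply Rmult_le_compat_l; auto. apply Rmult_le_compat_r; auto.
      apply Rmult_le_pos; auto.
Qed.

(** An asymptotic expansion in [z = s d], uniform up to [del]. The point [s = 0] is left out because
    [hray], the main instance, is a quotient by a power of [s]. *)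
Definition expands (f : R -> C) (d : C) (del : R) (a : nat -> C) (J : nat) : Prop :=
  exists K, 0 <= K /\
    forall s, 0 < s <= del -> Cmod (f s - psT a J (RtoC s * d))%C <= K * s ^ J.

Lemma Cmod_scaled (s : R) (d : C) : 0 <= s -> Cmod (RtoC s * d)%C = s * Cmod d.
Proof. intros; rewrite Cmod_mult, Cmod_RtoC_pos; auto. Qed.

Lemma expands_bounded (f : R -> C) (d : C) (del : R) (a : nat -> C) (J : nat) :
  expands f d del a J -> exists K, 0 <= K /\ forall s, 0 < s <= del -> Cmod (f s) <= K.
Proof.
  intros [K [HK H]]. destruct (psT_bounded a J (Rabs del * Cmod d)) as [L [HL HB]].
  exists (K * Rabs del ^ J + L). split.
  { apply Rplus_le_le_0_compat; auto. apply Rmult_le_pos; auto. apply pow_le, Rabs_pos. }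
  intros s Hs. replace (f s) with ((f s - psT a J (RtoC s * d)) + psT a J (RtoC s * d))%C by ring.
  apply Rle_trans with (1 := Cmod_triangle _ _). apply Rplus_le_compat.
  - apply Rle_trans with (1 := H s Hs). apply Rmult_le_compat_l; auto.
    apply pow_incr. split. lra. apply Rle_trans with (2 := Rle_abs _); lra.
  - apply HB. rewrite Cmod_scaled by lra. apply Rmult_le_compat_r. apply Cmod_ge_0.
    apply Rle_trans with (2 := Rle_abs _); lra.
Qed.

Lemma expands_mult (f g : R -> C) (d : C) (del : R) (a b : nat -> C) (J : nat) :
  expands f d del a J -> expands g d del b J ->
  expands (fun s => f s * g s)%C d del (ps_mul a b) J.
Proof.
  intros Hf Hg. destruct (expands_bounded _ _ _ _ _ Hf) as [Bf [HBf Hbf]].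
  destruct Hf as [K1 [HK1 H1]]. destruct Hg as [K2 [HK2 H2]].
  destruct (psT_bounded b J (Rabs del * Cmod d)) as [L [HL HB]].
  destruct (psT_mult J a b (Rabs del * Cmod d)) as [M [HM HP]].
  exists (Bf * K2 + L * K1 + M * Cmod d ^ J). split.
  { assert (0 <= Cmod d ^ J) by apply pow_le, Cmod_ge_0.
    assert (0 <= Bf * K2) by nra. assert (0 <= L * K1) by nra. nra. }
  intros s Hs. set (z := (RtoC s * d)%C).
  assert (Hz : Cmod z <= Rabs del * Cmod d).
  { unfold z. rewrite Cmod_scaled by lra. apply Rmult_le_compat_r. apply Cmod_ge_0.
    apply Rle_trans with (2 := Rle_abs _); lra. }
  replace (f s * g s - psT (ps_mul a b) J z)%C with
    (f s * (g s - psT b J z) + psT b J z * (f s - psT a J z)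
      + (psT a J z * psT b J z - psT (ps_mul a b) J z))%C by ring.
  assert (Hs0 : 0 <= s ^ J) by (apply pow_le; lra).
  specialize (HP z Hz). specialize (HB z Hz). specialize (Hbf s Hs).
  specialize (H1 s Hs). specialize (H2 s Hs). fold z in H1, H2.
  replace (Cmod z ^ J) with (s ^ J * Cmod d ^ J) in HP
    by (unfold z; rewrite Cmod_scaled, Rpow_mult_distr by lra; ring).
  apply Rle_trans with (1 := Cmod_triangle _ _).
  rewrite !Rmult_plus_distr_r. apply Rplus_le_compat.
  apply Rle_trans with (1 := Cmod_triangle _ _). rewrite !Cmod_mult.
  rewrite !(Rmult_assoc _ _ (s ^ J)).
  apply Rplus_le_compat; apply Rmult_le_compat; auto; apply Cmod_ge_0.
  apply Rle_trans with (1 := HP). right; ring.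
Qed.

Lemma expands_one (d : C) (del : R) (J : nat) : expands (fun _ => 1%C) d del ps_one J.
Proof.
  exists 1. split; [lra | ]. intros s Hs. destruct J.
  - unfold psT; simpl. replace (1 - 0)%C with (RtoC 1) by ring. rewrite Cmod_1; lra.
  - rewrite psT_S. replace (psT (fun j => ps_one (S j)) J (RtoC s * d))%C with (RtoC 0).
    2: { symmetry; apply Csum_zero; intros; unfold ps_one; simpl; ring. }
    unfold ps_one; simpl. replace (1 - (1 + RtoC s * d * 0))%C with (RtoC 0) by ring.
    rewrite Cmod_0. assert (0 <= s ^ J) by (apply pow_le; lra). nra.
Qed.

Lemma expands_pow (f : R -> C) (d : C) (del : R) (a : nat -> C) (J k : nat) :
  expands f d del a J -> expands (fun s => f s ^ k)%C d del (ps_pow a k) J.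
Proof.
  intros H. induction k; simpl. apply expands_one. apply expands_mult; auto.
Qed.

(** * Moments and Watson's lemma *)

(** Here [t] is the large parameter: [t = n] for [mu = 1] and [t = sqrt n] for [mu = 2]. *)
Definition kern (mu : nat) (a : C) (t s : R) : C :=
  Cexp (- a * (RtoC t * RtoC s) ^ mu)%C.

Lemma Cmod_kern (mu : nat) (a : C) (t s : R) :
  Cmod (kern mu a t s) = exp (- Re a * (t * s) ^ mu).
Proof.
  unfold kern. rewrite Cmod_Cexp. f_equal. rewrite <- RtoC_mult, <- RtoC_pow.
  rewrite Re_mult, Re_RtoC, Im_RtoC, Re_opp. ring.
Qed.

Lemma Cder_kern (q : nat) (a : C) (t s : R) :
  Cder (kern (S q) a t) s
    (- a * (RtoC (INR (S q)) * (RtoC t * RtoC s) ^ q * RtoC t) * kern (S q) a t s)%C.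
Proof.
  unfold kern. apply Cder_exp. apply Cder_scal. apply Cder_pow.
  eapply Cder_ext_val. apply Cder_scal. apply Cder_id. ring.
Qed.

Lemma Ccont_kern (mu : nat) (a : C) (t s : R) : Ccont (kern mu a t) s.
Proof.
  destruct mu.
  - apply (Ccont_ext (fun _ => Cexp (- a * 1)%C)). reflexivity. apply Ccont_const.
  - eapply Ccont_der, Cder_kern.
Qed.

Lemma Ccont_monomial (i : nat) (s : R) : Ccont (fun u => RtoC u ^ i)%C s.
Proof.
  destruct i. apply (Ccont_ext (fun _ => 1%C)). reflexivity. apply Ccont_const.
  eapply Ccont_der, Cder_pow, Cder_id.
Qed.

Lemma Ccont_kern_monomial (mu : nat) (a : C) (t : R) (i : nat) (s : R) :
  Ccont (fun u => kern mu a t u * RtoC u ^ i)%C s.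
Proof. apply Ccont_mult. apply Ccont_kern. apply Ccont_monomial. Qed.

Lemma exp_le (x y : R) : x <= y -> exp x <= exp y.
Proof.
  intros H. destruct (Req_dec x y) as [E | E]. subst; lra. left; apply exp_increasing; lra.
Qed.

(** Lets every kernel be dominated by a plain exponential, at the price of a constant factor
    [e^(Re a)]. *)
Lemma pow_ge_linear (q : nat) (y : R) : 0 <= y -> y - 1 <= y ^ S q.
Proof.
  intros Hy. destruct (Rle_dec y 1). apply Rle_trans with 0. lra. apply pow_le; auto.
  apply Rle_trans with (y ^ 1). simpl; lra. apply Rle_pow; [lra | lia].
Qed.

Lemma pow_exp_le_inv (c : R) (P : nat) : 0 < c ->
  exists K, 0 <= K /\ forall t, 0 < t -> exp (- c * t) <= K / t ^ P.
Proof.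
  intros Hc. destruct (pow_exp_bound P c Hc) as [K [HK H]]. exists K. split; [lra | ].
  intros t Ht. apply (Rmult_le_reg_l (t ^ P)). apply pow_lt; auto.
  replace (t ^ P * (K / t ^ P)) with K. apply H; lra. field. apply pow_nonzero; lra.
Qed.

Lemma kern_end_small (q : nat) (a : C) (del : R) (P : nat) :
  0 < Re a -> 0 < del ->
  exists K, 0 <= K /\ forall t, 1 <= t -> Cmod (kern (S q) a t del) <= K / t ^ P.
Proof.
  intros Ha Hd. destruct (pow_exp_le_inv (Re a * del) P) as [K [HK H]]. nra.
  exists (exp (Re a) * K). split. apply Rmult_le_pos; auto. left; apply exp_pos.
  intros t Ht. rewrite Cmod_kern. apply Rle_trans with (exp (Re a) * exp (- (Re a * del) * t)).
  - rewrite <- exp_plus. apply exp_le.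
    assert (Hp := pow_ge_linear q (t * del)). assert (0 <= t * del) by nra. nra.
  - unfold Rdiv. rewrite Rmult_assoc. apply Rmult_le_compat_l. left; apply exp_pos.
    apply H; lra.
Qed.

(* The bound for every [P] makes the choice of the upper limit [del] immaterial. *)
Definition has_moment (mu : nat) (a : C) (del : R) (i : nat) (m : C) : Prop :=
  forall P : nat, exists K, 0 <= K /\ forall t l, 1 <= t ->
    Cint (fun s => kern mu a t s * RtoC s ^ i)%C 0 del l ->
    Cmod (l - m / RtoC t ^ (i + 1))%C <= K / t ^ P.

Lemma Re_pos_neq0 (a : C) : 0 < Re a -> a <> 0%C.
Proof. intros H E; rewrite E in H; simpl in H; lra. Qed.

(** For the power [s^(mu-1)] the integrand is an exact derivative, up to a constant, of the kernel
    itself; the value at [del] is the negligible error. *)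
Lemma has_moment_first (q : nat) (a : C) (del : R) :
  0 < Re a -> 0 < del -> has_moment (S q) a del q (/ (RtoC (INR (S q)) * a))%C.
Proof.
  intros Ha Hd P. destruct (kern_end_small q a del P Ha Hd) as [K [HK H]].
  assert (Ha0 := Re_pos_neq0 a Ha).
  assert (Hq : RtoC (INR (S q)) <> 0%C) by (apply RtoC_neq0, not_0_INR; lia).
  assert (Hqa : (RtoC (INR (S q)) * a)%C <> 0%C) by (apply Cmult_neq_0; auto).
  exists (/ Cmod (RtoC (INR (S q)) * a)%C * K). split.
  { apply Rmult_le_pos; auto. left; apply Rinv_0_lt_compat, Cmod_pos; auto. }
  intros t l Ht Hl.
  assert (Ht0 : RtoC t <> 0%C) by (apply RtoC_neq0; lra).
  set (B := (/ (RtoC (INR (S q)) * a * RtoC t ^ (q + 1)))%C).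
  assert (El : l = (B * (1 - kern (S q) a t del))%C).
  { eapply Cint_unique. exact Hl.
    replace (B * (1 - kern (S q) a t del))%C
      with ((- B * kern (S q) a t del) - (- B * kern (S q) a t 0))%C.
    2: { replace (kern (S q) a t 0) with (RtoC 1). ring. unfold kern.
         replace (- a * (RtoC t * 0) ^ S q)%C with (RtoC 0) by (simpl; ring).
         symmetry; apply Cexp_0. }
    apply (Cint_FTC (fun s => - B * kern (S q) a t s)%C). lra.
    intros x Hx. eapply Cder_ext_val. apply Cder_scal, Cder_kern.
    unfold B. rewrite Cpow_mult_l, Cpow_add_r, Cpow_1_r. field.
    repeat split; auto. apply Cpow_nz; auto.
    intros; apply Ccont_kern_monomial. }
  rewrite El. unfold B.
  replace (_ - _)%C with (- (/ (RtoC (INR (S q)) * a)) * (/ RtoC t ^ (q + 1)) * kern (S q) a t del)%C.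
  2: { field. repeat split; auto. apply Cpow_nz; auto. }
  set (W := (RtoC (INR (S q)) * a)%C) in *.
  rewrite !Cmod_mult, Cmod_opp, !Cmod_inv, Cmod_pow, Cmod_RtoC_pos; auto; try lra.
  2: apply Cpow_nz; auto.
  unfold Rdiv. rewrite !Rmult_assoc. apply Rmult_le_compat_l.
  left; apply Rinv_0_lt_compat, Cmod_pos; auto.
  apply Rle_trans with (1 * Cmod (kern (S q) a t del)).
  apply Rmult_le_compat_r. apply Cmod_ge_0. rewrite <- Rinv_1. apply Rinv_le_contravar. lra.
  apply pow_R1_Rle; auto. rewrite Rmult_1_l. apply H; auto.
Qed.

(** Integrating the derivative of [kern * s^(i+1)] links the moments [i] and [i + mu]. This is the
    functional equation of the Gamma function, with a boundary term at [del] smaller than any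
    power. *)
Lemma has_moment_step (q : nat) (a : C) (del : R) (i : nat) (m : C) :
  0 < Re a -> 0 < del -> has_moment (S q) a del i m ->
  has_moment (S q) a del (i + S q)
    (RtoC (INR (S i)) * m / (RtoC (INR (S q)) * a))%C.
Proof.
  intros Ha Hd Hm P. destruct (kern_end_small q a del P Ha Hd) as [K1 [HK1 H1]].
  destruct (Hm P) as [K2 [HK2 H2]].
  assert (Ha0 := Re_pos_neq0 a Ha).
  assert (Hq : RtoC (INR (S q)) <> 0%C) by (apply RtoC_neq0, not_0_INR; lia).
  assert (Hqa : (RtoC (INR (S q)) * a)%C <> 0%C) by (apply Cmult_neq_0; auto).
  set (A := Cmod (RtoC (INR (S q)) * a)%C). assert (HA : 0 < A) by (apply Cmod_pos; auto).
  set (D := del ^ S i). assert (HD : 0 <= D) by (apply pow_le; lra).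
  exists (/ A * (INR (S i) * K2 + D * K1)). split.
  { apply Rmult_le_pos. left; apply Rinv_0_lt_compat; auto.
    apply Rplus_le_le_0_compat; apply Rmult_le_pos; auto. apply pos_INR. }
  intros t l Ht Hl.
  assert (Ht0 : RtoC t <> 0%C) by (apply RtoC_neq0; lra).
  assert (Htq : (RtoC t ^ S q)%C <> 0%C) by (apply Cpow_nz; auto).
  destruct (Cint_ex (fun s => kern (S q) a t s * RtoC s ^ i)%C 0 del) as [l2 Hl2].
  lra. intros; apply Ccont_kern_monomial.
  assert (E : (RtoC (INR (S q)) * a * RtoC t ^ S q * l =
               RtoC (INR (S i)) * l2 - RtoC D * kern (S q) a t del)%C).
  { assert (X : (RtoC (INR (S i)) * l2 - RtoC (INR (S q)) * a * RtoC t ^ S q * l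
                 = RtoC D * kern (S q) a t del)%C).
    { eapply (Cint_unique _ 0 del).
      - apply Cint_minus. lra. apply Cint_scal. exact Hl2. apply Cint_scal. exact Hl.
      - replace (RtoC D * kern (S q) a t del)%C with
          (kern (S q) a t del * RtoC del ^ S i - kern (S q) a t 0 * 0 ^ S i)%C.
        2: { unfold D; rewrite RtoC_pow; simpl; ring. }
        apply (Cint_FTC (fun s => kern (S q) a t s * RtoC s ^ S i)%C). lra.
        + intros x Hx. eapply Cder_ext_val. apply Cder_mult. apply Cder_kern.
          apply Cder_pow, Cder_id. cbv beta.
          replace (i + S q)%nat with (q + S i)%nat by lia.
          rewrite Cpow_mult_l, Cpow_add_r, !Cpow_S. ring.
        + intros x Hx. unfold Cminus.
          apply (Ccont_ext (fun x => RtoC (INR (S i)) * (kern (S q) a t x * RtoC x ^ i) +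
            (- (RtoC (INR (S q)) * a * RtoC t ^ S q)) * (kern (S q) a t x * RtoC x ^ (i + S q)))%C).
          intros; ring.
          apply Ccont_plus; (apply Ccont_mult; [apply Ccont_const | apply Ccont_kern_monomial]). }
    rewrite <- X. ring. }
  assert (El : l = ((RtoC (INR (S i)) * l2 - RtoC D * kern (S q) a t del) /
                     (RtoC (INR (S q)) * a * RtoC t ^ S q))%C).
  { rewrite <- E. field. repeat split; auto. }
  rewrite El.
  replace (_ - _)%C with
    (/ (RtoC (INR (S q)) * a) * / RtoC t ^ S q *
      (RtoC (INR (S i)) * (l2 - m / RtoC t ^ (i + 1)) - RtoC D * kern (S q) a t del))%C.
  2: { replace (i + S q + 1)%nat with (S q + (i + 1))%nat by lia.
       rewrite (Cpow_add_r _ (S q)). field. repeat split; auto; apply Cpow_nz; auto. }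
  unfold A. set (W := (RtoC (INR (S q)) * a)%C) in *.
  rewrite (Cmod_mult (/ W * _)), (Cmod_mult (/ W)), !Cmod_inv, Cmod_pow, Cmod_RtoC_pos; auto; try lra.
  unfold Rdiv. rewrite !Rmult_assoc. apply Rmult_le_compat_l.
  left; apply Rinv_0_lt_compat; auto.
  set (Z := Cmod _).
  apply Rle_trans with (1 * Z).
  apply Rmult_le_compat_r. apply Cmod_ge_0. rewrite <- Rinv_1. apply Rinv_le_contravar. lra.
  apply pow_R1_Rle; auto. rewrite Rmult_1_l. unfold Z.
  apply Rle_trans with (1 := Cmod_triangle_minus _ _). rewrite Rmult_plus_distr_r, !Cmod_mult.
  rewrite !(Rmult_assoc _ _ (/ t ^ P)).
  rewrite (Cmod_RtoC_pos (INR _)) by apply pos_INR. rewrite (Cmod_RtoC_pos D) by auto.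
  apply Rplus_le_compat; apply Rmult_le_compat_l; auto. apply pos_INR.
Qed.

(** The majorant [1/(1+(ts)^2)] has an integral of order [1/t], uniformly in [del]; this supplies
    the last factor [1/t] in Watson's lemma. *)
Lemma is_RInt_lorentz (t del : R) : 0 < t -> 0 <= del ->
  is_RInt (fun s => / (1 + (t * s) ^ 2)) 0 del (/ t * atan (t * del)).
Proof.
  intros Ht Hd.
  replace (/ t * atan (t * del)) with (minus (/ t * atan (t * del)) (/ t * atan (t * 0))).
  2: { rewrite Rmult_0_r, atan_0. unfold minus, plus, opp; simpl; ring. }
  apply (is_RInt_derive (V := R_CompleteNormedModule) (fun s => / t * atan (t * s))).
  - intros x _. auto_derive; auto. simpl. field. split; nra.
  - intros x _. apply (ex_derive_continuous (K := R_AbsRing) (V := R_NormedModule)).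
    auto_derive. simpl; nra.
Qed.

Lemma pow_exp_lorentz (q i : nat) (b : R) : 0 < b ->
  exists K, 0 <= K /\ forall y, 0 <= y -> y ^ i * exp (- b * y ^ S q) <= K * / (1 + y ^ 2).
Proof.
  intros Hb. destruct (pow_exp_bound i b Hb) as [K1 [HK1 H1]].
  destruct (pow_exp_bound (i + 2) b Hb) as [K2 [HK2 H2]].
  exists (exp b * (K1 + K2)). assert (He := exp_pos b). split. nra.
  intros y Hy. assert (Hy2 : 0 < 1 + y ^ 2) by (simpl; nra).
  apply (Rmult_le_reg_r (1 + y ^ 2)); auto.
  rewrite (Rmult_assoc (exp b * _)), Rinv_l, Rmult_1_r by lra.
  specialize (H1 y Hy). specialize (H2 y Hy).
  assert (Hi : 0 <= y ^ i) by (apply pow_le; auto).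
  apply Rle_trans with (y ^ i * (exp b * exp (- b * y)) * (1 + y ^ 2)).
  - apply Rmult_le_compat_r. lra. apply Rmult_le_compat_l; auto.
    rewrite <- exp_plus. apply exp_le. generalize (pow_ge_linear q y Hy); nra.
  - rewrite pow_add in H2.
    replace (y ^ i * (exp b * exp (- b * y)) * (1 + y ^ 2)) with
      (exp b * (y ^ i * exp (- b * y) + y ^ i * y ^ 2 * exp (- b * y))) by ring.
    apply Rmult_le_compat_l; lra.
Qed.

(* With [y = t s], [mu = S p] and [h(s) = O(s)], the factor [exp (c y^mu h(s))] is expanded
   in powers of its argument; the error is controlled by the remaining half of [exp (- a y^mu)]. *)
Lemma watson_ray (p : nat) (a c d : C) (del : R) (h qf : R -> C) (g : R -> R -> C)
    (ha qb : nat -> C) (m : nat -> C) (J : nat) :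
  0 < Re a -> 0 < del ->
  (forall t s, 1 <= t -> 0 < s <= del ->
     g t s = Cexp (- a * (RtoC t * RtoC s) ^ S p
                   + c * (RtoC t * RtoC s) ^ S p * h s)%C * qf s)%C ->
  (forall t s, 1 <= t -> 0 <= s <= del -> Ccont (g t) s) ->
  (exists L, 0 <= L /\ forall s, 0 < s <= del -> Cmod (h s) <= L * s) ->
  (forall s, 0 < s <= del -> Cmod (c * h s)%C <= Re a / 2) ->
  expands h d del ha J -> expands qf d del qb J ->
  (forall i, has_moment (S p) a del i (m i)) ->
  exists K, 0 <= K /\ forall t l, 1 <= t -> Cint (g t) 0 del l ->
    Cmod (l - Csum (fun j => d ^ j / RtoC t ^ (j + 1) *
       Csum (fun k => c ^ k / RtoC (INR (fact k)) * ps_mul (ps_pow ha k) qb j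
                      * m (S p * k + j)%nat) J) J)%C <= K / t ^ (J + 1).
Proof.
  intros Ha Hd Hg Hgc [L [HL HhL]] Hsm Hh Hq Hm.
  destruct (expands_bounded _ _ _ _ _ Hq) as [Bq [HBq Hbq]].
  set (b := Re a / 2). assert (Hb : 0 < b) by (unfold b; lra).
  set (co := fun k j => (c ^ k / RtoC (INR (fact k)) * ps_mul (ps_pow ha k) qb j * d ^ j)%C).
  (* [G] is the approximate integrand: [k] indexes the exponential series and [j] the series of
     [h^k q], both cut at [J] terms, while the kernel is kept exact. *)
  set (G := fun t s => Csum (fun k => Csum (fun j =>
     co k j * RtoC t ^ (S p * k) * (kern (S p) a t s * RtoC s ^ (S p * k + j)))%C J) J).
  assert (HGi : forall t, exists l', Cint (G t) 0 del l' /\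
    exists mm : nat -> nat -> C, l' = Csum (fun k => Csum (fun j =>
     co k j * RtoC t ^ (S p * k) * mm k j)%C J) J /\
     forall k j, Cint (fun s => kern (S p) a t s * RtoC s ^ (S p * k + j))%C 0 del (mm k j)).
  { intros t.
    set (mm := fun k j => RInt (V := C_R_CompleteNormedModule)
        (fun s => kern (S p) a t s * RtoC s ^ (S p * k + j))%C 0 del).
    assert (Hmm : forall k j, Cint (fun s => kern (S p) a t s * RtoC s ^ (S p * k + j))%C 0 del (mm k j)).
    { intros k j. destruct (Cint_ex (fun s => kern (S p) a t s * RtoC s ^ (S p * k + j))%C 0 del) as [l Hl].
      lra. intros; apply Ccont_kern_monomial.
      unfold mm. rewrite (Cint_RInt _ _ _ _ Hl); auto. }
    eexists. split; [ | exists mm; split; [reflexivity | exact Hmm]].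
    unfold G. apply (Cint_Csum (fun k t0 => Csum (fun j =>
     co k j * RtoC t ^ (S p * k) * (kern (S p) a t t0 * RtoC t0 ^ (S p * k + j)))%C J)). intros k Hk.
    apply (Cint_Csum (fun j t0 => co k j * RtoC t ^ (S p * k) *
      (kern (S p) a t t0 * RtoC t0 ^ (S p * k + j)))%C). intros j Hj.
    apply Cint_scal. apply Hmm. }
  (* Error of cutting the series of [h^k q]: the remainder [s^J] equals [(ts)^J / t^J], and the
     kernel absorbs all powers of [ts]. *)
  assert (Hk : forall k, exists Kk, 0 <= Kk /\ forall t s, 1 <= t -> 0 < s <= del ->
    Cmod (kern (S p) a t s * ((c * (RtoC t * RtoC s) ^ S p * h s) ^ k / RtoC (INR (fact k)) * qf s)
      - Csum (fun j => co k j * RtoC t ^ (S p * k) * (kern (S p) a t s * RtoC s ^ (S p * k + j))) J)%C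
    <= Kk / t ^ J * / (1 + (t * s) ^ 2)).
  { intros k. destruct (expands_mult _ _ _ _ _ _ _ (expands_pow _ _ _ _ _ k Hh) Hq) as [E [HE HEx]].
    destruct (pow_exp_lorentz p (S p * k + J) (Re a) Ha) as [K [HK HKx]].
    set (A := Cmod (c ^ k / RtoC (INR (fact k)))%C).
    exists (A * E * K). split.
    { repeat apply Rmult_le_pos; auto. apply Cmod_ge_0. }
    intros t s Ht Hs.
    replace (_ - _)%C with
     (c ^ k / RtoC (INR (fact k)) * (kern (S p) a t s * (RtoC t * RtoC s) ^ (S p * k)) *
       (h s ^ k * qf s - psT (ps_mul (ps_pow ha k) qb) J (RtoC s * d)))%C.
    2: { replace (Csum (fun j => co k j * RtoC t ^ (S p * k) * (kern (S p) a t s * RtoC s ^ (S p * k + j)))%C J)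
           with (c ^ k / RtoC (INR (fact k)) * (kern (S p) a t s * (RtoC t * RtoC s) ^ (S p * k)) *
                  psT (ps_mul (ps_pow ha k) qb) J (RtoC s * d))%C.
         rewrite !Cpow_mult_l, <- !Cpow_mult_r. field. apply INR_fact_C_neq0.
         unfold psT. rewrite <- Csum_scal. apply Csum_ext. intros j Hj. unfold co.
         rewrite !Cpow_mult_l, Cpow_add_r. ring. }
    rewrite Cmod_mult, Cmod_mult. fold A. rewrite Cmod_mult, Cmod_kern, Cmod_pow.
    rewrite <- RtoC_mult, Cmod_RtoC_pos by nra.
    specialize (HEx s Hs). specialize (HKx (t * s)). assert (Hts : 0 <= t * s) by nra.
    specialize (HKx Hts).
    assert (HtJ : 0 < t ^ J) by (apply pow_lt; lra).
    assert (HA : 0 <= A) by apply Cmod_ge_0.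
    apply Rle_trans with (A * (exp (- Re a * (t * s) ^ S p) * (t * s) ^ (S p * k)) * (E * s ^ J)).
    - apply Rmult_le_compat_l; auto. apply Rmult_le_pos; auto.
      apply Rmult_le_pos. left; apply exp_pos. apply pow_le; auto.
    - replace (A * (exp (- Re a * (t * s) ^ S p) * (t * s) ^ (S p * k)) * (E * s ^ J))
        with (A * E / t ^ J * ((t * s) ^ (S p * k + J) * exp (- Re a * (t * s) ^ S p))).
      + replace (A * E * K / t ^ J * / (1 + (t * s) ^ 2)) with (A * E / t ^ J * (K * / (1 + (t * s) ^ 2))).
        apply Rmult_le_compat_l; auto. apply Rdiv_le_0_compat; auto. apply Rmult_le_pos; auto.
        field. split. nra. lra.
      + rewrite pow_add, (Rpow_mult_distr t s J). field. lra. }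
  (* Error of cutting the exponential series. The argument [X] is bounded twice: by [b (ts)^mu]
     inside the exponential, and by a multiple of [(ts)^mu s] in the factor [|X|^J], whose [J]
     factors [s = (ts)/t] produce [t^(-J)]. *)
  assert (Hr : exists Kr, 0 <= Kr /\ forall t s, 1 <= t -> 0 < s <= del ->
    Cmod (g t s - kern (S p) a t s * (expT J (c * (RtoC t * RtoC s) ^ S p * h s) * qf s))%C
    <= Kr / t ^ J * / (1 + (t * s) ^ 2)).
  { destruct (pow_exp_lorentz p (S p * J + J) b Hb) as [K [HK HKx]].
    set (A := (Cmod c * L) ^ J). assert (HA : 0 <= A) by (apply pow_le, Rmult_le_pos; auto; apply Cmod_ge_0).
    exists (A * Bq * K). split. repeat apply Rmult_le_pos; auto.
    intros t s Ht Hs. rewrite Hg by auto. rewrite Cexp_plus. fold (kern (S p) a t s).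
    set (X := (c * (RtoC t * RtoC s) ^ S p * h s)%C).
    replace (kern (S p) a t s * Cexp X * qf s - kern (S p) a t s * (expT J X * qf s))%C
      with (kern (S p) a t s * (Cexp X - expT J X) * qf s)%C by ring.
    rewrite !Cmod_mult, Cmod_kern.
    assert (Hts : 0 <= t * s) by nra.
    assert (HtJ : 0 < t ^ J) by (apply pow_lt; lra).
    assert (Hy : 0 <= (t * s) ^ S p) by (apply pow_le; auto).
    assert (HX1 : Cmod X <= b * (t * s) ^ S p).
    { unfold X. replace (c * (RtoC t * RtoC s) ^ S p * h s)%C with ((c * h s) * (RtoC t * RtoC s) ^ S p)%C by ring.
      rewrite Cmod_mult, Cmod_pow, <- RtoC_mult, Cmod_RtoC_pos by auto.
      apply Rmult_le_compat_r; auto. }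
    assert (HX2 : Cmod X <= Cmod c * L * ((t * s) ^ S p * s)).
    { unfold X. rewrite !Cmod_mult, Cmod_pow, <- RtoC_mult, Cmod_RtoC_pos by auto.
      replace (Cmod c * L * ((t * s) ^ S p * s)) with (Cmod c * (t * s) ^ S p * (L * s)) by ring.
      apply Rmult_le_compat_l. apply Rmult_le_pos; auto. apply Cmod_ge_0. apply HhL; auto. }
    assert (HXJ : Cmod X ^ J <= A * ((t * s) ^ (S p * J + J) / t ^ J)).
    { apply Rle_trans with ((Cmod c * L * ((t * s) ^ S p * s)) ^ J).
      apply pow_incr; split; auto. apply Cmod_ge_0. right.
      rewrite Rpow_mult_distr. fold A. f_equal. rewrite Rpow_mult_distr, <- pow_mult, pow_add.
      rewrite (Rpow_mult_distr t s J). field. lra. }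
    assert (HTay := Cexp_Taylor X J).
    assert (HeX : exp (Cmod X) <= exp (b * (t * s) ^ S p)) by (apply exp_le; auto).
    specialize (HKx (t * s) Hts). specialize (Hbq s Hs).
    assert (0 < exp (- Re a * (t * s) ^ S p)) by apply exp_pos.
    assert (0 < exp (Cmod X)) by apply exp_pos.
    assert (0 <= Cmod X ^ J) by apply pow_le, Cmod_ge_0.
    set (Y := (t * s) ^ (S p * J + J)) in *. assert (HY : 0 <= Y) by (apply pow_le; auto).
    apply Rle_trans with (exp (- Re a * (t * s) ^ S p) * (A * (Y / t ^ J) * exp (b * (t * s) ^ S p)) * Bq).
    - apply Rmult_le_compat; auto. apply Rmult_le_pos. lra. apply Cmod_ge_0. apply Cmod_ge_0.
      apply Rmult_le_compat_l. lra. apply Rle_trans with (1 := HTay).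
      apply Rmult_le_compat; auto. lra.
    - replace (exp (- Re a * (t * s) ^ S p) * (A * (Y / t ^ J) * exp (b * (t * s) ^ S p)) * Bq)
        with (A * Bq / t ^ J * (Y * (exp (- Re a * (t * s) ^ S p) * exp (b * (t * s) ^ S p)))) by (field; lra).
      rewrite <- exp_plus.
      replace (- Re a * (t * s) ^ S p + b * (t * s) ^ S p) with (- b * (t * s) ^ S p) by (unfold b; field).
      replace (A * Bq * K / t ^ J * / (1 + (t * s) ^ 2)) with (A * Bq / t ^ J * (K * / (1 + (t * s) ^ 2))).
      apply Rmult_le_compat_l; auto. apply Rdiv_le_0_compat; auto. apply Rmult_le_pos; auto.
      field. split. nra. lra. }
  assert (Hpt : exists Kp, 0 <= Kp /\ forall t s, 1 <= t -> 0 < s <= del ->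
    Cmod (g t s - G t s)%C <= Kp / t ^ J * / (1 + (t * s) ^ 2)).
  { destruct Hr as [Kr [HKr Hr]].
    assert (Hall : forall N, exists KN, 0 <= KN /\ forall t s, 1 <= t -> 0 < s <= del ->
      Cmod (kern (S p) a t s * (expT N (c * (RtoC t * RtoC s) ^ S p * h s) * qf s)
         - Csum (fun k => Csum (fun j =>
     co k j * RtoC t ^ (S p * k) * (kern (S p) a t s * RtoC s ^ (S p * k + j)))%C J) N)%C
       <= KN / t ^ J * / (1 + (t * s) ^ 2)).
    { induction N.
      - exists 0. split; [lra | ]. intros. unfold expT; simpl.
        match goal with |- Cmod ?z <= _ => replace z with (RtoC 0) by ring end.
        rewrite Cmod_0. unfold Rdiv; lra.
      - destruct IHN as [K1 [HK1 H1]]. destruct (Hk N) as [K2 [HK2 H2]].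
        exists (K1 + K2). split; [lra | ]. intros t s Ht Hs.
        specialize (H1 t s Ht Hs). specialize (H2 t s Ht Hs).
        replace ((K1 + K2) / t ^ J * / (1 + (t * s) ^ 2)) with
          (K1 / t ^ J * / (1 + (t * s) ^ 2) + K2 / t ^ J * / (1 + (t * s) ^ 2))
          by (unfold Rdiv; ring).
        eapply Rle_trans; [ | apply Rplus_le_compat; [exact H1 | exact H2]].
        eapply Rle_trans; [ | apply Cmod_triangle]. right; f_equal.
        unfold expT; simpl. ring. }
    destruct (Hall J) as [KJ [HKJ HJ]]. exists (Kr + KJ). split; [lra | ].
    intros t s Ht Hs. specialize (Hr t s Ht Hs). specialize (HJ t s Ht Hs).
    replace ((Kr + KJ) / t ^ J * / (1 + (t * s) ^ 2)) with
          (Kr / t ^ J * / (1 + (t * s) ^ 2) + KJ / t ^ J * / (1 + (t * s) ^ 2))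
          by (unfold Rdiv; ring).
    eapply Rle_trans; [ | apply Rplus_le_compat; [exact Hr | exact HJ]].
    eapply Rle_trans; [ | apply Cmod_triangle]. right; f_equal. unfold G; ring. }
  destruct Hpt as [Kp [HKp Hpt]].
  assert (Hmo : exists Km, 0 <= Km /\ forall t, 1 <= t -> forall mm : nat -> nat -> C,
     (forall k j, Cint (fun s => kern (S p) a t s * RtoC s ^ (S p * k + j))%C 0 del (mm k j)) ->
     forall k j, (k < J)%nat -> (j < J)%nat ->
     Cmod (co k j * RtoC t ^ (S p * k) * (mm k j - m (S p * k + j)%nat / RtoC t ^ (S p * k + j + 1)))%C
     <= Km / t ^ (J + 1)).
  { assert (Hone : forall k j, exists Km, 0 <= Km /\ forall t, 1 <= t -> forall mm : nat -> nat -> C,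
     (forall k j, Cint (fun s => kern (S p) a t s * RtoC s ^ (S p * k + j))%C 0 del (mm k j)) ->
     Cmod (co k j * RtoC t ^ (S p * k) * (mm k j - m (S p * k + j)%nat / RtoC t ^ (S p * k + j + 1)))%C
     <= Km / t ^ (J + 1)).
    (* The moment is approximated to order [mu k + J + 1], so that the error survives multiplication
       by [t^(mu k)]. *)
    { intros k j. destruct (Hm (S p * k + j)%nat (S p * k + (J + 1))%nat) as [K [HK H]].
      exists (Cmod (co k j) * K). split. apply Rmult_le_pos; auto. apply Cmod_ge_0.
      intros t Ht mm Hmm. rewrite !Cmod_mult, Cmod_pow, Cmod_RtoC_pos by lra.
      specialize (H t (mm k j) Ht (Hmm k j)). rewrite Rmult_assoc. unfold Rdiv. rewrite Rmult_assoc.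
      apply Rmult_le_compat_l. apply Cmod_ge_0.
      assert (0 < t ^ (S p * k)) by (apply pow_lt; lra).
      assert (0 < t ^ (J + 1)) by (apply pow_lt; lra).
      apply Rle_trans with (t ^ (S p * k) * (K / t ^ (S p * k + (J + 1)))).
      apply Rmult_le_compat_l; auto. lra.
      rewrite (pow_add t (S p * k)). right. field. lra. }
    (* Adding up the finitely many constants, first over [j] and then over [k], gives one constant
       for all pairs. *)
    assert (Hj : forall k N, exists Km, 0 <= Km /\ forall t, 1 <= t -> forall mm : nat -> nat -> C,
     (forall k j, Cint (fun s => kern (S p) a t s * RtoC s ^ (S p * k + j))%C 0 del (mm k j)) ->
     forall j, (j < N)%nat ->
     Cmod (co k j * RtoC t ^ (S p * k) * (mm k j - m (S p * k + j)%nat / RtoC t ^ (S p * k + j + 1)))%C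
     <= Km / t ^ (J + 1)).
    { intros k. induction N. exists 0; split; [lra | intros; lia].
      destruct IHN as [K1 [HK1 H1]]. destruct (Hone k N) as [K2 [HK2 H2]].
      exists (K1 + K2). split; [lra | ]. intros t Ht mm Hmm j Hj.
      assert (0 < / t ^ (J + 1)) by (apply Rinv_0_lt_compat, pow_lt; lra).
      destruct (Nat.eq_dec j N) as [-> | Hn].
      - apply Rle_trans with (1 := H2 t Ht mm Hmm). unfold Rdiv; nra.
      - apply Rle_trans with (1 := H1 t Ht mm Hmm j ltac:(lia)). unfold Rdiv; nra. }
    assert (Hkj : forall N, exists Km, 0 <= Km /\ forall t, 1 <= t -> forall mm : nat -> nat -> C,
     (forall k j, Cint (fun s => kern (S p) a t s * RtoC s ^ (S p * k + j))%C 0 del (mm k j)) ->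
     forall k j, (k < N)%nat -> (j < J)%nat ->
     Cmod (co k j * RtoC t ^ (S p * k) * (mm k j - m (S p * k + j)%nat / RtoC t ^ (S p * k + j + 1)))%C
     <= Km / t ^ (J + 1)).
    { induction N. exists 0; split; [lra | intros; lia].
      destruct IHN as [K1 [HK1 H1]]. destruct (Hj N J) as [K2 [HK2 H2]].
      exists (K1 + K2). split; [lra | ]. intros t Ht mm Hmm k j Hk' Hj'.
      assert (0 < / t ^ (J + 1)) by (apply Rinv_0_lt_compat, pow_lt; lra).
      destruct (Nat.eq_dec k N) as [-> | Hn].
      - apply Rle_trans with (1 := H2 t Ht mm Hmm j Hj'). unfold Rdiv; nra.
      - apply Rle_trans with (1 := H1 t Ht mm Hmm k j ltac:(lia) Hj'). unfold Rdiv; nra. }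
    apply Hkj. }
  destruct Hmo as [Km [HKm Hmo]].
  (* The 2 bounds the arctangent; the two factors [INR J] count the terms of the double sum. *)
  exists (Kp * 2 + INR J * (INR J * Km)). split.
  { assert (0 <= INR J) by apply pos_INR. assert (0 <= INR J * Km) by nra. nra. }
  intros t l Ht Hl. destruct (HGi t) as [l' [Hl' [mm [El' Hmm]]]].
  assert (HtJ : 0 < t ^ J) by (apply pow_lt; lra).
  replace (_ - _)%C with ((l - l') + (Csum (fun k => Csum (fun j =>
     co k j * RtoC t ^ (S p * k) * (mm k j - m (S p * k + j)%nat / RtoC t ^ (S p * k + j + 1)))%C J) J))%C.
  2: { rewrite El'.
       assert (Ht0 : RtoC t <> 0%C) by (apply RtoC_neq0; lra).
       transitivity (l - Csum (fun k => Csum (fun j => co k j * m (S p * k + j)%nat / RtoC t ^ (j + 1))%C J) J)%C.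
       - rewrite (Csum_ext (fun k => Csum (fun j => co k j * RtoC t ^ (S p * k) *
            (mm k j - m (S p * k + j)%nat / RtoC t ^ (S p * k + j + 1)))%C J)
            (fun k => Csum (fun j => co k j * RtoC t ^ (S p * k) * mm k j)%C J -
              Csum (fun j => co k j * m (S p * k + j)%nat / RtoC t ^ (j + 1))%C J)%C).
         rewrite Csum_minus. ring.
         intros k _. rewrite <- Csum_minus. apply Csum_ext. intros j _.
         rewrite <- (Nat.add_assoc (S p * k) j 1), (Cpow_add_r _ (S p * k) (j + 1)). field.
         split; apply Cpow_nz; auto.
       - f_equal. rewrite Csum_exchange. apply Csum_ext. intros j _.
         rewrite <- Csum_scal. apply Csum_ext. intros k _. unfold co, Cdiv; ring. }
  apply Rle_trans with (1 := Cmod_triangle _ _).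
  replace ((Kp * 2 + INR J * (INR J * Km)) / t ^ (J + 1)) with
    (Kp / t ^ J * (2 / t) + INR J * (INR J * (Km / t ^ (J + 1)))).
  2: { rewrite pow_add, pow_1. field. split; lra. }
  apply Rplus_le_compat.
  - apply Rle_trans with (Kp / t ^ J * (/ t * atan (t * del))).
    + apply (Cint_Cmod_le (fun s => g t s - G t s)%C (fun s => Kp / t ^ J * / (1 + (t * s) ^ 2)) 0 del).
      lra. intros s Hs; apply Hpt; lra.
      apply Cint_minus; auto. lra.
      apply (is_RInt_scal (V := R_NormedModule) _ _ _ (Kp / t ^ J)).
      apply is_RInt_lorentz; lra.
    + apply Rmult_le_compat_l. apply Rdiv_le_0_compat; auto.
      unfold Rdiv. rewrite Rmult_comm. apply Rmult_le_compat_r.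
      left; apply Rinv_0_lt_compat; lra.
      generalize (atan_bound (t * del)) PI_4; lra.
  - apply Cmod_Csum. intros k Hk'. apply Cmod_Csum. intros j Hj'. apply Hmo; auto.
Qed.

(** * The Gaussian integral *)

(* [gaussA x ^ 2 + 2 * gaussB x] does not depend on [x], and [gaussB] vanishes at infinity. *)
Definition gaussA (x : R) : R := RInt (fun y => exp (- (y * y / 2))) 0 x.
Definition gaussB (x : R) : R :=
  RInt (fun u => exp (- (x * x * (1 + u * u) / 2)) / (1 + u * u)) 0 1.

Lemma gaussA_derive (x : R) : is_derive gaussA x (exp (- (x * x / 2))).
Proof.
  assert (Hc : forall y, continuous (fun y => exp (- (y * y / 2))) y).
  { intros y. apply (ex_derive_continuous (K := R_AbsRing) (V := R_NormedModule)).
    auto_derive; auto. }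
  apply (is_derive_RInt (V := R_NormedModule) (fun y => exp (- (y * y / 2))) gaussA 0).
  - apply filter_forall. intros b. apply (RInt_correct (V := R_CompleteNormedModule)).
    apply (ex_RInt_continuous (V := R_CompleteNormedModule)). intros; auto.
  - apply Hc.
Qed.

Lemma gaussB_derive (x : R) :
  is_derive gaussB x (RInt (fun u => - x * exp (- (x * x * (1 + u * u) / 2))) 0 1).
Proof.
  assert (HD : forall y u, is_derive (fun z => exp (- (z * z * (1 + u * u) / 2)) / (1 + u * u)) y
     (- y * exp (- (y * y * (1 + u * u) / 2)))).
  { intros y u. assert (0 < 1 + u * u) by nra. auto_derive; auto.
    replace (- (y * y * (1 + u * u) * / 2)) with (- (y * y * (1 + u * u) / 2)) by (unfold Rdiv; ring). field. lra. }
  assert (HDe : forall y u, Derive (fun z => exp (- (z * z * (1 + u * u) / 2)) / (1 + u * u)) y =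
     - y * exp (- (y * y * (1 + u * u) / 2))) by (intros; apply is_derive_unique, HD).
  assert (H := is_derive_RInt_param
     (fun x u => exp (- (x * x * (1 + u * u) / 2)) / (1 + u * u)) 0 1 x).
  rewrite (RInt_ext _ (fun u => - x * exp (- (x * x * (1 + u * u) / 2)))) in H.
  2: { intros; apply HDe. }
  apply H; clear H.
  - apply filter_forall. intros y u _. eexists; apply HD.
  - intros u _. apply (continuity_2d_pt_ext (fun y u => - y * exp (- (y * y * (1 + u * u) / 2)))).
    intros; symmetry; apply HDe.
    apply continuity_2d_pt_mult. apply continuity_2d_pt_opp, continuity_2d_pt_id1.
    apply (continuity_1d_2d_pt_comp exp (fun y u => - (y * y * (1 + u * u) / 2))).
    apply derivable_continuous_pt, derivable_pt_exp.
    apply continuity_2d_pt_opp. unfold Rdiv. apply continuity_2d_pt_mult; [ | apply continuity_2d_pt_const].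
    apply continuity_2d_pt_mult. apply continuity_2d_pt_mult; apply continuity_2d_pt_id1.
    apply continuity_2d_pt_plus. apply continuity_2d_pt_const.
    apply continuity_2d_pt_mult; apply continuity_2d_pt_id2.
  - apply filter_forall. intros y. apply (ex_RInt_continuous (V := R_CompleteNormedModule)).
    intros u _. apply (ex_derive_continuous (K := R_AbsRing) (V := R_NormedModule)).
    auto_derive. nra.
Qed.

(** The substitution [y = x u] turns the derivative of [gaussB] into [- gaussA' * gaussA], which is
    what the constancy of [gaussA^2 + 2 gaussB] requires. *)
Lemma gaussA_scaled (x : R) :
  RInt (fun u => - x * exp (- (x * x * (1 + u * u) / 2))) 0 1 = - (exp (- (x * x / 2)) * gaussA x).
Proof.
  unfold gaussA.
  assert (H := RInt_comp_lin (V := R_CompleteNormedModule) (fun y => exp (- (y * y / 2))) x 0 0 1).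
  rewrite Rmult_0_r, Rmult_1_r, !Rplus_0_r in H. rewrite <- H; clear H.
  2: { apply (ex_RInt_continuous (V := R_CompleteNormedModule)). intros.
       apply (ex_derive_continuous (K := R_AbsRing) (V := R_NormedModule)). auto_derive; auto. }
  apply is_RInt_unique. evar_last.
  - apply (is_RInt_ext (fun u => scal (- exp (- (x * x / 2))) (scal x (exp (- ((x * u + 0) * (x * u + 0) / 2)))))).
    + intros u _. unfold scal; simpl; unfold mult; simpl.
      replace (- (x * x * (1 + u * u) / 2)) with (- (x * x / 2) + - ((x * u + 0) * (x * u + 0) / 2)) by field.
      rewrite exp_plus. ring.
    + apply (is_RInt_scal (V := R_NormedModule)). apply (RInt_correct (V := R_CompleteNormedModule)).
      apply (ex_RInt_continuous (V := R_CompleteNormedModule)). intros.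
      apply (ex_derive_continuous (K := R_AbsRing) (V := R_NormedModule)).
      unfold scal; simpl; unfold mult; simpl. auto_derive; auto.
  - set (r := RInt _ 0 1). unfold scal; simpl; unfold mult; simpl. ring.
Qed.

Lemma gauss_identity (x : R) : 0 <= x -> gaussA x * gaussA x + 2 * gaussB x = PI / 2.
Proof.
  intros Hx.
  (* At 0 only [gaussB] contributes, with the integral [atan 1 = PI/4] of [1/(1+u^2)]. *)
  assert (E0 : gaussA 0 * gaussA 0 + 2 * gaussB 0 = PI / 2).
  { unfold gaussA. rewrite RInt_point. unfold zero; simpl. unfold gaussB.
    rewrite (RInt_ext _ (fun u => / (1 + (1 * u) ^ 2))).
    - rewrite (is_RInt_unique (V := R_CompleteNormedModule) _ _ _ _ (is_RInt_lorentz 1 1 Rlt_0_1 Rle_0_1)).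
      rewrite Rmult_1_r, atan_1. field.
    - intros u _. replace (- (0 * 0 * (1 + u * u) / 2)) with 0 by field. rewrite exp_0.
      simpl. unfold Rdiv. rewrite Rmult_1_l. f_equal; ring. }
  destruct (Req_dec x 0) as [-> | Hn]; auto.
  rewrite <- E0. symmetry.
  apply (eq_is_derive (V := R_NormedModule) (fun x => gaussA x * gaussA x + 2 * gaussB x) 0 x); [ | lra].
  intros t _. evar_last.
  apply (is_derive_plus (V := R_NormedModule) (fun x => gaussA x * gaussA x) (fun x => 2 * gaussB x)).
  apply (is_derive_mult gaussA gaussA). apply gaussA_derive. apply gaussA_derive. apply Rmult_comm.
  apply (is_derive_scal gaussB). apply gaussB_derive. rewrite gaussA_scaled. unfold plus, mult, zero; simpl. ring.
Qed.

Lemma gaussB_bound (x : R) : 0 <= gaussB x <= exp (- (x * x / 2)).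
Proof.
  assert (Hex : ex_RInt (fun u => exp (- (x * x * (1 + u * u) / 2)) / (1 + u * u)) 0 1).
  { apply (ex_RInt_continuous (V := R_CompleteNormedModule)).
    intros u _. apply (ex_derive_continuous (K := R_AbsRing) (V := R_NormedModule)).
    auto_derive. nra. }
  unfold gaussB. split.
  - apply RInt_ge_0; auto. lra. intros u _.
    apply Rdiv_le_0_compat. left; apply exp_pos. nra.
  - replace (exp (- (x * x / 2))) with (RInt (fun _ => exp (- (x * x / 2))) 0 1).
    2: { rewrite RInt_const. unfold scal; simpl; unfold mult; simpl; ring. }
    apply RInt_le; auto. lra. apply (ex_RInt_const (V := R_NormedModule)).
    intros u _. apply Rle_trans with (exp (- (x * x * (1 + u * u) / 2))).
    + assert (0 < exp (- (x * x * (1 + u * u) / 2))) by apply exp_pos.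
      apply (Rmult_le_reg_r (1 + u * u)). nra.
      unfold Rdiv at 1. rewrite Rmult_assoc, Rinv_l by nra. nra.
    + apply exp_le. assert (0 <= x * x) by nra. assert (0 <= u * u) by nra. nra.
Qed.

(** With [r = sqrt(PI/2)] the identity reads [(r - gaussA)(r + gaussA) = 2 gaussB], and
    [r + gaussA >= 1]. *)
Lemma gaussA_limit (x : R) : 0 <= x -> Rabs (gaussA x - sqrt (PI / 2)) <= 2 * exp (- (x * x / 2)).
Proof.
  intros Hx. assert (H := gauss_identity x Hx). assert (HB := gaussB_bound x).
  assert (HA : 0 <= gaussA x).
  { apply RInt_ge_0; auto.
    apply (ex_RInt_continuous (V := R_CompleteNormedModule)). intros.
    apply (ex_derive_continuous (K := R_AbsRing) (V := R_NormedModule)). auto_derive; auto.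
    intros; left; apply exp_pos. }
  assert (HP : PI / 2 > 1) by (generalize PI2_1; unfold PI2; lra).
  assert (Hs : sqrt (PI / 2) * sqrt (PI / 2) = PI / 2) by (apply sqrt_sqrt; lra).
  assert (Hs1 : 1 <= sqrt (PI / 2)) by (rewrite <- sqrt_1; apply sqrt_le_1_alt; lra).
  set (r := sqrt (PI / 2)) in *.
  assert (Hd : (r - gaussA x) * (r + gaussA x) = 2 * gaussB x) by lra.
  assert (0 <= r - gaussA x). { apply Rnot_lt_le. intro. nra. }
  rewrite Rabs_minus_sym, Rabs_pos_eq by lra. nra.
Qed.

Lemma has_moment_gauss0 (del : R) : 0 < del ->
  has_moment 2 (RtoC (/ 2)) del 0 (RtoC (sqrt (PI / 2))).
Proof.
  intros Hd P.
  destruct (kern_end_small 1 (RtoC (/ 2)) del P) as [K [HK H]]. simpl; lra. auto.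
  exists (2 * K). split; [lra | ]. intros t l Ht Hl.
  assert (El : l = RtoC (/ t * gaussA (t * del))).
  { eapply Cint_unique. exact Hl.
    replace (RtoC (/ t * gaussA (t * del))) with (RtoC (/ t * gaussA (t * del)) - RtoC (/ t * gaussA (t * 0)))%C.
    2: { replace (gaussA (t * 0)) with 0. rewrite Rmult_0_r. ring.
         unfold gaussA. rewrite Rmult_0_r, RInt_point. reflexivity. }
    apply (Cint_FTC (fun s => RtoC (/ t * gaussA (t * s)))). lra.
    - intros s _.
      assert (E : (kern 2 (RtoC (/ 2)) t s * RtoC s ^ 0)%C = RtoC (exp (- (t * s * (t * s) / 2)))).
      { rewrite <- Cexp_RtoC. unfold kern. simpl Cpow. rewrite !Cmult_1_r. f_equal.
        apply C_eq; simpl; field. }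
      rewrite E. split; simpl.
      + evar_last. apply (is_derive_scal (fun s => gaussA (t * s))).
        apply (is_derive_comp gaussA (fun s => t * s)). apply gaussA_derive.
        apply (is_derive_scal (fun s => s)). apply (is_derive_id (K := R_AbsRing)).
        unfold scal, one; simpl; unfold mult; simpl. field. lra.
      + apply (is_derive_const (V := R_NormedModule)).
    - intros; apply Ccont_kern_monomial. }
  rewrite El. simpl Cpow. rewrite Cmult_1_r.
  rewrite <- RtoC_div by lra. rewrite <- RtoC_minus, Cmod_R.
  specialize (H t Ht). rewrite Cmod_kern in H. simpl in H.
  assert (Htd : 0 <= t * del) by nra.
  assert (HG := gaussA_limit (t * del) Htd).
  replace (- / 2 * (t * del * (t * del * 1))) with (- (t * del * (t * del) / 2)) in H by field.
  replace (/ t * gaussA (t * del) - sqrt (PI / 2) / t) with (/ t * (gaussA (t * del) - sqrt (PI / 2)))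
    by (unfold Rdiv; ring).
  rewrite Rabs_mult, (Rabs_pos_eq (/ t)) by (left; apply Rinv_0_lt_compat; lra).
  assert (/ t <= 1) by (rewrite <- Rinv_1; apply Rinv_le_contravar; lra).
  assert (0 < / t) by (apply Rinv_0_lt_compat; lra).
  assert (0 <= Rabs (gaussA (t * del) - sqrt (PI / 2))) by apply Rabs_pos.
  unfold Rdiv in *. nra.
Qed.

(** The half-line moments of [y^i e^(-y^2/2)]. Truncated subtraction makes [i = 0] read [0!! = 1],
    the intended value of [(-1)!!]. *)
Definition gmom (i : nat) : C :=
  if Nat.even i then RtoC (INR (dfact (i - 1)) * sqrt (PI / 2)) else RtoC (INR (dfact (i - 1))).

Lemma dfact_SS (i : nat) : dfact (S (S i)) = (S (S i) * dfact i)%nat.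
Proof. reflexivity. Qed.

Lemma gmom_SS (i : nat) : gmom (S (S i)) = (RtoC (INR (S i)) * gmom i)%C.
Proof.
  unfold gmom. change (Nat.even (S (S i))) with (Nat.even i).
  assert (E : INR (dfact (S (S i) - 1)) = INR (S i) * INR (dfact (i - 1))).
  { rewrite <- mult_INR. f_equal. destruct i. reflexivity.
    replace (S (S (S i)) - 1)%nat with (S (S i)) by lia. replace (S i - 1)%nat with i by lia.
    apply dfact_SS. }
  rewrite E. destruct (Nat.even i); rewrite !RtoC_mult; ring.
Qed.

Lemma has_moment_gauss (del : R) (i : nat) : 0 < del ->
  has_moment 2 (RtoC (/ 2)) del i (gmom i).
Proof.
  intros Hd.
  (* The recursion advances by two, so the induction carries two neighbouring moments. *)
  assert (H : has_moment 2 (RtoC (/ 2)) del i (gmom i) /\ has_moment 2 (RtoC (/ 2)) del (S i) (gmom (S i))).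
  2: apply H.
  induction i.
  - split.
    + unfold gmom; simpl. rewrite Rmult_1_l. apply has_moment_gauss0; auto.
    + assert (H := has_moment_first 1 (RtoC (/ 2)) del). unfold gmom; simpl.
      match type of H with _ -> _ -> has_moment _ _ _ _ ?m => replace (RtoC 1) with m end.
      apply H; auto; simpl; lra.
      rewrite <- RtoC_mult. simpl. replace ((1 + 1) * / 2) with 1 by field. field.
  - destruct IHi as [H1 H2]. split; auto.
    rewrite gmom_SS.
    assert (H := has_moment_step 1 (RtoC (/ 2)) del i (gmom i)).
    replace (i + 2)%nat with (S (S i)) in H by lia.
    match type of H with _ -> _ -> _ -> has_moment _ _ _ _ ?m => replace (RtoC (INR (S i)) * gmom i)%C with m end.
    apply H; auto. simpl; lra.
    rewrite <- (RtoC_mult (INR 2)). replace (INR 2 * / 2) with 1 by (simpl; field). field.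
Qed.

Lemma has_moment_exp (a : C) (del : R) (i : nat) : 0 < Re a -> 0 < del ->
  has_moment 1 a del i (RtoC (INR (fact i)) / a ^ (i + 1))%C.
Proof.
  intros Ha Hd. assert (Ha0 := Re_pos_neq0 a Ha). induction i.
  - assert (H := has_moment_first 0 a del Ha Hd).
    match type of H with has_moment _ _ _ _ ?m => replace (RtoC (INR (fact 0)) / a ^ (0 + 1))%C with m end.
    exact H. simpl. field; auto.
  - assert (H := has_moment_step 0 a del i _ Ha Hd IHi).
    replace (i + 1)%nat with (S i) in H at 1 by lia.
    match type of H with has_moment _ _ _ _ ?m => replace (RtoC (INR (fact (S i))) / a ^ (S i + 1))%C with m end.
    exact H. change (fact (S i)) with (S i * fact i)%nat. rewrite mult_INR, RtoC_mult.
    replace (INR 1) with 1 by reflexivity. change (S i + 1)%nat with (S (i + 1)). rewrite (Cpow_S a). field. split; auto.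
    apply Cpow_nz; auto.
Qed.

(** * Logarithm and powers along a ray *)

Lemma Clog_1 : Clog 1%C = 0%C.
Proof.
  unfold Clog, Carg. rewrite Cmod_1, ln_1. simpl.
  destruct (Rlt_dec 0 1); [ | lra]. replace (0 / 1) with 0 by field. rewrite atan_0. reflexivity.
Qed.

Lemma Csum_add (f : nat -> C) (n m : nat) :
  Csum f (n + m) = (Csum f n + Csum (fun i => f (n + i)%nat) m)%C.
Proof.
  induction m. rewrite Nat.add_0_r; simpl; ring.
  rewrite Nat.add_succ_r. simpl. rewrite IHm. ring.
Qed.

(** [|s d| <= 1/2] keeps [1 - s d] off the branch cut of the logarithm and off 0; the later factors
    2 are bounds for [1/|1 - s d|]. *)
Lemma ray_bounds (d : C) (del s : R) : del * Cmod d <= / 2 -> 0 <= s <= del ->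
  / 2 <= Re (1 - RtoC s * d)%C /\ / 2 <= Cmod (1 - RtoC s * d)%C /\ Cmod (RtoC s * d)%C <= / 2.
Proof.
  intros Hd Hs. assert (H : Cmod (RtoC s * d)%C <= / 2).
  { rewrite Cmod_scaled by lra. assert (0 <= Cmod d) by apply Cmod_ge_0. nra. }
  assert (H2 := Re_le_Cmod (RtoC s * d)%C).
  assert (H3 : / 2 <= Re (1 - RtoC s * d)%C) by (rewrite Re_minus, (Re_RtoC 1); lra).
  repeat split; auto. apply Rle_trans with (1 := H3), Re_le_Cmod.
Qed.

Lemma Cder_ray (d : C) (s : R) : Cder (fun s => 1 - RtoC s * d)%C s (- d)%C.
Proof.
  apply (Cder_ext (fun s => 1 + RtoC s * (- d))%C). intros; ring. apply Cder_lin.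
Qed.

Lemma Cder_log_ray (d : C) (del s : R) : del * Cmod d <= / 2 -> 0 <= s <= del ->
  Cder (fun s => Clog (1 - RtoC s * d)%C) s (- d / (1 - RtoC s * d))%C.
Proof.
  intros Hd Hs. destruct (ray_bounds d del s Hd Hs) as [H1 _].
  apply (Cder_log (fun s => 1 - RtoC s * d)%C). lra. apply Cder_ray.
Qed.

Lemma geometric_sum (z : C) (N : nat) :
  ((1 - z) * Csum (fun j => z ^ j) N = 1 - z ^ N)%C.
Proof. induction N; simpl. ring. rewrite Cmult_plus_distr_l, IHN. ring. Qed.

Lemma Cmod_half_neq0 (z : C) : / 2 <= Cmod z -> z <> 0%C.
Proof. intros H E; rewrite E, Cmod_0 in H; lra. Qed.

Lemma Cmod_div_half (x z : C) : / 2 <= Cmod z -> Cmod (x / z)%C <= 2 * Cmod x.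
Proof.
  intros H. rewrite Cmod_div by (apply Cmod_half_neq0; auto).
  assert (H0 := Cmod_ge_0 x). apply (Rmult_le_reg_r (Cmod z)). lra.
  unfold Rdiv. rewrite Rmult_assoc, Rinv_l by lra. nra.
Qed.

Lemma Ccont_div_ray (F : R -> C) (d : C) (del s : R) :
  del * Cmod d <= / 2 -> 0 <= s <= del -> Ccont F s ->
  Ccont (fun s => F s / (1 - RtoC s * d))%C s.
Proof.
  intros Hd Hs HF. unfold Cdiv. apply Ccont_mult; auto.
  destruct (ray_bounds d del s Hd Hs) as [H1 _].
  assert (Hc := Ccont_der _ _ _ (Cder_ray d s)). destruct Hc as [Ha Hb].
  set (u := fun s => Re (1 - RtoC s * d)%C) in *. set (w := fun s => Im (1 - RtoC s * d)%C) in *.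
  change (/ 2 <= u s) in H1.
  assert (Hn : u s ^ 2 + w s ^ 2 <> 0) by nra.
  assert (Hcn : continuous (fun s => / (u s ^ 2 + w s ^ 2)) s).
  { apply (continuous_Rinv_comp (fun s => u s ^ 2 + w s ^ 2)); auto.
    apply (continuous_ext (fun s => u s * u s + w s * w s)).
    intros x; change (u x * u x + w x * w x = u x ^ 2 + w x ^ 2); ring.
    apply (continuous_plus (V := R_NormedModule) (fun s => u s * u s) (fun s => w s * w s)).
    apply (continuous_mult (K := R_AbsRing) _ _ _ Ha Ha).
    apply (continuous_mult (K := R_AbsRing) _ _ _ Hb Hb). }
  split.
  - apply (continuous_mult (K := R_AbsRing) u (fun s => / (u s ^ 2 + w s ^ 2)) s Ha Hcn).
  - apply (continuous_mult (K := R_AbsRing) (fun s => - w s) (fun s => / (u s ^ 2 + w s ^ 2)) s); auto.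
    apply (continuous_opp (V := R_NormedModule) w); auto.
Qed.

Definition logT (N : nat) (z : C) : C := Csum (fun j => z ^ S j / RtoC (INR (S j)))%C N.

(** [logT] is minus the Taylor polynomial of [log(1-z)], hence the plus sign. By the geometric sum
    the remainder has derivative [-d z^N / (1-z)], and it vanishes at 0. *)
Lemma log_ray_Taylor (d : C) (del s : R) (N : nat) : del * Cmod d <= / 2 -> 0 <= s <= del ->
  Cmod (Clog (1 - RtoC s * d) + logT N (RtoC s * d))%C <= 2 * (s * Cmod d) ^ S N.
Proof.
  intros Hd Hs.
  set (F := fun s => (Clog (1 - RtoC s * d) + logT N (RtoC s * d))%C).
  set (f := fun s => (- d * (RtoC s * d) ^ N / (1 - RtoC s * d))%C).
  assert (F0 : F 0 = 0%C).
  { unfold F, logT. rewrite Csum_zero. replace (1 - 0 * d)%C with (RtoC 1) by ring.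
    rewrite Clog_1. ring. intros. rewrite Cmult_0_l. simpl. field.
    apply (RtoC_neq0 (INR (S i))). apply not_0_INR; lia. }
  assert (E : F s = (F s - F 0)%C) by (rewrite F0; ring).
  change (Cmod (F s) <= 2 * (s * Cmod d) ^ S N). rewrite E.
  apply Rle_trans with (2 * (Cmod d * (s * Cmod d) ^ N) * (s - 0)).
  2: { simpl; right; ring. }
  apply (Cder_mean_value F f 0 s).
  - lra.
  - intros x Hx. assert (Hx' : 0 <= x <= del) by lra.
    destruct (ray_bounds d del x Hd Hx') as [_ [H2 _]]. apply Cmod_half_neq0 in H2.
    eapply Cder_ext_val. unfold F. apply Cder_plus. apply (Cder_log_ray d del x Hd Hx').
    unfold logT. apply Cder_Csum. intros i Hi.
    apply (Cder_ext (fun t => / RtoC (INR (S i)) * (RtoC t * d) ^ S i)%C).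
    intros; unfold Cdiv; ring. apply Cder_scal, Cder_pow. apply Cder_mult. apply Cder_id. apply Cder_const.
    cbv beta. unfold f.
    rewrite (Csum_ext _ (fun i => d * (RtoC x * d) ^ i)%C).
    2: { intros i Hi. cbv beta. set (y := RtoC (INR (S i))).
         assert (y <> 0%C) by (apply RtoC_neq0, not_0_INR; lia). field. auto. }
    rewrite Csum_scal. set (z := (RtoC x * d)%C) in *.
    assert (G := geometric_sum z N).
    replace (Csum (Cpow z) N)%C with ((1 - z ^ N) / (1 - z))%C. field; auto.
    change (Csum (Cpow z) N) with (Csum (fun j => z ^ j)%C N).
    rewrite <- G. field; auto.
  - intros x Hx. unfold f. apply (Ccont_div_ray _ d del x); auto. lra.
    apply Ccont_mult. apply Ccont_const.
    destruct N. apply (Ccont_ext (fun _ => 1%C)). reflexivity. apply Ccont_const.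
    eapply Ccont_der, Cder_pow, Cder_mult. apply Cder_id. apply Cder_const.
  - intros x Hx. unfold f. assert (Hx' : 0 <= x <= del) by lra.
    destruct (ray_bounds d del x Hd Hx') as [_ [H2 _]].
    apply Rle_trans with (1 := Cmod_div_half _ _ H2).
    apply Rmult_le_compat_l. lra. rewrite Cmod_mult, Cmod_opp, Cmod_pow, Cmod_scaled by lra.
    apply Rmult_le_compat_l. apply Cmod_ge_0. apply pow_incr.
    assert (0 <= Cmod d) by apply Cmod_ge_0. split; nra.
Qed.

(** With [z = s d] this is the sum over [j >= 1] of [z^j / (j+p+1)], so that [-log(1-z)] is its
    polynomial of degree [p+1] plus [z^(p+1)] times [hray]. For [p = 0] and [p = 1] the coefficients
    are the arguments [1/2, 1/3, ...] and [1/3, 1/4, ...] of the De Moivre polynomials. *)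
Definition hray (p : nat) (d : C) (s : R) : C :=
  (- (Clog (1 - RtoC s * d) + logT (S p) (RtoC s * d)) / (RtoC s * d) ^ S p)%C.

Definition hcoef (p : nat) (j : nat) : C :=
  if Nat.eqb j 0 then 0%C else RtoC (/ INR (j + S p)).

Lemma hray_expands_explicit (p : nat) (d : C) (del : R) (J : nat) (s : R) :
  d <> 0%C -> del * Cmod d <= / 2 -> 0 < s <= del ->
  Cmod (hray p d s - psT (hcoef p) (S J) (RtoC s * d))%C <= 2 * (s * Cmod d) ^ S J.
Proof.
  intros Hd0 Hd Hs. set (z := (RtoC s * d)%C).
  assert (Hz : z <> 0%C) by (apply Cmult_neq_0; auto; apply RtoC_neq0; lra).
  assert (Hzp : (z ^ S p)%C <> 0%C) by (apply Cpow_nz; auto).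
  assert (Hzm : Cmod z = s * Cmod d) by (apply Cmod_scaled; lra).
  assert (Hzm0 : 0 < Cmod z) by (apply Cmod_pos; auto).
  assert (E : (hray p d s - psT (hcoef p) (S J) z = - (Clog (1 - z) + logT (S p + J) z) / z ^ S p)%C).
  { unfold hray. fold z. unfold logT. rewrite Csum_add.
    assert (E1 : Csum (fun i => z ^ S (S p + i) / RtoC (INR (S (S p + i))))%C J =
                 (z ^ S p * psT (hcoef p) (S J) z)%C).
    { rewrite psT_S. unfold psT. rewrite (Cmult_comm z), <- (Cmult_comm z), <- Csum_scal.
      replace (hcoef p 0%nat) with (RtoC 0) by reflexivity. rewrite Cplus_0_l, <- Csum_scal.
      apply Csum_ext. intros i Hi. unfold hcoef. replace (Nat.eqb (S i) 0) with false by reflexivity.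
      replace (S i + S p)%nat with (S (S p + i)) by lia.
      rewrite RtoC_inv by (apply not_0_INR; lia).
      replace (S (S p + i)) with (S p + S i)%nat at 1 by lia. rewrite Cpow_add_r, (Cpow_S z i).
      unfold Cdiv; ring. }
    rewrite E1. field. auto. }
  rewrite E, Cmod_div, Cmod_opp, Cmod_pow by auto.
  assert (HL := log_ray_Taylor d del s (S p + J) Hd ltac:(lra)). fold z in HL.
  rewrite <- Hzm in *. apply (Rmult_le_reg_r (Cmod z ^ S p)). apply pow_lt; auto.
  unfold Rdiv. rewrite Rmult_assoc, Rinv_l, Rmult_1_r by (apply pow_nonzero; lra).
  apply Rle_trans with (1 := HL). replace (S (S p + J)) with (S J + S p)%nat by lia.
  rewrite (pow_add _ (S J) (S p)). right; ring.
Qed.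

Lemma hray_expands (p : nat) (d : C) (del : R) (J : nat) :
  d <> 0%C -> del * Cmod d <= / 2 -> expands (hray p d) d del (hcoef p) (S J).
Proof.
  intros Hd0 Hd. exists (2 * Cmod d ^ S J). split.
  { apply Rmult_le_pos. lra. apply pow_le, Cmod_ge_0. }
  intros s Hs. apply Rle_trans with (1 := hray_expands_explicit p d del J s Hd0 Hd Hs).
  rewrite Rpow_mult_distr. right; ring.
Qed.

Lemma hray_bound (p : nat) (d : C) (del s : R) :
  d <> 0%C -> del * Cmod d <= / 2 -> 0 < s <= del -> Cmod (hray p d s) <= 2 * Cmod d * s.
Proof.
  intros Hd0 Hd Hs. assert (H := hray_expands_explicit p d del 0 s Hd0 Hd Hs).
  replace (psT (hcoef p) 1 (RtoC s * d)) with (RtoC 0) in H.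
  2: { unfold psT, hcoef; simpl; ring. }
  replace (hray p d s - 0)%C with (hray p d s) in H by ring. simpl in H. lra.
Qed.

(** Taylor coefficients of [(1-z)^v]. *)
Definition bcoef (v : C) (j : nat) : C := (msign j * Cbinom v j)%C.

Lemma bcoef_S (v : C) (j : nat) :
  (RtoC (INR (S j)) * bcoef v (S j) = - (v - RtoC (INR j)) * bcoef v j)%C.
Proof.
  unfold bcoef, Cbinom, msign. change (falling v (S j)) with (falling v j * (v - RtoC (INR j)))%C.
  change (fact (S j)) with (S j * fact j)%nat. rewrite mult_INR, RtoC_mult. simpl Cpow. field.
  split. apply INR_fact_C_neq0. apply RtoC_neq0, not_0_INR; lia.
Qed.

(** [(1-z)^v] solves [(1-z) T' + v T = 0]; its Taylor polynomial of degree [N] solves it up to one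
    monomial. *)
Lemma bcoef_ode (v z : C) (N : nat) :
  ((1 - z) * Csum (fun j => RtoC (INR (S j)) * bcoef v (S j) * z ^ j) N + v * psT (bcoef v) (S N) z
   = (v - RtoC (INR N)) * bcoef v N * z ^ N)%C.
Proof.
  induction N.
  - unfold psT; simpl. ring.
  - change (psT (bcoef v) (S (S N)) z) with (psT (bcoef v) (S N) z + bcoef v (S N) * z ^ S N)%C.
    change (Csum (fun j => RtoC (INR (S j)) * bcoef v (S j) * z ^ j) (S N))%C with
      (Csum (fun j => RtoC (INR (S j)) * bcoef v (S j) * z ^ j) N
        + RtoC (INR (S N)) * bcoef v (S N) * z ^ N)%C.
    set (A := Csum _ N) in *. set (B := psT _ (S N) z) in *.
    transitivity ((1 - z) * A + v * B + (1 - z) * (RtoC (INR (S N)) * bcoef v (S N)) * z ^ N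
                  + v * bcoef v (S N) * z ^ S N)%C. ring.
    rewrite IHN. rewrite Cpow_S.
    transitivity (((v - RtoC (INR N)) * bcoef v N + RtoC (INR (S N)) * bcoef v (S N)) * z ^ N
       + (v - RtoC (INR (S N))) * bcoef v (S N) * (z * z ^ N))%C. ring.
    rewrite bcoef_S. ring.
Qed.

Lemma Cmod_Clog_ray (d : C) (del s : R) : del * Cmod d <= / 2 -> 0 <= s <= del ->
  Cmod (Clog (1 - RtoC s * d))%C <= 1.
Proof.
  intros Hd Hs. assert (H := log_ray_Taylor d del s 0 Hd Hs).
  unfold logT in H; simpl in H. rewrite Cplus_0_r in H.
  assert (0 <= Cmod d) by apply Cmod_ge_0.
  apply Rle_trans with (1 := H). nra.
Qed.

Lemma Cmod_Cexp_le (z : C) : Cmod (Cexp z) <= exp (Cmod z).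
Proof. rewrite Cmod_Cexp. apply exp_le, Re_le_Cmod. Qed.

(** The product of [(1-z)^(-v)] and the Taylor polynomial [T] equals 1 at 0, and by [bcoef_ode] its
    derivative is [O(s^N)]. So it stays within [O(s^(N+1))] of 1, and multiplying back by [(1-z)^v]
    compares the power with [T]. *)
Lemma power_ray_expands (v d : C) (del : R) (N : nat) :
  0 < del -> del * Cmod d <= / 2 ->
  expands (fun s => Cexp (v * Clog (1 - RtoC s * d))) d del (bcoef v) (S N).
Proof.
  intros Hdel Hd.
  set (T := fun s => psT (bcoef v) (S N) (RtoC s * d)).
  set (E := fun s => Cexp (- v * Clog (1 - RtoC s * d))%C).
  set (e := (d * ((v - RtoC (INR N)) * bcoef v N))%C).
  set (f := fun s => (E s * (e * (RtoC s * d) ^ N) / (1 - RtoC s * d))%C).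
  assert (HE : forall s, 0 <= s <= del -> Cmod (E s) <= exp (Cmod v)).
  { intros s Hs. unfold E. apply Rle_trans with (1 := Cmod_Cexp_le _). apply exp_le.
    rewrite Cmod_mult, Cmod_opp. generalize (Cmod_Clog_ray d del s Hd Hs) (Cmod_ge_0 v); nra. }
  assert (HQ : forall s, 0 <= s <= del -> Cmod (Cexp (v * Clog (1 - RtoC s * d))) <= exp (Cmod v)).
  { intros s Hs. apply Rle_trans with (1 := Cmod_Cexp_le _). apply exp_le.
    rewrite Cmod_mult. generalize (Cmod_Clog_ray d del s Hd Hs) (Cmod_ge_0 v); nra. }
  assert (HEd : forall s, 0 <= s <= del -> Cder E s (v * d / (1 - RtoC s * d) * E s)%C).
  { intros s Hs. unfold E. eapply Cder_ext_val. apply Cder_exp, Cder_scal.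
    apply (Cder_log_ray d del); auto. cbv beta. unfold Cdiv; ring. }
  assert (HW : forall s, 0 <= s <= del -> Cder (fun s => E s * T s)%C s (f s)).
  { intros s Hs. destruct (ray_bounds d del s Hd Hs) as [_ [H2 _]]. apply Cmod_half_neq0 in H2.
    eapply Cder_ext_val. apply Cder_mult. apply HEd; auto.
    unfold T.
    apply (Cder_ext (fun s => 1 + Csum (fun j => bcoef v (S j) * (RtoC s * d) ^ S j) N)%C).
    { intros. unfold psT. rewrite (Csum_S_l _ N). f_equal. unfold bcoef, Cbinom, msign; simpl. field. }
    apply Cder_plus. apply Cder_const. apply Cder_Csum. intros i Hi. apply Cder_scal, Cder_pow.
    apply Cder_mult. apply Cder_id. apply Cder_const.
    cbv beta. unfold f, e. rewrite Cplus_0_l.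
    rewrite (Csum_ext _ (fun j => d * (RtoC (INR (S j)) * bcoef v (S j) * (RtoC s * d) ^ j))%C)
      by (intros; ring).
    rewrite Csum_scal. fold (T s). set (z := (RtoC s * d)%C) in *.
    assert (O := bcoef_ode v z N). set (D := Csum _ N) in *. change (psT (bcoef v) (S N) z) with (T s) in *.
    transitivity (E s * d * ((1 - z) * D + v * T s) / (1 - z))%C. field; auto.
    rewrite O. field; auto. }
  set (M := exp (Cmod v) * (Cmod e * Cmod d ^ N) * 2).
  assert (HM : 0 <= M).
  { unfold M. repeat apply Rmult_le_pos; try lra; try apply Cmod_ge_0. left; apply exp_pos.
    apply pow_le, Cmod_ge_0. }
  exists (exp (Cmod v) * M). split. apply Rmult_le_pos; auto. left; apply exp_pos.
  intros s Hs. fold (T s).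
  replace (Cexp (v * Clog (1 - RtoC s * d)) - T s)%C with
    (- Cexp (v * Clog (1 - RtoC s * d)) * (E s * T s - E 0 * T 0))%C.
  2: { replace (E 0 * T 0)%C with (RtoC 1).
       unfold E. replace (- v * Clog (1 - RtoC s * d))%C with (- (v * Clog (1 - RtoC s * d)))%C by ring.
       rewrite Cexp_opp. field. apply Cexp_neq0.
       unfold E, T. rewrite psT_S. replace (1 - 0 * d)%C with (RtoC 1) by ring. rewrite Clog_1.
       replace (- v * 0)%C with (RtoC 0) by ring. rewrite Cexp_0.
       unfold bcoef at 1, Cbinom, msign; simpl. field. }
  rewrite Cmod_mult, Cmod_opp, Rmult_assoc.
  apply Rmult_le_compat; try apply Cmod_ge_0. apply HQ; lra.
  apply Rle_trans with (M * s ^ N * (s - 0)). 2: simpl; right; ring.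
  apply (Cder_mean_value (fun s => E s * T s)%C f 0 s).
  - lra.
  - intros; apply HW; lra.
  - intros x Hx. unfold f. apply (Ccont_div_ray _ d del); auto. lra.
    apply Ccont_mult. eapply Ccont_der, HEd; lra. apply Ccont_mult. apply Ccont_const.
    destruct N. apply (Ccont_ext (fun _ => 1%C)). reflexivity. apply Ccont_const.
    eapply Ccont_der, Cder_pow, Cder_mult. apply Cder_id. apply Cder_const.
  - intros x Hx. unfold f. assert (Hx' : 0 <= x <= del) by lra.
    destruct (ray_bounds d del x Hd Hx') as [_ [H2 _]].
    apply Rle_trans with (1 := Cmod_div_half _ _ H2). unfold M.
    replace (exp (Cmod v) * (Cmod e * Cmod d ^ N) * 2 * s ^ N) with
      (2 * (exp (Cmod v) * (Cmod e * (s * Cmod d) ^ N))) by (rewrite Rpow_mult_distr; ring).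
    apply Rmult_le_compat_l. lra. rewrite !Cmod_mult, Cmod_pow, Cmod_scaled by lra.
    apply Rmult_le_compat. apply Cmod_ge_0.
    apply Rmult_le_pos. apply Cmod_ge_0. apply pow_le. apply Rmult_le_pos. lra. apply Cmod_ge_0.
    apply HE; auto. apply Rmult_le_compat_l. apply Cmod_ge_0. apply pow_incr.
    assert (0 <= Cmod d) by apply Cmod_ge_0. split; nra.
Qed.

(** * Local contributions *)

(** One integrand for all local pieces: [d = 1] at the endpoint [z = 1] of the defining integral,
    [d = -1/w] for the stretch beyond [w], and [w = 1], [d = 1] or [-1] for the two sides of the
    saddle. *)
Definition gray (n : R) (w v d : C) (s : R) : C :=
  Cexp (RtoC n * (w * (RtoC s * d)) + (RtoC n + v) * Clog (1 - RtoC s * d))%C.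

Lemma Ccont_gray (n : R) (w v d : C) (del s : R) : del * Cmod d <= / 2 -> 0 <= s <= del ->
  Ccont (gray n w v d) s.
Proof.
  intros Hd Hs. unfold gray. eapply Ccont_der, Cder_exp, Cder_plus.
  apply Cder_scal, Cder_scal, Cder_mult. apply Cder_id. apply Cder_const.
  apply Cder_scal. apply (Cder_log_ray d del); auto.
Qed.

Lemma msign_sq (k : nat) : (msign k * msign k = 1)%C.
Proof.
  unfold msign. rewrite <- Cpow_mult_l. replace (-1 * -1)%C with (RtoC 1) by ring. apply Cpow_1_l.
Qed.

Lemma msign_add (j k : nat) : msign (j + k) = (msign j * msign k)%C.
Proof. apply Cpow_add_r. Qed.

Lemma msign_neq0 (k : nat) : msign k <> 0%C.
Proof. apply Cpow_nz, RtoC_neq0; lra. Qed.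

Lemma msign_sub (j i : nat) : (i <= j)%nat -> msign (j - i) = (msign j * msign i)%C.
Proof.
  intros H. replace j with (j - i + i)%nat at 2 by lia. rewrite msign_add, <- Cmult_assoc, msign_sq. ring.
Qed.

Lemma msign_even (r : nat) : msign (2 * r) = 1%C.
Proof. rewrite Nat.mul_comm. replace (r * 2)%nat with (r + r)%nat by lia. rewrite msign_add. apply msign_sq. Qed.

Lemma Cpow_opp_msign (z : C) (k : nat) : ((- z) ^ k = msign k * z ^ k)%C.
Proof. unfold msign. rewrite <- Cpow_mult_l. f_equal. ring. Qed.

Lemma ps_pow_vanish (f : nat -> C) (k : nat) : f 0%nat = 0%C ->
  forall n, (n < k)%nat -> ps_pow f k n = 0%C.
Proof.
  intros H0. induction k; intros n Hn. lia.
  simpl. unfold ps_mul. rewrite Csum_S_l, H0, Csum_zero. ring.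
  intros i Hi. rewrite IHk by lia. ring.
Qed.

Lemma Csum_pairs (f : nat -> C) (N : nat) :
  Csum f (2 * N) = Csum (fun r => f (2 * r)%nat + f (2 * r + 1)%nat)%C N.
Proof.
  induction N. reflexivity.
  replace (2 * S N)%nat with (S (S (2 * N))) by lia. simpl Csum at 1.
  replace (N + (N + 0))%nat with (2 * N)%nat by lia. rewrite IHN. simpl.
  replace (N + (N + 0) + 1)%nat with (S (N + (N + 0))) by lia. ring.
Qed.

(* Only the terms [k <= i] survive, since [ha] has no constant term. *)
Lemma coefficient_regroup (ha : nat -> C) (v : C) (X : nat -> C) (J r : nat) :
  ha 0%nat = 0%C -> (r < J)%nat ->
  Csum (fun k => X k * ps_mul (ps_pow ha k) (bcoef v) r)%C J =
  (msign r * Csum (fun i => msign i * Cbinom v (r - i) * Csum (fun k => X k * ps_pow ha k i) (S i))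
     (S r))%C.
Proof.
  intros H0 Hr.
  rewrite (Csum_ext _ (fun k => Csum (fun i => X k * (ps_pow ha k i * bcoef v (r - i))) (S r))%C).
  2: { intros k _. unfold ps_mul. rewrite Csum_scal. reflexivity. }
  rewrite Csum_exchange, <- Csum_scal. apply Csum_ext. intros i Hi.
  rewrite (Csum_extend _ (S i) J); [ | lia | ].
  2: { intros k Hk. rewrite ps_pow_vanish; auto; [ring | lia]. }
  rewrite <- !Csum_scal. apply Csum_ext. intros k Hk.
  unfold bcoef. rewrite (msign_sub r i) by lia. ring.
Qed.

(** All powers of [d] cancel. This is why the endpoint of the integral when [Re w < 1] and the end
    of the path at [w] otherwise produce the same coefficients [U_r]. The Kronecker delta is the
    leading 1 of [S_n]. *)
Lemma Ucoef_eq (w v : C) (d : C) (J r : nat) :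
  (1 - w)%C <> 0%C -> d <> 0%C -> (r < J)%nat ->
  (w * d * (d ^ r * Csum (fun k => (- d) ^ k / RtoC (INR (fact k)) *
      ps_mul (ps_pow (hcoef 0) k) (bcoef v) r *
      (RtoC (INR (fact (1 * k + r))) / ((1 - w) * d) ^ (1 * k + r + 1))) J)
   = Ucoef r w v - kdelta r)%C.
Proof.
  intros Hw Hd Hr.
  assert (Hw' : (w - 1)%C <> 0%C).
  { intros E. apply Hw. replace (1 - w)%C with (- (w - 1))%C by ring. rewrite E; ring. }
  rewrite (Csum_ext _ (fun k => (msign k * d ^ k / RtoC (INR (fact k)) *
     (RtoC (INR (fact (r + k))) / ((1 - w) * d) ^ (r + k + 1))) * ps_mul (ps_pow (hcoef 0) k) (bcoef v) r)%C).
  2: { intros k _. rewrite Cpow_opp_msign. replace (1 * k + r)%nat with (r + k)%nat by lia.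
       unfold Cdiv; ring. }
  rewrite coefficient_regroup; auto.
  unfold Ucoef. set (S1 := Csum _ (S r)). set (S2 := Csum _ (S r)).
  replace (kdelta r - S2 - kdelta r)%C with (- S2)%C by ring.
  unfold S1, S2. transitivity ((-1) * Csum (fun m => msign m * Cbinom v (r - m) *
     Csum (fun k => w / (w - 1) ^ (r + k + 1) *
                    (RtoC (INR (fact (r + k))) / RtoC (INR (fact k)))
                    * deMoivre seq2 m k) (S m)) (S r))%C. 2: ring.
  rewrite <- !Csum_scal. apply Csum_ext. intros i Hi.
  transitivity ((msign i * Cbinom v (r - i)) * ((w * d * d ^ r * msign r) *
     Csum (fun k => msign k * d ^ k / RtoC (INR (fact k)) *
       (RtoC (INR (fact (r + k))) / ((1 - w) * d) ^ (r + k + 1)) * ps_pow (hcoef 0) k i) (S i)))%C.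
  ring.
  transitivity ((msign i * Cbinom v (r - i)) * ((-1) * Csum (fun k => w / (w - 1) ^ (r + k + 1) *
                    (RtoC (INR (fact (r + k))) / RtoC (INR (fact k)))
                    * deMoivre seq2 i k) (S i)))%C. 2: ring.
  f_equal. rewrite <- !Csum_scal. apply Csum_ext. intros k Hk.
  replace (ps_pow (hcoef 0) k i) with (deMoivre seq2 i k) by reflexivity.
  replace (1 - w)%C with (- (w - 1))%C by ring.
  rewrite Cpow_mult_l, Cpow_opp_msign, !msign_add, (Cpow_add_r d), (Cpow_add_r d), Cpow_1_r.
  replace (msign 1) with (- (1))%C by (unfold msign; simpl; ring).
  assert (Hk2 := msign_sq k). assert (Hr2 := msign_sq r).
  assert (Hd1 : (d ^ r)%C <> 0%C) by (apply Cpow_nz; auto).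
  assert (Hd2 : (d ^ k)%C <> 0%C) by (apply Cpow_nz; auto).
  assert (Hw1 : ((w - 1) ^ (r + k + 1))%C <> 0%C) by (apply Cpow_nz; auto).
  assert (Hf := INR_fact_C_neq0 k). assert (Hm1 := msign_neq0 k). assert (Hm2 := msign_neq0 r).
  set (W := ((w - 1) ^ (r + k + 1))%C) in *. set (Dr := (d ^ r)%C) in *. set (Dk := (d ^ k)%C) in *.
  field. repeat split; auto.
Qed.

(** Since [log(1-z) = -z - z h], the phase is [-(1-w) z - z h]: Watson's lemma of degree 1 with
    [a = (1-w) d], [c = -d], [t = n]. Any smaller [del] is allowed, so that callers can add their
    own constraints. *)
Lemma local_linear (w v d : C) (N : nat) :
  d <> 0%C -> 0 < Re ((1 - w) * d)%C ->
  exists del0, 0 < del0 /\ forall del, 0 < del <= del0 -> del * Cmod d <= / 2 /\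
  exists K, 0 <= K /\ forall n l, 1 <= n -> Cint (gray n w v d) 0 del l ->
    Cmod (RtoC n * w * d * l - (Csum (fun r => Ucoef r w v / RtoC n ^ r) (S N) - 1))%C
      <= K / n ^ (S N).
Proof.
  intros Hd0 Ha. set (a := ((1 - w) * d)%C) in *.
  assert (Hmd : 0 < Cmod d) by (apply Cmod_pos; auto).
  (* From [|h| <= 2 |d| s] one gets [|c h| <= B s]; the second entry of the minimum keeps this below
     [Re a / 2]. *)
  set (B := Cmod d * (2 * Cmod d)). assert (HB : 0 < B) by (unfold B; nra).
  exists (Rmin (/ 2 / Cmod d) (Re a / 2 / B)). split.
  { apply Rmin_pos; repeat apply Rdiv_lt_0_compat; lra. }
  intros del Hdel.
  assert (H1 : del * Cmod d <= / 2).
  { apply Rle_trans with (/ 2 / Cmod d * Cmod d). apply Rmult_le_compat_r. lra.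
    apply Rle_trans with (1 := proj2 Hdel), Rmin_l. right; field; lra. }
  assert (H2 : del * B <= Re a / 2).
  { apply Rle_trans with (Re a / 2 / B * B). apply Rmult_le_compat_r. lra.
    apply Rle_trans with (1 := proj2 Hdel), Rmin_r. right; field; lra. }
  split; auto.
  assert (Hw : (1 - w)%C <> 0%C).
  { intros E. unfold a in Ha. rewrite E, Cmult_0_l in Ha. simpl in Ha; lra. }
  destruct (watson_ray 0 a (- d)%C d del (hray 0 d) (fun s => Cexp (v * Clog (1 - RtoC s * d)))
     (fun n s => gray n w v d s) (hcoef 0) (bcoef v)
     (fun i => RtoC (INR (fact i)) / a ^ (i + 1))%C (S N)) as [K [HK H]]; auto.
  - lra.
  - intros t s Ht Hs. unfold gray. rewrite <- Cexp_plus. f_equal. rewrite !Cpow_1_r.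
    unfold hray, logT, a. simpl Csum. simpl Cpow.
    field. repeat split; auto. apply RtoC_neq0; lra.
  - intros t s Ht Hs. apply (Ccont_gray t w v d del); auto.
  - exists (2 * Cmod d). split. lra. intros s Hs. apply (hray_bound 0 d del); auto.
  - intros s Hs. rewrite Cmod_mult, Cmod_opp.
    assert (Hb := hray_bound 0 d del s Hd0 H1 Hs).
    apply Rle_trans with (Cmod d * (2 * Cmod d * s)). apply Rmult_le_compat_l; lra.
    apply Rle_trans with (2 := H2). unfold B. nra.
  - apply hray_expands; auto.
  - apply power_ray_expands; auto. lra.
  - intros i. apply has_moment_exp; auto. lra.
  - exists (Cmod (w * d)%C * K). split. apply Rmult_le_pos; auto. apply Cmod_ge_0.
    intros n l Hn Hl. specialize (H n l Hn Hl).
    assert (Hn0 : RtoC n <> 0%C) by (apply RtoC_neq0; lra).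
    match type of H with Cmod (l - ?X)%C <= _ => set (Sm := X) in * end.
    replace (Csum (fun r => Ucoef r w v / RtoC n ^ r) (S N) - 1)%C with (RtoC n * w * d * Sm)%C.
    2: { transitivity (Csum (fun r => (Ucoef r w v - kdelta r) / RtoC n ^ r) (S N))%C.
         - unfold Sm. rewrite <- Csum_scal. apply Csum_ext. intros r Hr.
           rewrite <- (Ucoef_eq w v d (S N) r Hw Hd0 Hr). fold a.
           rewrite Cpow_add_r, Cpow_1_r. field. split; auto. apply Cpow_nz; auto.
         - rewrite (Csum_ext _ (fun r => Ucoef r w v / RtoC n ^ r - kdelta r / RtoC n ^ r)%C)
             by (intros; unfold Cdiv; ring).
           rewrite Csum_minus. f_equal. f_equal. rewrite Csum_S_l, Csum_zero.
           unfold kdelta; simpl. field.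
           intros; unfold kdelta; simpl. unfold Cdiv; ring. }
    replace (RtoC n * w * d * l - RtoC n * w * d * Sm)%C with (RtoC n * ((w * d) * (l - Sm)))%C by ring.
    rewrite Cmod_mult, (Cmod_mult (w * d)), Cmod_RtoC_pos by lra.
    apply Rle_trans with (n * (Cmod (w * d)%C * (K / n ^ (S N + 1)))).
    apply Rmult_le_compat_l. lra. apply Rmult_le_compat_l; auto. apply Cmod_ge_0.
    rewrite pow_add, pow_1. right. field. split. apply pow_nonzero; lra. lra.
Qed.

(** The coefficient delivered by [watson_ray] for [c = -1] and Gaussian moments, with the factor
    [d^j] left out. Even [j] give [gamma_r], odd [j] give [rho_r]. *)
Definition saddle_coef (v : C) (j J : nat) : C :=
  Csum (fun k => (- (1)) ^ k / RtoC (INR (fact k)) * ps_mul (ps_pow (hcoef 1) k) (bcoef v) j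
        * gmom (2 * k + j))%C J.

Lemma saddle_coef_even (v : C) (r J : nat) : (2 * r < J)%nat ->
  saddle_coef v (2 * r) J = (gam r v * RtoC (sqrt (PI / 2)))%C.
Proof.
  intros Hr. unfold saddle_coef.
  rewrite (Csum_ext _ (fun k => (msign k / RtoC (INR (fact k)) * gmom (2 * k + 2 * r)) *
     ps_mul (ps_pow (hcoef 1) k) (bcoef v) (2 * r))%C).
  2: { intros k _. rewrite Cpow_opp_msign, Cpow_1_l. unfold Cdiv; ring. }
  rewrite coefficient_regroup; auto. rewrite msign_even, Cmult_1_l.
  unfold gam. rewrite Cmult_comm, <- Csum_scal. apply Csum_ext. intros i Hi.
  transitivity (msign i * Cbinom v (2 * r - i) * (RtoC (sqrt (PI / 2)) *
     Csum (fun k => RtoC (INR (dfact (2 * r + 2 * k - 1))) / (msign k * RtoC (INR (fact k)))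
                   * deMoivre seq3 i k) (S i)))%C. 2: ring.
  f_equal. rewrite <- Csum_scal. apply Csum_ext. intros k Hk.
  replace (ps_pow (hcoef 1) k i) with (deMoivre seq3 i k) by reflexivity.
  unfold gmom. replace (2 * k + 2 * r)%nat with (2 * (r + k))%nat by lia.
  rewrite Nat.even_even. replace (2 * r + 2 * k)%nat with (2 * (r + k))%nat by lia.
  rewrite RtoC_mult.
  assert (Hf := INR_fact_C_neq0 k). assert (Hm1 := msign_neq0 k). assert (Hk2 := msign_sq k).
  set (mk := msign k) in *. set (D := deMoivre seq3 i k). set (F := RtoC (INR (fact k))) in *.
  set (q := RtoC (INR (dfact _))). set (p := RtoC (sqrt _)).
  transitivity ((mk * mk) * (q * p * D) / (mk * F))%C. field; auto.
  rewrite Hk2. field; auto.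
Qed.

Lemma saddle_coef_odd (v : C) (r J : nat) : (2 * r + 1 < J)%nat ->
  saddle_coef v (2 * r + 1) J = (rho r v - kdelta r)%C.
Proof.
  intros Hr. unfold saddle_coef.
  rewrite (Csum_ext _ (fun k => (msign k / RtoC (INR (fact k)) * gmom (2 * k + (2 * r + 1))) *
     ps_mul (ps_pow (hcoef 1) k) (bcoef v) (2 * r + 1))%C).
  2: { intros k _. rewrite Cpow_opp_msign, Cpow_1_l. unfold Cdiv; ring. }
  rewrite coefficient_regroup; auto. rewrite msign_add, msign_even, Cmult_1_l.
  replace (msign 1) with (- (1))%C by (unfold msign; simpl; ring).
  unfold rho. set (S1 := Csum _ _). set (S2 := Csum _ _).
  replace (kdelta r - S2 - kdelta r)%C with (- (1) * S2)%C by ring. f_equal.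
  unfold S1, S2. apply Csum_ext. intros i Hi. f_equal. apply Csum_ext. intros k Hk.
  replace (ps_pow (hcoef 1) k i) with (deMoivre seq3 i k) by reflexivity.
  unfold gmom. replace (2 * k + (2 * r + 1))%nat with (2 * (r + k) + 1)%nat by lia.
  rewrite Nat.even_odd. replace (2 * r + 2 * k)%nat with (2 * (r + k))%nat by lia.
  replace (2 * (r + k) + 1 - 1)%nat with (2 * (r + k))%nat by lia.
  assert (Hf := INR_fact_C_neq0 k). assert (Hm1 := msign_neq0 k). assert (Hk2 := msign_sq k).
  set (mk := msign k) in *. set (D := deMoivre seq3 i k). set (F := RtoC (INR (fact k))) in *.
  set (q := RtoC (INR (dfact _))).
  transitivity ((mk * mk) * (q * D) / (mk * F))%C. field; auto.
  rewrite Hk2. field; auto.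
Qed.

Lemma sqrt_half_saddle (n : R) : 0 <= n -> sqrt n * sqrt (PI / 2) = sqrt (2 * PI * n) / 2.
Proof.
  intros Hn. assert (HP := PI_RGT_0).
  replace (2 * PI * n) with ((2 * 2) * (n * (PI / 2))) by field.
  rewrite sqrt_mult, sqrt_square, sqrt_mult; nra.
Qed.

(** At [w = 1] the linear term of the phase cancels, and [z^2 = s^2] leaves [-s^2/2 - s^2 h]. Even
    powers of [d] are 1 and odd ones are [d], so the direction only affects the sign of the [rho_r]
    part. *)
Lemma local_saddle (v d : C) (N : nat) : (d * d = 1)%C ->
  exists del0, 0 < del0 /\ forall del, 0 < del <= del0 -> del * Cmod d <= / 2 /\
  exists K, 0 <= K /\ forall n l, 1 <= n -> Cint (gray n 1 v d) 0 del l ->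
    Cmod (RtoC n * l - Csum (fun r => / RtoC n ^ r *
       (d * (rho r v - kdelta r) + gam r v / 2 * sq2pin n)) (S N))%C
      <= K / sqrt n ^ (2 * N + 1).
Proof.
  intros Hdd.
  assert (Hd0 : d <> 0%C).
  { intros E. rewrite E in Hdd. apply (f_equal fst) in Hdd. simpl in Hdd; lra. }
  assert (Hmd : Cmod d = 1).
  { assert (E : Cmod d * Cmod d = 1) by (rewrite <- Cmod_mult, Hdd, Cmod_1; auto).
    generalize (Cmod_ge_0 d); nra. }
  (* [|h| <= 2 s <= 1/4], which is half of [a = 1/2]. *)
  exists (/ 8). split; [lra | ]. intros del Hdel.
  assert (H1 : del * Cmod d <= / 2) by (rewrite Hmd; lra). split; auto.
  (* With [t = sqrt n], each power of [1/n] takes two terms in [1/t], one even and one odd: hence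
     [2 (N+1)] terms. *)
  destruct (watson_ray 1 (RtoC (/ 2)) (- (1))%C d del (hray 1 d) (fun s => Cexp (v * Clog (1 - RtoC s * d)))
     (fun t s => gray (t * t) 1 v d s) (hcoef 1) (bcoef v) gmom (2 * S N)) as [K [HK H]]; auto.
  - simpl; lra.
  - lra.
  - intros t s Ht Hs. unfold gray. rewrite <- Cexp_plus. f_equal.
    unfold hray, logT. simpl Csum. simpl Cpow. rewrite RtoC_mult, RtoC_inv by lra.
    replace (RtoC (1 + 1)) with (RtoC 2) by (f_equal; ring).
    assert (Hs0 : RtoC s <> 0%C) by (apply RtoC_neq0; lra).
    symmetry. set (L := Clog _).
    transitivity (v * L + RtoC t * RtoC t * ((L + RtoC s * d + RtoC s * RtoC s * (d * d) / 2) / (d * d)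
      - RtoC s * RtoC s / 2))%C.
    + field. split; auto.
    + rewrite Hdd. field.
  - intros t s Ht Hs. apply (Ccont_gray (t * t) 1 v d del); auto.
  - exists (2 * Cmod d). split. lra. intros s Hs. apply (hray_bound 1 d del); auto.
  - intros s Hs. rewrite Cmod_mult, Cmod_opp, Cmod_1. simpl Re.
    assert (Hb := hray_bound 1 d del s Hd0 H1 Hs). rewrite Hmd in Hb. lra.
  - replace (2 * S N)%nat with (S (2 * N + 1)) by lia. apply hray_expands; auto.
  - replace (2 * S N)%nat with (S (2 * N + 1)) by lia. apply power_ray_expands; auto. lra.
  - intros i. apply has_moment_gauss; lra.
  - exists K. split; auto. intros n l Hn Hl.
    set (t := sqrt n). assert (Ht : 1 <= t) by (unfold t; rewrite <- sqrt_1; apply sqrt_le_1_alt; auto).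
    assert (Htt : t * t = n) by (apply sqrt_sqrt; lra).
    rewrite <- Htt in Hl. specialize (H t l Ht Hl).
    assert (Ht0 : RtoC t <> 0%C) by (apply RtoC_neq0; lra).
    match type of H with Cmod (l - ?X)%C <= _ => set (Sm := X) in * end.
    match goal with |- Cmod (_ - ?X)%C <= _ => replace X with (RtoC n * Sm)%C end.
    2: { unfold Sm. rewrite Csum_pairs, <- Csum_scal. apply Csum_ext. intros r Hr.
         change (Csum (fun k => _) _) with (saddle_coef v (2 * r) (2 * S N)) at 1.
         change (Csum (fun k => _) _) with (saddle_coef v (2 * r + 1) (2 * S N)) at 1.
         rewrite saddle_coef_even, saddle_coef_odd by lia.
         unfold sq2pin. replace (sqrt (2 * PI * n)) with (2 * (t * sqrt (PI / 2))).
         2: { unfold t. rewrite sqrt_half_saddle by lra. field. }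
         rewrite <- Htt, !RtoC_mult, !Cpow_add_r, !Cpow_mult_r.
         replace (d ^ 2)%C with (RtoC 1) by (simpl; rewrite Cmult_1_r; auto).
         replace (RtoC t ^ 2)%C with (RtoC t * RtoC t)%C by (simpl; ring).
         rewrite Cpow_1_l, !Cpow_1_r, Cpow_mult_l. field.
         split; auto; apply Cpow_nz; auto. }
    replace (RtoC n * l - RtoC n * Sm)%C with (RtoC n * (l - Sm))%C by ring.
    rewrite Cmod_mult, Cmod_RtoC_pos by lra.
    apply Rle_trans with (n * (K / t ^ (2 * S N + 1))).
    apply Rmult_le_compat_l; auto. lra.
    replace (2 * S N + 1)%nat with (2 * N + 1 + 2)%nat by lia. rewrite (pow_add t (2 * N + 1) 2).
    rewrite <- Htt. right. field. split. apply pow_nonzero; lra. lra.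
Qed.

(** * The primitive and the contour *)

(* [Ccpow] takes the value [1] at [s = 0] because [ln 0 = 0]; [pw] is its continuous version. *)
Definition pw (a : C) (s : R) : C := if Rle_dec s 0 then 0%C else Cexp (a * RtoC (ln s))%C.

Lemma pw_pos (a : C) (s : R) : 0 < s -> pw a s = Cexp (a * RtoC (ln s))%C.
Proof. intros H; unfold pw; destruct (Rle_dec s 0); auto; lra. Qed.

Lemma pw_0 (a : C) : pw a 0 = 0%C.
Proof. unfold pw; destruct (Rle_dec 0 0); auto; lra. Qed.

Lemma Clog_RtoC (s : R) : 0 < s -> Clog (RtoC s) = RtoC (ln s).
Proof.
  intros H. unfold Clog, Carg. rewrite Cmod_RtoC_pos by lra. simpl.
  destruct (Rlt_dec 0 s); [ | lra]. replace (0 / s) with 0 by (field; lra). rewrite atan_0. auto.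
Qed.

Lemma Cmod_pw (a : C) (s : R) : 0 < s -> Cmod (pw a s) = exp (Re a * ln s).
Proof. intros H. rewrite pw_pos, Cmod_Cexp by auto. f_equal. unfold Re; simpl; ring. Qed.

Lemma ln_le_0 (s : R) : 0 < s <= 1 -> ln s <= 0.
Proof. intros H. rewrite <- ln_1. destruct (Req_dec s 1). subst; lra. left; apply ln_increasing; lra. Qed.

Lemma pw_le_sq (a : C) (s : R) : 2 <= Re a -> s <= 1 -> Cmod (pw a s) <= s * s.
Proof.
  intros Ha Hs. destruct (Rle_dec s 0).
  - unfold pw. destruct (Rle_dec s 0); [ | lra]. rewrite Cmod_0. nra.
  - rewrite Cmod_pw by lra. replace (s * s) with (exp (2 * ln s)).
    apply exp_le. assert (ln s <= 0) by (apply ln_le_0; lra). nra.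
    replace (2 * ln s) with (ln s + ln s) by ring. rewrite exp_plus, exp_ln; lra.
Qed.

Lemma pw_le_1 (a : C) (s : R) : 2 <= Re a -> 0 <= s <= 1 -> Cmod (pw a s) <= 1.
Proof. intros Ha Hs. apply Rle_trans with (1 := pw_le_sq a s Ha ltac:(lra)). nra. Qed.

Lemma pw_S (a : C) (s : R) : (RtoC s * pw a s)%C = pw (a + 1)%C s \/ s < 0.
Proof.
  destruct (Rlt_dec s 0); auto. left. destruct (Req_dec s 0).
  - subst. rewrite !pw_0. ring.
  - rewrite !pw_pos by lra. rewrite Cmult_plus_distr_r, Cexp_plus, Cmult_1_l, Cexp_RtoC, exp_ln by lra.
    ring.
Qed.

Lemma Rabs_Re_le (z : C) : Rabs (Re z) <= Cmod z.
Proof. apply re_le_Cmod. Qed.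

Lemma Rabs_Im_le (z : C) : Rabs (Im z) <= Cmod z.
Proof. apply Rle_trans with (2 := Rmax_Cmod z). apply Rmax_r. Qed.

(** A quadratic remainder suffices for the two derivatives not given by a closed formula: the power
    at 0, and the integral depending on a parameter. *)
Lemma Cder_quadratic (f : R -> C) (x : R) (l : C) (K : R) :
  (forall h, Rabs h <= 1 -> Cmod (f (x + h)%R - f x - RtoC h * l)%C <= K * (h * h)) -> Cder f x l.
Proof.
  intros H.
  assert (HK : 0 <= K).
  { assert (H1 := H 1). rewrite Rabs_R1 in H1. specialize (H1 (Rle_refl 1)).
    generalize (Cmod_ge_0 (f (x + 1)%R - f x - RtoC 1 * l)%C); lra. }
  assert (G : forall g : R -> R, forall m, (forall h, Rabs h <= 1 -> Rabs (g (x + h) - g x - h * m) <= K * (h * h)) ->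
     is_derive g x m).
  { intros g m Hg. apply is_derive_Reals. intros eps Heps.
    assert (Hd : 0 < Rmin 1 (eps / (K + 1))) by (apply Rmin_pos; [lra | apply Rdiv_lt_0_compat; lra]).
    exists (mkposreal _ Hd). intros h Hh0 Hh. simpl in Hh.
    assert (Hh1 : Rabs h <= 1) by (generalize (Rmin_l 1 (eps / (K + 1))); lra).
    assert (Hh2 : Rabs h < eps / (K + 1)) by (generalize (Rmin_r 1 (eps / (K + 1))); lra).
    specialize (Hg h Hh1).
    replace ((g (x + h) - g x) / h - m) with ((g (x + h) - g x - h * m) / h) by (field; auto).
    unfold Rdiv. rewrite Rabs_mult, Rabs_inv. assert (0 < Rabs h) by (apply Rabs_pos_lt; auto).
    apply Rle_lt_trans with (K * Rabs h).
    - apply (Rmult_le_reg_r (Rabs h)); auto. rewrite Rmult_assoc, Rinv_l, Rmult_1_r by lra.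
      apply Rle_trans with (1 := Hg). rewrite Rmult_assoc, <- Rabs_mult, (Rabs_pos_eq (h * h)) by nra. lra.
    - apply Rle_lt_trans with ((K + 1) * Rabs h). nra.
      apply (Rmult_lt_compat_l (K + 1)) in Hh2; [ | lra].
      replace ((K + 1) * (eps / (K + 1))) with eps in Hh2 by (field; lra). auto. }
  split; apply G; intros h Hh; apply Rle_trans with (2 := H h Hh).
  - apply Rle_trans with (2 := Rabs_Re_le _). right; f_equal. unfold Re, Im; simpl; ring.
  - apply Rle_trans with (2 := Rabs_Im_le _). right; f_equal. unfold Re, Im; simpl; ring.
Qed.

(** At 0 the derivative is two-sided: [pw] vanishes on the left and is at most [s^2] on the right.
    This is the source of the condition [2 <= Re a], and so of the threshold [n >= |Re v| + 2] in
    all later estimates. *)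
Lemma Cder_pw (a : C) (s : R) : 2 <= Re a -> 0 <= s -> Cder (pw a) s (a * pw (a - 1) s)%C.
Proof.
  intros Ha Hs. destruct (Req_dec s 0) as [-> | Hn].
  - apply (Cder_quadratic _ _ _ 1). intros h Hh. rewrite !pw_0, Rplus_0_l.
    replace (pw a h - 0 - RtoC h * (a * 0))%C with (pw a h) by ring. rewrite Rmult_1_l.
    apply pw_le_sq; auto. generalize (Rle_abs h); lra.
  - assert (Hp : 0 < s) by lra. apply (Cder_ext_loc (fun s => Cexp (a * RtoC (ln s))%C)).
    + assert (Hd : 0 < s) by lra. exists (mkposreal s Hd). intros y Hy.
      rewrite pw_pos; auto. unfold ball in Hy; simpl in Hy; unfold AbsRing_ball, abs, minus, plus, opp in Hy; simpl in Hy.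
      apply Rabs_def2 in Hy. lra.
    + eapply Cder_ext_val. apply Cder_exp, Cder_scal. instantiate (1 := RtoC (/ s)).
      split; simpl. apply is_derive_ln; auto. apply (is_derive_const (V := R_NormedModule)).
      rewrite pw_pos by auto.
      replace (a * RtoC (ln s))%C with ((a - 1) * RtoC (ln s) + RtoC (ln s))%C by ring.
      rewrite Cexp_plus, Cexp_RtoC, exp_ln, RtoC_inv by lra. field. apply RtoC_neq0; lra.
Qed.

Lemma Ccont_pw (a : C) (s : R) : 2 <= Re a -> 0 <= s -> Ccont (pw a) s.
Proof. intros; eapply Ccont_der, Cder_pw; auto. Qed.

Definition eker (n : R) (e a : C) (s : R) : C := (Cexp (- (RtoC n * e) * RtoC s) * pw a s)%C.

Definition Eint (n : R) (a e : C) : C := RInt (V := C_R_CompleteNormedModule) (eker n e a) 0 1.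

Lemma Cder_expker (n : R) (e : C) (s : R) :
  Cder (fun s => Cexp (- (RtoC n * e) * RtoC s)%C) s
    (- (RtoC n * e) * Cexp (- (RtoC n * e) * RtoC s))%C.
Proof. apply Cder_exp. eapply Cder_ext_val. apply Cder_scal, Cder_id. ring. Qed.

Lemma Ccont_eker (n : R) (e a : C) (s : R) : 2 <= Re a -> 0 <= s -> Ccont (eker n e a) s.
Proof.
  intros. apply Ccont_mult. eapply Ccont_der, Cder_expker. apply Ccont_pw; auto.
Qed.

Lemma Eint_correct (n : R) (a e : C) : 2 <= Re a -> Cint (eker n e a) 0 1 (Eint n a e).
Proof.
  intros Ha. destruct (Cint_ex (eker n e a) 0 1) as [l Hl]. lra.
  intros; apply Ccont_eker; auto; lra.
  unfold Eint. rewrite (Cint_RInt _ _ _ _ Hl). auto.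
Qed.

Lemma Re_plus_1 (a : C) : Re (a + 1)%C = Re a + 1.
Proof. reflexivity. Qed.

(** Integrates the derivative of [e^(-n e s) s^(a+1)]. The left side is the bracket that appears
    when [Fprim] is differentiated. *)
Lemma Eint_by_parts (n : R) (a e : C) : 2 <= Re a ->
  ((a + 1) * Eint n a e - RtoC n * e * Eint n (a + 1) e = Cexp (- (RtoC n * e)))%C.
Proof.
  intros Ha. assert (Ha1 : 2 <= Re (a + 1)%C) by (rewrite Re_plus_1; lra).
  eapply (Cint_unique _ 0 1).
  - apply Cint_minus. lra. apply Cint_scal, Eint_correct; auto. apply Cint_scal, Eint_correct; auto.
  - replace (Cexp (- (RtoC n * e))%C) with (eker n e (a + 1) 1 - eker n e (a + 1) 0)%C.
    2: { unfold eker. rewrite pw_0, pw_pos, ln_1, !Cmult_0_r, Cexp_0, !Cmult_1_r by lra. ring. }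
    apply (Cint_FTC (eker n e (a + 1))). lra.
    + intros x Hx. eapply Cder_ext_val. apply Cder_mult. apply Cder_expker. apply Cder_pw; auto; lra.
      cbv beta. unfold eker. replace (a + 1 - 1)%C with a by ring. ring.
    + intros x Hx.
      apply (Ccont_ext (fun x => (a + 1) * eker n e a x + - (RtoC n * e) * eker n e (a + 1) x)%C).
      intros; ring.
      apply Ccont_plus; (apply Ccont_mult; [apply Ccont_const | apply Ccont_eker; auto; lra]).
Qed.

Lemma expT_2 (X : C) : expT 2 X = (1 + X)%C.
Proof. unfold expT; simpl. field. Qed.

(** Differentiation under the integral: the increment of the exponent is [y = - n e1 h s], and
    [e^y - 1 - y] is [O(h^2)] uniformly for [s] in [[0,1]]. *)
Lemma Cder_Eint (n : R) (a e0 e1 : C) (x : R) : 0 <= n -> 2 <= Re a ->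
  Cder (fun t => Eint n a (e0 + RtoC t * e1)) x
    (- (RtoC n * e1) * Eint n (a + 1) (e0 + RtoC x * e1))%C.
Proof.
  intros Hn Ha. assert (Ha1 : 2 <= Re (a + 1)%C) by (rewrite Re_plus_1; lra).
  set (e := (e0 + RtoC x * e1)%C). set (B := n * Cmod e1).
  assert (HB : 0 <= B) by (apply Rmult_le_pos; auto; apply Cmod_ge_0).
  apply (Cder_quadratic _ _ _ (exp (n * Cmod e) * (B * B * exp B))). intros h Hh. fold e.
  replace (e0 + RtoC (x + h) * e1)%C with (e + RtoC h * e1)%C by (unfold e; rewrite RtoC_plus; ring).
  set (l := (_ - _ - _)%C).
  assert (Hl : Cint (fun s => (eker n (e + RtoC h * e1) a s - eker n e a s)
     - RtoC h * (- (RtoC n * e1)) * eker n e (a + 1) s)%C 0 1 l).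
  { unfold l. rewrite (Cmult_assoc (RtoC h)).
    apply Cint_minus. lra. apply Cint_minus. lra. apply Eint_correct; auto. apply Eint_correct; auto.
    apply Cint_scal, Eint_correct; auto. }
  apply Rle_trans with (exp (n * Cmod e) * (B * B * exp B) * (h * h) * (1 - 0)); [ | lra].
  refine (Cint_Cmod_le_const _ 0 1 l _ _ _ Hl). lra.
  intros s Hs.
  set (y := (- (RtoC n * e1) * RtoC h * RtoC s)%C).
  match goal with |- Cmod ?Z <= _ =>
    replace Z with (Cexp (- (RtoC n * e) * RtoC s) * pw a s * (Cexp y - expT 2 y))%C end.
  2: { rewrite expT_2. unfold eker. destruct (pw_S a s) as [E | E]; [ | lra]. rewrite <- E.
       replace (- (RtoC n * (e + RtoC h * e1)) * RtoC s)%C with (- (RtoC n * e) * RtoC s + y)%C by (unfold y; ring).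
       rewrite Cexp_plus. unfold y; ring. }
  rewrite !Cmod_mult.
  assert (Hy : Cmod y <= B * Rabs h).
  { unfold y. rewrite !Cmod_mult, Cmod_opp, Cmod_mult, (Cmod_RtoC_pos n), (Cmod_RtoC_pos s), Cmod_R by lra.
    fold B. assert (0 <= B * Rabs h) by (apply Rmult_le_pos; auto; apply Rabs_pos). nra. }
  assert (HyB : Cmod y <= B) by (assert (0 <= Rabs h) by apply Rabs_pos; nra).
  assert (HT := Cexp_Taylor y 2).
  assert (Hp : Cmod (pw a s) <= 1) by (apply pw_le_1; auto; lra).
  assert (He : Cmod (Cexp (- (RtoC n * e) * RtoC s)) <= exp (n * Cmod e)).
  { apply Rle_trans with (1 := Cmod_Cexp_le _). apply exp_le.
    rewrite Cmod_mult, Cmod_opp, Cmod_mult, (Cmod_RtoC_pos n), (Cmod_RtoC_pos s) by lra.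
    assert (0 <= n * Cmod e) by (apply Rmult_le_pos; auto; apply Cmod_ge_0). nra. }
  assert (HT2 : Cmod (Cexp y - expT 2 y)%C <= B * B * exp B * (h * h)).
  { apply Rle_trans with (1 := HT).
    replace (B * B * exp B * (h * h)) with ((B * Rabs h) ^ 2 * exp B).
    apply Rmult_le_compat. apply pow_le, Cmod_ge_0. left; apply exp_pos.
    apply pow_incr. split; auto. apply Cmod_ge_0. apply exp_le; auto.
    simpl. rewrite !Rmult_1_r.
    replace (B * Rabs h * (B * Rabs h)) with (B * B * (Rabs h * Rabs h)) by ring.
    rewrite <- Rabs_mult, (Rabs_pos_eq (h * h)) by nra. ring. }
  rewrite (Rmult_assoc (exp (n * Cmod e))).
  apply Rmult_le_compat; auto. apply Rmult_le_pos; apply Cmod_ge_0. apply Cmod_ge_0.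
  apply Rle_trans with (Cmod (Cexp (- (RtoC n * e) * RtoC s)) * 1); [ | lra].
  apply Rmult_le_compat_l; auto. apply Cmod_ge_0.
Qed.

Lemma Cexp_Clog (z : C) : 0 < Re z -> Cexp (Clog z) = z.
Proof.
  intros Hz. unfold Cexp, Clog, Carg; simpl. destruct (Rlt_dec 0 (Re z)); [ | lra].
  assert (Hm : 0 < Cmod z) by (apply Cmod_pos, Re_pos_neq0; auto).
  rewrite exp_ln by auto. set (x := Re z) in *. set (y := Im z).
  assert (Hq : sqrt (1 + Rsqr (y / x)) = Cmod z / x).
  { unfold Cmod. change (fst z) with x. change (snd z) with y.
    replace (1 + Rsqr (y / x)) with ((x ^ 2 + y ^ 2) / (x * x)) by (unfold Rsqr; field; lra).
    rewrite sqrt_div by nra. rewrite sqrt_square by lra. auto. }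
  rewrite cos_atan, sin_atan, Hq. apply C_eq.
  - change (Cmod z * (1 / (Cmod z / x)) = x). field; lra.
  - change (Cmod z * (y / x / (Cmod z / x)) = y). field; lra.
Qed.

Definition fint (n : R) (a u : C) : C := Cexp (- (RtoC n * u) + a * Clog u)%C.
Definition Fprim (n : R) (a u : C) : C := (Cexp ((a + 1) * Clog u) * Eint n a u)%C.

(** The product rule leaves [e1 e^a] times the bracket of [Eint_by_parts], which collapses to the
    exponential. [Re > 0] is needed only for the logarithm. *)
Lemma Cder_Fprim (n : R) (a e0 e1 : C) (x : R) : 0 <= n -> 2 <= Re a ->
  0 < Re (e0 + RtoC x * e1)%C ->
  Cder (fun t => Fprim n a (e0 + RtoC t * e1)) x (e1 * fint n a (e0 + RtoC x * e1))%C.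
Proof.
  intros Hn Ha He. unfold Fprim. eapply Cder_ext_val. apply Cder_mult.
  apply Cder_exp, Cder_scal, Cder_log; auto. apply Cder_lin. apply Cder_Eint; auto.
  cbv beta. set (e := (e0 + RtoC x * e1)%C) in *. assert (He0 := Re_pos_neq0 e He).
  transitivity (e1 * / e * Cexp ((a + 1) * Clog e) *
    ((a + 1) * Eint n a e - RtoC n * e * Eint n (a + 1) e))%C. field; auto.
  rewrite Eint_by_parts by auto. unfold fint.
  replace ((a + 1) * Clog e)%C with (a * Clog e + Clog e)%C by ring.
  rewrite !Cexp_plus, (Cexp_Clog e He). field; auto.
Qed.

Lemma Ccont_fint (n : R) (a e0 e1 : C) (x : R) : 0 < Re (e0 + RtoC x * e1)%C ->
  Ccont (fun t => fint n a (e0 + RtoC t * e1)) x.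
Proof.
  intros He. unfold fint. eapply Ccont_der, Cder_exp, Cder_plus.
  - apply (Cder_ext (fun t => - RtoC n * (e0 + RtoC t * e1))%C). intros; ring.
    apply Cder_scal, Cder_lin.
  - apply Cder_scal, Cder_log; auto. apply Cder_lin.
Qed.

Lemma segment_integral (n : R) (a e0 e1 : C) (b : R) : 0 <= n -> 2 <= Re a -> 0 <= b ->
  (forall x, 0 <= x <= b -> 0 < Re (e0 + RtoC x * e1)%C) ->
  Cint (fun t => e1 * fint n a (e0 + RtoC t * e1))%C 0 b
    (Fprim n a (e0 + RtoC b * e1) - Fprim n a e0)%C.
Proof.
  intros Hn Ha Hb He.
  replace (Fprim n a e0) with (Fprim n a (e0 + 0 * e1)) by (f_equal; ring).
  apply (Cint_FTC (fun t => Fprim n a (e0 + RtoC t * e1))); auto.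
  intros; apply Cder_Fprim; auto.
  intros; apply Ccont_mult. apply Ccont_const. apply Ccont_fint; auto.
Qed.

Lemma Sn_Eint (n : R) (w v : C) : 2 <= Re (RtoC n + v)%C ->
  Sn n w v = (1 + RtoC n * w * (Cexp (RtoC n * w) * Eint n (RtoC n + v) w))%C.
Proof.
  intros Ha. unfold Sn. do 2 f_equal. apply Cint_RInt.
  apply (Cint_ext (fun s => Cexp (RtoC n * w) * eker n w (RtoC n + v) s)%C). lra.
  - intros s Hs. unfold eker, Ccpow. rewrite pw_pos, Clog_RtoC by lra.
    rewrite RtoC_minus. replace (RtoC n * w * (1 - RtoC s))%C with
      (RtoC n * w + - (RtoC n * w) * RtoC s)%C by ring. rewrite Cexp_plus. ring.
  - apply Cint_scal, Eint_correct; auto.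
Qed.

Lemma Sn_Fprim (n : R) (w v : C) : 2 <= Re (RtoC n + v)%C -> 0 < Re w ->
  Sn n w v = (1 + RtoC n * (Cexp (RtoC n * w - (RtoC n + v) * Clog w) * Fprim n (RtoC n + v) w))%C.
Proof.
  intros Ha Hw. rewrite Sn_Eint by auto. f_equal. unfold Fprim.
  set (a := (RtoC n + v)%C). set (E := Eint n a w).
  assert (X : (Cexp (RtoC n * w - a * Clog w) * Cexp ((a + 1) * Clog w) = w * Cexp (RtoC n * w))%C).
  { rewrite <- (Cexp_Clog w Hw) at 4. rewrite <- !Cexp_plus. f_equal. ring. }
  rewrite (Cmult_assoc (Cexp (RtoC n * w - a * Clog w))), X. ring.
Qed.

Lemma Cint_reflect (f : R -> C) (b : R) (l : C) :
  Cint f (1 - b) 1 l -> Cint (fun s => f (1 - s)) 0 b l.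
Proof.
  assert (G : forall (g : R -> R) m, is_RInt g (1 - b) 1 m -> is_RInt (fun s => g (1 - s)) 0 b m).
  { intros g m H. apply (is_RInt_swap (V := R_NormedModule)) in H.
    replace 1 with (-1 * 0 + 1) in H at 1 by ring. replace (1 - b) with (-1 * b + 1) in H by ring.
    apply (is_RInt_comp_lin (V := R_NormedModule)) in H.
    apply (is_RInt_scal (V := R_NormedModule) _ _ _ (-1)) in H.
    evar_last. eapply is_RInt_ext; [ | exact H].
    intros s _. simpl. unfold scal; simpl; unfold mult; simpl.
    replace (-1 * s + 1) with (1 - s) by ring. ring.
    unfold scal, opp; simpl; unfold mult; simpl. ring. }
  intros [H1 H2]; split. apply (G (fun t => Re (f t)) _ H1). apply (G (fun t => Im (f t)) _ H2).
Qed.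

Lemma ln_1_minus_le (s : R) : 0 <= s < 1 -> ln (1 - s) <= - s - s * s / 2.
Proof.
  intros Hs. destruct (Req_dec s 0) as [-> | Hn].
  { replace (1 - 0) with 1 by ring. rewrite ln_1. lra. }
  (* The difference of the two sides vanishes at 0 and decreases. *)
  destruct (MVT_gen (fun s => ln (1 - s) + s + s * s / 2) 0 s (fun s => - s * s / (1 - s))) as [c [Hc E]].
  - intros x. rewrite Rmin_left, Rmax_right by lra. intros Hx. auto_derive. lra. field. lra.
  - intros x. rewrite Rmin_left, Rmax_right by lra. intros Hx.
    apply continuity_pt_filterlim.
    apply (ex_derive_continuous (K := R_AbsRing) (V := R_NormedModule)
             (fun s => ln (1 - s) + s + s * s / 2)).
    auto_derive. lra.
  - rewrite Rmin_left, Rmax_right in Hc by lra.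
    replace (ln (1 - 0) + 0 + 0 * 0 / 2) with 0 in E.
    2: { replace (1 - 0) with 1 by ring. rewrite ln_1. field. }
    assert (0 <= c * c / (1 - c)) by (apply Rdiv_le_0_compat; [nra | lra]).
    replace (- c * c / (1 - c)) with (- (c * c / (1 - c))) in E by (field; lra). nra.
Qed.

(* For [Re w <= 1], [ln (1 - s) <= - s - s^2 / 2] makes the part [s >= del] exponentially small. *)
Lemma real_segment_reduction (w v : C) (del : R) : Re w <= 1 -> 0 < del <= / 2 ->
  exists K, 0 <= K /\ forall n, Rabs (Re v) + 2 <= n ->
  exists l, Cint (gray n w v 1) 0 del l /\
    Cmod (Cexp (RtoC n * w) * Eint n (RtoC n + v) w - l)%C <= K * exp (- (del * del / 2) * n).
Proof.
  intros Hw Hd. exists (exp (2 * Rabs (Re v))). split. left; apply exp_pos.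
  intros n Hn. set (a := (RtoC n + v)%C).
  assert (HRv := Rabs_pos (Re v)). assert (HRv2 := Rle_abs (- Re v)). rewrite Rabs_Ropp in HRv2.
  assert (Ha : 2 <= Re a) by (unfold a; rewrite Re_plus, Re_RtoC; lra).
  set (f := fun s => (Cexp (RtoC n * w) * eker n w a s)%C).
  assert (Hf : forall s, 0 <= s -> Ccont f s).
  { intros s Hs. apply Ccont_mult. apply Ccont_const. apply Ccont_eker; auto. }
  destruct (Cint_ex f 0 (1 - del)) as [l1 Hl1]. lra. intros; apply Hf; lra.
  destruct (Cint_ex f (1 - del) 1) as [l2 Hl2]. lra. intros; apply Hf; lra.
  assert (E : (Cexp (RtoC n * w) * Eint n a w)%C = (l1 + l2)%C).
  { eapply Cint_unique. apply Cint_scal, Eint_correct; auto. apply (Cint_Chasles f 0 (1 - del) 1); auto. }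
  exists l2. split.
  - apply Cint_reflect in Hl2. apply (Cint_ext _ (gray n w v 1)) in Hl2; auto. lra.
    intros s Hs. unfold f, eker, gray. rewrite pw_pos by lra.
    replace (1 - RtoC s * 1)%C with (RtoC (1 - s)) by (rewrite RtoC_minus; ring).
    rewrite Clog_RtoC by lra. fold a. rewrite <- !Cexp_plus.
    f_equal. rewrite RtoC_minus. ring.
  - rewrite E. replace (l1 + l2 - l2)%C with l1 by ring.
    set (M := exp (2 * Rabs (Re v)) * exp (- (del * del / 2) * n)).
    assert (HM : 0 < M) by (apply Rmult_lt_0_compat; apply exp_pos).
    apply Rle_trans with (M * (1 - del - 0)). 2: nra.
    refine (Cint_Cmod_le_const f 0 (1 - del) l1 M _ _ Hl1). lra.
    intros z Hz. unfold f, eker. rewrite !Cmod_mult, Cmod_pw, !Cmod_Cexp by lra.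
    unfold M. rewrite <- !exp_plus. apply exp_le.
    replace (Re (RtoC n * w)%C) with (n * Re w) by (unfold Re; simpl; ring).
    replace (Re (- (RtoC n * w) * RtoC z)%C) with (- (n * Re w * z)) by (unfold Re; simpl; ring).
    unfold a. rewrite Re_plus, Re_RtoC.
    assert (HL := ln_1_minus_le (1 - z) ltac:(lra)). replace (1 - (1 - z)) with z in HL by ring.
    assert (HL0 : ln z <= 0) by (apply ln_le_0; lra).
    set (s := 1 - z) in *. assert (Hs : del <= s < 1) by (unfold s; lra).
    replace z with (1 - s) by (unfold s; ring).
    set (m := Rabs (Re v)) in *.
    (* Lowering [n + Re v] to [n - m] is allowed because [ln z <= 0]. The linear part [-n s] then
       cancels the growth [n s Re w] of the exponential, and the leftover [m (s + s^2/2) <= 2 m] is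
       the constant announced at the start. *)
    assert (H1 : (n + Re v) * ln z <= (n - m) * (- s - s * s / 2)).
    { apply Rle_trans with ((n - m) * ln z). nra. apply Rmult_le_compat_l; lra. }
    replace (1 - s) with z by (unfold s; ring).
    assert (H2 : n * Re w - n * Re w * z <= n * s).
    { replace (n * Re w - n * Re w * z) with (n * s * Re w) by (unfold s; ring).
      assert (0 <= n * s) by (apply Rmult_le_pos; lra). nra. }
    assert (H3 : del * del <= s * s) by (apply Rmult_le_compat; lra).
    assert (H4 : n * (del * del) <= n * (s * s)) by (apply Rmult_le_compat_l; lra).
    assert (H5 : m * (s + s * s / 2) <= m * 2) by (apply Rmult_le_compat_l; nra).
    lra.
Qed.

(** * Assembling the pieces *)

(** The extra [n] is the factor in front of the integral in [S_n]. *)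
Lemma exp_small (c : R) (P : nat) : 0 < c ->
  exists K, 0 <= K /\ forall n, 1 <= n -> n * exp (- c * n) <= K / n ^ P.
Proof.
  intros Hc. destruct (pow_exp_le_inv c (S P) Hc) as [K [HK H]]. exists K. split; auto.
  intros n Hn. apply Rle_trans with (n * (K / n ^ S P)).
  apply Rmult_le_compat_l. lra. apply H; lra. right. simpl. field.
  split. apply pow_nonzero; lra. lra.
Qed.

Lemma sqrt_ge_1 (n : R) : 1 <= n -> 1 <= sqrt n.
Proof. intros H. rewrite <- sqrt_1. apply sqrt_le_1_alt; auto. Qed.

Lemma div_pow_le_div_sqrt (K n : R) (N : nat) : 0 <= K -> 1 <= n ->
  K / n ^ S N <= K / sqrt n ^ (2 * N + 1).
Proof.
  intros HK Hn. apply Rmult_le_compat_l; auto. assert (Hs := sqrt_ge_1 n Hn).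
  apply Rinv_le_contravar. apply pow_lt; lra.
  replace (n ^ S N) with (sqrt n ^ (2 * S N)). apply Rle_pow; [lra | lia].
  rewrite pow_mult. f_equal. simpl. rewrite Rmult_1_r. apply sqrt_sqrt; lra.
Qed.

Lemma Rpower_half (n : R) (N : nat) : 1 <= n -> Rpower n (INR (S N) - / 2) = sqrt n ^ (2 * N + 1).
Proof.
  intros Hn. rewrite <- Rpower_pow by (apply sqrt_lt_R0; lra). rewrite <- Rpower_sqrt by lra.
  rewrite Rpower_mult. f_equal. rewrite plus_INR, mult_INR, S_INR. simpl. field.
Qed.

Lemma Csum_kdelta (n : C) (N : nat) : Csum (fun r => / n ^ r * kdelta r)%C (S N) = 1%C.
Proof.
  rewrite Csum_S_l, Csum_zero. unfold kdelta; simpl. field.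
  intros; unfold kdelta; simpl; ring.
Qed.

Lemma Rmin_half_pos (x : R) : 0 < x -> 0 < Rmin x (/ 2).
Proof. intros; apply Rmin_pos; lra. Qed.

Lemma n_large (v : C) (n : R) : Rabs (Re v) + 2 <= n -> 1 <= n /\ 2 <= Re (RtoC n + v)%C.
Proof.
  intros Hn. assert (HRv := Rabs_pos (Re v)). assert (HRv2 := Rle_abs (- Re v)).
  rewrite Rabs_Ropp in HRv2. rewrite Re_plus, Re_RtoC. lra.
Qed.

(** The integral over [[0,1]] at [w = 1] approaches the saddle from the left only; with [u = 1 - s]
    this is direction [d = 1]. *)
Lemma left_half_saddle (v : C) (N : nat) :
  exists K, 0 <= K /\ forall n, Rabs (Re v) + 2 <= n ->
    Cmod (RtoC n * (Cexp (RtoC n) * Eint n (RtoC n + v) 1)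
      - Csum (fun r => / RtoC n ^ r * (1 * (rho r v - kdelta r) + gam r v / 2 * sq2pin n)) (S N))%C
    <= K / sqrt n ^ (2 * N + 1).
Proof.
  destruct (local_saddle v 1 N) as [del0 [Hdel0 H]]. ring.
  set (del := Rmin del0 (/ 2)). assert (Hdel := Rmin_half_pos del0 Hdel0). fold del in Hdel.
  assert (Hdel1 : del <= del0) by apply Rmin_l. assert (Hdel2 : del <= / 2) by apply Rmin_r.
  destruct (H del) as [Hd1 [K [HK HL]]]. lra.
  destruct (real_segment_reduction 1 v del) as [K2 [HK2 HR]]. simpl; lra. lra.
  destruct (exp_small (del * del / 2) (S N)) as [K3 [HK3 HE]]. nra.
  exists (K + K2 * K3). split. assert (0 <= K2 * K3) by (apply Rmult_le_pos; auto). lra.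
  intros n Hn. destruct (n_large v n Hn) as [Hn1 Hn2].
  destruct (HR n Hn) as [l [Hl Hb]]. specialize (HL n l Hn1 Hl).
  rewrite Cmult_1_r in Hb. set (E := (Cexp (RtoC n) * Eint n (RtoC n + v) 1)%C) in *.
  set (Sm := Csum _ (S N)) in *.
  replace (RtoC n * E - Sm)%C with ((RtoC n * l - Sm) + RtoC n * (E - l))%C by ring.
  apply Rle_trans with (1 := Cmod_triangle _ _).
  unfold Rdiv. rewrite Rmult_plus_distr_r. apply Rplus_le_compat; auto.
  rewrite Cmod_mult, Cmod_RtoC_pos by lra.
  apply Rle_trans with (K2 * (K3 / n ^ S N)).
  - apply Rle_trans with (K2 * (n * exp (- (del * del / 2) * n))).
    apply (Rmult_le_compat_l n) in Hb; lra.
    apply Rmult_le_compat_l; auto.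
  - rewrite Rmult_assoc. apply Rmult_le_compat_l; auto. apply div_pow_le_div_sqrt; auto.
Qed.

(** For [d = 1] the condition of [local_linear] is just [Re (1-w) > 0]. The size of [w e^(1-w)] does
    not enter, so one argument serves all of [Re w < 1], including [w = 0]. *)
Lemma endpoint_inner (w v : C) (N : nat) : Re w < 1 ->
  exists K, 0 <= K /\ forall n, Rabs (Re v) + 2 <= n ->
    Cmod (Sn n w v - Csum (fun r => Ucoef r w v / RtoC n ^ r) (S N))%C <= K / n ^ S N.
Proof.
  intros Hw. destruct (local_linear w v 1 N) as [del0 [Hdel0 H]].
  apply RtoC_neq0; lra. rewrite Cmult_1_r, Re_minus, (Re_RtoC 1); lra.
  set (del := Rmin del0 (/ 2)). assert (Hdel := Rmin_half_pos del0 Hdel0). fold del in Hdel.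
  assert (Hdel1 : del <= del0) by apply Rmin_l. assert (Hdel2 : del <= / 2) by apply Rmin_r.
  destruct (H del) as [Hd1 [K [HK HL]]]. lra.
  destruct (real_segment_reduction w v del) as [K2 [HK2 HR]]. lra. lra.
  destruct (exp_small (del * del / 2) (S N)) as [K3 [HK3 HE]]. nra.
  assert (Hw0 := Cmod_ge_0 w).
  exists (K + Cmod w * K2 * K3). split.
  { assert (0 <= Cmod w * K2 * K3) by (repeat apply Rmult_le_pos; auto). lra. }
  intros n Hn. destruct (n_large v n Hn) as [Hn1 Hn2].
  destruct (HR n Hn) as [l [Hl Hb]]. specialize (HL n l Hn1 Hl).
  rewrite Sn_Eint by auto. rewrite Cmult_1_r in HL.
  set (E := (Cexp (RtoC n * w) * Eint n (RtoC n + v) w)%C) in *.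
  set (Sm := Csum _ (S N)) in *.
  replace (1 + RtoC n * w * E - Sm)%C with ((RtoC n * w * l - (Sm - 1)) + RtoC n * (w * (E - l)))%C by ring.
  apply Rle_trans with (1 := Cmod_triangle _ _).
  unfold Rdiv. rewrite Rmult_plus_distr_r. apply Rplus_le_compat; auto.
  rewrite Cmod_mult, Cmod_mult, Cmod_RtoC_pos by lra.
  apply Rle_trans with (Cmod w * K2 * (n * exp (- (del * del / 2) * n))).
  - replace (Cmod w * K2 * (n * exp (- (del * del / 2) * n))) with
      (n * (Cmod w * (K2 * exp (- (del * del / 2) * n)))) by ring.
    apply Rmult_le_compat_l. lra. apply Rmult_le_compat_l; auto.
  - rewrite (Rmult_assoc (Cmod w * K2)). apply Rmult_le_compat_l; auto. apply Rmult_le_pos; auto.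
Qed.

Lemma ln_le_sub_1 (x : R) : 0 < x -> ln x <= x - 1.
Proof.
  intros H. destruct (Req_dec x 1) as [-> | Hn]. rewrite ln_1; lra.
  assert (E := exp_ineq1_le (ln x)). rewrite exp_ln in E by auto. lra.
Qed.

Lemma ln_1_plus_gap (y : R) : 0 < y -> 0 < y - ln (1 + y).
Proof.
  intros H. assert (E : ln (1 + y) < y).
  { apply exp_lt_inv. rewrite exp_ln by lra. apply exp_ineq1; lra. } lra.
Qed.

Lemma ln_1_plus_gap_mono (x y : R) : 0 < x <= y -> x - ln (1 + x) <= y - ln (1 + y).
Proof.
  intros H. assert (E : ln ((1 + y) / (1 + x)) <= (1 + y) / (1 + x) - 1)
    by (apply ln_le_sub_1, Rdiv_lt_0_compat; lra).
  rewrite ln_div in E by lra.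
  replace ((1 + y) / (1 + x) - 1) with ((y - x) / (1 + x)) in E by (field; lra).
  assert ((y - x) / (1 + x) <= y - x).
  { apply (Rmult_le_reg_r (1 + x)). lra. unfold Rdiv. rewrite Rmult_assoc, Rinv_l by lra. nra. }
  lra.
Qed.

Lemma Fprim_1 (n : R) (a : C) : Fprim n a 1 = Eint n a 1.
Proof. unfold Fprim. rewrite Clog_1, Cmult_0_r, Cexp_0. ring. Qed.

(** With [u = 1 + s] this is direction [d = -1]. The end [b] is arbitrary, because everything beyond
    [1 + del] is exponentially small. *)
Lemma right_half_saddle (v : C) (b : R) (N : nat) : 1 < b ->
  exists K, 0 <= K /\ forall n, Rabs (Re v) + 2 <= n ->
    Cmod (RtoC n * (Cexp (RtoC n) * (Fprim n (RtoC n + v) (RtoC b) - Fprim n (RtoC n + v) 1))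
      - Csum (fun r => / RtoC n ^ r * (- (1) * (rho r v - kdelta r) + gam r v / 2 * sq2pin n)) (S N))%C
    <= K / sqrt n ^ (2 * N + 1).
Proof.
  intros Hb. destruct (local_saddle v (- (1))%C N) as [del0 [Hdel0 H]]. ring.
  set (del := Rmin del0 (b - 1)). assert (Hdel : 0 < del) by (apply Rmin_pos; lra).
  assert (Hdel1 : del <= del0) by apply Rmin_l. assert (Hdel2 : del <= b - 1) by apply Rmin_r.
  destruct (H del) as [Hd1 [K [HK HL]]]. lra.
  (* The decay rate at [u = 1 + del]; [s - ln(1+s)] increases, so it holds on the whole tail. In
     [K2] below, [b^|Re v|] bounds [|u^v|] and [b - 1] the length. *)
  set (kap := del - ln (1 + del)). assert (Hkap : 0 < kap) by (apply ln_1_plus_gap; auto).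
  destruct (exp_small kap (S N) Hkap) as [K3 [HK3 HE]].
  set (K2 := exp (Rabs (Re v) * ln b) * (b - 1)).
  assert (HK2 : 0 <= K2) by (apply Rmult_le_pos; [left; apply exp_pos | lra]).
  exists (K + K2 * K3). split. assert (0 <= K2 * K3) by (apply Rmult_le_pos; auto). lra.
  intros n Hn. destruct (n_large v n Hn) as [Hn1 Hn2]. set (a := (RtoC n + v)%C) in *.
  assert (Hpos : forall x, 0 <= x -> 0 < Re (1 + RtoC x * 1)%C) by (intros; simpl; lra).
  set (f := fun t => (Cexp (RtoC n) * fint n a (1 + RtoC t * 1))%C).
  assert (Hf : forall x, 0 <= x -> Ccont f x).
  { intros x Hx. apply Ccont_mult. apply Ccont_const. apply Ccont_fint; auto. }
  assert (Hseg : Cint f 0 (b - 1) (Cexp (RtoC n) * (Fprim n a (RtoC b) - Fprim n a 1))%C).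
  { assert (Hs := segment_integral n a 1 1 (b - 1)).
    replace (1 + RtoC (b - 1) * 1)%C with (RtoC b) in Hs by (rewrite RtoC_minus; ring).
    apply (Cint_ext (fun t => Cexp (RtoC n) * (1 * fint n a (1 + RtoC t * 1)))%C). lra.
    intros; unfold f; ring. apply Cint_scal, Hs; auto; try lra. intros; apply Hpos; lra. }
  destruct (Cint_ex f 0 del) as [l1 Hl1]. lra. intros; apply Hf; lra.
  destruct (Cint_ex f del (b - 1)) as [l2 Hl2]. lra. intros; apply Hf; lra.
  rewrite (Cint_unique _ _ _ _ _ Hseg (Cint_Chasles _ _ _ _ _ _ Hl1 Hl2)).
  assert (Hg : Cint (gray n 1 v (- (1))) 0 del l1).
  { apply (Cint_ext f); auto. lra. intros s Hs. unfold f, fint, gray. fold a.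
    replace (1 - RtoC s * - (1))%C with (1 + RtoC s * 1)%C by ring. rewrite <- Cexp_plus.
    f_equal. ring. }
  specialize (HL n l1 Hn1 Hg). set (Sm := Csum _ (S N)) in *.
  replace (RtoC n * (l1 + l2) - Sm)%C with ((RtoC n * l1 - Sm) + RtoC n * l2)%C by ring.
  apply Rle_trans with (1 := Cmod_triangle _ _).
  unfold Rdiv. rewrite Rmult_plus_distr_r. apply Rplus_le_compat; auto.
  rewrite Cmod_mult, Cmod_RtoC_pos by lra.
  assert (Hl2b : Cmod l2 <= K2 * exp (- kap * n)).
  { set (M := exp (Rabs (Re v) * ln b) * exp (- kap * n)).
    assert (HM : 0 < M) by (apply Rmult_lt_0_compat; apply exp_pos).
    apply Rle_trans with (M * (b - 1 - del)).
    2: { unfold K2. fold M. apply Rle_trans with (M * (b - 1)). nra. right; unfold M; ring. }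
    refine (Cint_Cmod_le_const f del (b - 1) l2 M _ _ Hl2). lra.
    intros s Hs. unfold f, fint. rewrite <- Cexp_plus, Cmod_Cexp. unfold M. rewrite <- exp_plus.
    apply exp_le. replace (1 + RtoC s * 1)%C with (RtoC (1 + s)) by (rewrite RtoC_plus; ring).
    rewrite Clog_RtoC by lra.
    replace (Re (RtoC n + (- (RtoC n * RtoC (1 + s)) + a * RtoC (ln (1 + s))))%C) with
      (- n * (s - ln (1 + s)) + Re v * ln (1 + s)) by (unfold a, Re; simpl; ring).
    assert (Hm := ln_1_plus_gap_mono del s ltac:(lra)). fold kap in Hm.
    assert (Hl0 : 0 <= ln (1 + s)) by (rewrite <- ln_1; apply ln_le; lra).
    assert (Hlb : ln (1 + s) <= ln b) by (apply ln_le; lra).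
    assert (Hv := Rle_abs (Re v)). assert (Hv0 := Rabs_pos (Re v)).
    assert (Re v * ln (1 + s) <= Rabs (Re v) * ln b).
    { apply Rle_trans with (Rabs (Re v) * ln (1 + s)). apply Rmult_le_compat_r; auto.
      apply Rmult_le_compat_l; auto. }
    assert (n * kap <= n * (s - ln (1 + s))) by (apply Rmult_le_compat_l; lra). lra. }
  apply Rle_trans with (K2 * (K3 / n ^ S N)).
  - apply Rle_trans with (K2 * (n * exp (- kap * n))).
    apply (Rmult_le_compat_l n) in Hl2b; lra.
    apply Rmult_le_compat_l; auto.
  - rewrite Rmult_assoc. apply Rmult_le_compat_l; auto. apply div_pow_le_div_sqrt; auto.
Qed.

(* The odd-order terms of the two halves of the saddle cancel. *)
Lemma full_saddle (v : C) (b : R) (N : nat) : 1 < b ->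
  exists K, 0 <= K /\ forall n, Rabs (Re v) + 2 <= n ->
    Cmod (RtoC n * (Cexp (RtoC n) * Fprim n (RtoC n + v) (RtoC b))
      - sq2pin n * Csum (fun r => gam r v / RtoC n ^ r) (S N))%C
    <= K / sqrt n ^ (2 * N + 1).
Proof.
  intros Hb. destruct (left_half_saddle v N) as [K1 [HK1 H1]].
  destruct (right_half_saddle v b N Hb) as [K2 [HK2 H2]].
  exists (K1 + K2). split. lra. intros n Hn. specialize (H1 n Hn). specialize (H2 n Hn).
  rewrite <- Fprim_1 in H1. unfold Rdiv. rewrite Rmult_plus_distr_r.
  apply Rle_trans with (2 := Rplus_le_compat _ _ _ _ H1 H2).
  apply Rle_trans with (2 := Cmod_triangle _ _). right. f_equal.
  set (a := (RtoC n + v)%C).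
  match goal with |- _ = ((?A - ?X) + (?B - ?Y))%C => transitivity ((A + B) - (X + Y))%C; [ | ring] end.
  f_equal. ring. rewrite <- Csum_plus, <- Csum_scal. apply Csum_ext. intros.
  unfold Cdiv.
  assert (E : (/ 2 + / 2 = 1)%C) by field.
  transitivity (sq2pin n * (gam i v * / RtoC n ^ i) * (/ 2 + / 2))%C. rewrite E; ring. ring.
Qed.

Lemma Carg_bound (z : C) : 0 < Re z -> Rabs (Im (Clog z)) <= 2.
Proof.
  intros H. simpl. unfold Carg. destruct (Rlt_dec 0 (Re z)); [ | lra].
  apply Rabs_le. generalize (atan_bound (Im z / Re z)) PI_4; lra.
Qed.

Lemma Rmult_le_Rabs (x y B : R) : Rabs y <= B -> x * y <= Rabs x * B.
Proof.
  intros H. apply Rle_trans with (1 := Rle_abs _). rewrite Rabs_mult.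
  apply Rmult_le_compat_l; auto. apply Rabs_pos.
Qed.

Lemma Re_shift (w : C) (x : R) : Re (w + RtoC x * 1)%C = Re w + x.
Proof. unfold Re; simpl; ring. Qed.

(** Both sides have the same derivative in [s] and agree at [s = 0], which excludes a jump by a
    multiple of [2 PI i]. *)
Lemma Clog_shift (w : C) (del s : R) : 1 <= Re w -> del * Cmod (- / w)%C <= / 2 -> 0 <= s <= del ->
  Clog (w + RtoC s)%C = (Clog w + Clog (1 - RtoC s * - / w))%C.
Proof.
  intros Hw Hd Hs. assert (Hw0 : w <> 0%C) by (apply Re_pos_neq0; lra).
  set (D := fun s => (Clog (w + RtoC s * 1) + (-1) * Clog (1 - RtoC s * - / w))%C).
  assert (HD : Cmod (D s - D 0)%C <= 0 * (s - 0)).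
  { apply (Cder_mean_value D (fun _ => 0%C)). lra.
    - intros x Hx. unfold D. eapply Cder_ext_val. apply Cder_plus.
      apply Cder_log. rewrite Re_shift; lra. apply Cder_lin.
      apply Cder_scal. apply (Cder_log_ray _ del); auto. lra.
      cbv beta. destruct (ray_bounds (- / w)%C del x Hd ltac:(lra)) as [_ [H2 _]].
      apply Cmod_half_neq0 in H2.
      assert (H3 : (w + RtoC x * 1)%C <> 0%C) by (apply Re_pos_neq0; rewrite Re_shift; lra).
      replace (1 - RtoC x * - / w)%C with ((w + RtoC x * 1) / w)%C by (field; auto).
      set (e := (w + RtoC x * 1)%C) in *. field. split; auto.
    - intros; apply Ccont_const.
    - intros; rewrite Cmod_0; lra. }
  assert (HD0 : (D s - D 0)%C = 0%C).
  { apply Cmod_eq_0. generalize (Cmod_ge_0 (D s - D 0)%C); lra. }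
  unfold D in HD0. replace (1 - 0 * - / w)%C with (RtoC 1) in HD0 by ring. rewrite Clog_1 in HD0.
  replace (w + 0 * 1)%C with w in HD0 by ring. replace (w + RtoC s * 1)%C with (w + RtoC s)%C in HD0 by ring.
  set (A := Clog (w + RtoC s)%C) in *. set (B := Clog (1 - RtoC s * - / w)%C) in *.
  transitivity (A + -1 * B - (Clog w + -1 * 0) + (Clog w + B))%C. ring. rewrite HD0. ring.
Qed.

Lemma Cmod_ge_Re1 (w : C) : 1 <= Re w -> 1 <= Cmod w.
Proof. intros. apply Rle_trans with (1 := H), Re_le_Cmod. Qed.

(* Here [b = Re w + del]; on the vertical side from [b] to [w + del] the integrand is smaller than
   at [w] by the factor [((1 + del) e^(-del))^n]. *)
Lemma endpoint_outer (w v : C) (N : nat) : 1 <= Re w -> w <> 1%C ->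
  exists b, 1 < b /\ exists K, 0 <= K /\ forall n, Rabs (Re v) + 2 <= n ->
    Cmod (Sn n w v
      - / (wepow n w * Ccpow w v) * (RtoC n * (Cexp (RtoC n) * Fprim n (RtoC n + v) (RtoC b)))
      - Csum (fun r => Ucoef r w v / RtoC n ^ r) (S N))%C <= K / n ^ S N.
Proof.
  intros Hw Hw1. assert (Hw0 : w <> 0%C) by (apply Re_pos_neq0; lra).
  assert (Hwm : 1 <= Cmod w) by (apply Cmod_ge_Re1; auto).
  set (d := (- / w)%C).
  assert (Hd0 : d <> 0%C).
  { intros E. assert (X : (d * w = - (1))%C) by (unfold d; field; auto).
    rewrite E in X. apply (f_equal fst) in X. simpl in X; lra. }
  (* [(1-w) d = 1 - 1/w] has positive real part exactly when [|w|^2 > Re w]; for [Re w >= 1] this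
     fails only at [w = 1]. *)
  assert (Hre : 0 < Re ((1 - w) * d)%C).
  { replace ((1 - w) * d)%C with (1 - / w)%C by (unfold d; field; auto).
    assert (Hsq : Re w < Re w ^ 2 + Im w ^ 2).
    { destruct (Req_dec (Im w) 0) as [Hi | Hi].
      - assert (Re w <> 1). { intros Hr. apply Hw1. apply C_eq; simpl; auto. }
        rewrite Hi. simpl. nra.
      - assert (0 < Im w ^ 2) by (apply pow2_gt_0; auto). simpl in *; nra. }
    replace (Re (1 - / w)%C) with (1 - Re w / (Re w ^ 2 + Im w ^ 2)) by reflexivity.
    assert (Re w / (Re w ^ 2 + Im w ^ 2) < 1).
    { apply (Rmult_lt_reg_r (Re w ^ 2 + Im w ^ 2)). lra.
      unfold Rdiv. rewrite Rmult_assoc, Rinv_l by lra. lra. }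
    lra. }
  destruct (local_linear w v d N Hd0 Hre) as [del [Hdel H]].
  destruct (H del) as [Hd1 [K [HK HL]]]. lra. clear H.
  set (b := Re w + del). exists b. split. unfold b; lra.
  set (kap := del - ln (1 + del)). assert (Hkap : 0 < kap) by (apply ln_1_plus_gap; auto).
  destruct (exp_small kap (S N) Hkap) as [K3 [HK3 HE]].
  (* Bounds [|log|] of the modulus of [u^v] on the vertical side, arguments being at most 2 in
     absolute value; [2 * C1] accounts for [u^v] and [w^(-v)] together. *)
  set (C1 := Rabs (Re v) * ln (Cmod w + del) + Rabs (Im v) * 2).
  set (K2 := Rabs (Im w) * exp (2 * C1)).
  assert (HK2 : 0 <= K2) by (apply Rmult_le_pos; [apply Rabs_pos | left; apply exp_pos]).
  exists (K + K2 * K3). split. assert (0 <= K2 * K3) by (apply Rmult_le_pos; auto). lra.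
  intros n Hn. destruct (n_large v n Hn) as [Hn1 Hn2].
  rewrite Sn_Fprim by (auto; lra). set (a := (RtoC n + v)%C) in *.
  set (P := Cexp (RtoC n * w - a * Clog w)%C).
  assert (HP : (/ (wepow n w * Ccpow w v) * Cexp (RtoC n))%C = P).
  { unfold wepow, Ccpow. rewrite <- Cexp_plus, <- Cexp_opp, <- Cexp_plus. unfold P. f_equal. unfold a; ring. }
  assert (HH := segment_integral n a w 1 del).
  replace (w + RtoC del * 1)%C with (w + RtoC del)%C in HH by ring.
  assert (HH' := HH ltac:(lra) Hn2 ltac:(lra) ltac:(intros x Hx; rewrite Re_shift; lra)). clear HH.
  apply (Cint_scal P) in HH'.
  assert (Hg : Cint (gray n w v d) 0 del (P * (Fprim n a (w + RtoC del) - Fprim n a w))%C).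
  { eapply Cint_ext; [ | | exact HH']. lra. intros s Hs. cbv beta. unfold gray, fint, P. fold a.
    replace (w + RtoC s * 1)%C with (w + RtoC s)%C by ring.
    rewrite (Clog_shift w del s) by (auto; lra). fold d.
    rewrite Cmult_1_l, <- Cexp_plus. f_equal. unfold d. field. auto. }
  specialize (HL n _ Hn1 Hg).
  set (iy := ((0, Im w) : C)).
  assert (HV := segment_integral n a (RtoC b) iy 1).
  assert (Hbpos : forall x : R, 0 < Re (RtoC b + RtoC x * iy)%C).
  { intros x. replace (Re (RtoC b + RtoC x * iy)%C) with b by (unfold iy, Re; simpl; ring). unfold b; lra. }
  assert (HV' := HV ltac:(lra) Hn2 ltac:(lra) ltac:(intros; apply Hbpos)). clear HV.
  replace (RtoC b + 1 * iy)%C with (w + RtoC del)%C in HV'.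
  2: { apply C_eq; unfold b, iy, Re, Im; simpl; ring. }
  set (V := (Fprim n a (w + RtoC del) - Fprim n a (RtoC b))%C) in *.
  assert (HPV : Cmod (P * V)%C <= K2 * exp (- kap * n)).
  { apply (Cint_scal P) in HV'.
    apply Rle_trans with (K2 * exp (- kap * n) * (1 - 0)); [ | lra].
    refine (Cint_Cmod_le_const _ 0 1 _ _ _ _ HV'). lra.
    intros x Hx. rewrite !Cmod_mult.
    replace (Cmod iy) with (Rabs (Im w)).
    2: { unfold iy, Cmod; simpl. rewrite !Rmult_0_l, Rplus_0_l, Rmult_1_r. symmetry. apply sqrt_Rsqr_abs. }
    set (u := (RtoC b + RtoC x * iy)%C).
    assert (Hu : 0 < Re u) by apply Hbpos.
    assert (Hu1 : 1 <= Cmod u).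
    { apply Rle_trans with (2 := Re_le_Cmod u).
      replace (Re u) with b by (unfold u, iy, Re; simpl; ring). unfold b; lra. }
    assert (Hu2 : Cmod u <= Cmod w + del).
    { apply Rle_trans with (Cmod (w + RtoC del)%C).
      2: { apply Rle_trans with (1 := Cmod_triangle _ _). rewrite (Cmod_RtoC_pos del); lra. }
      unfold Cmod. apply sqrt_le_1_alt.
      replace (fst u) with b by (unfold u, iy; simpl; ring).
      replace (snd u) with (x * Im w) by (unfold u, iy, Im; simpl; ring).
      replace (fst (w + RtoC del)%C) with b by reflexivity.
      replace (snd (w + RtoC del)%C) with (Im w) by (unfold Im; simpl; ring).
      apply Rplus_le_compat_l. rewrite Rpow_mult_distr.
      assert (0 <= Im w ^ 2) by apply pow2_ge_0. assert (x ^ 2 <= 1) by (simpl; nra). nra. }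
    unfold fint, P. rewrite !Cmod_Cexp.
    replace (Re (RtoC n * w - a * Clog w)%C) with
      (n * Re w - n * ln (Cmod w) - Re v * ln (Cmod w) + Im v * Im (Clog w)).
    2: { unfold a, Clog, Re, Im; simpl; ring. }
    replace (Re (- (RtoC n * u) + a * Clog u)%C) with
      (- n * b + n * ln (Cmod u) + Re v * ln (Cmod u) - Im v * Im (Clog u)).
    2: { replace b with (Re u) by (unfold u, iy, Re; simpl; ring).
         unfold a, Clog, Re, Im; simpl; ring. }
    assert (HA1 := Carg_bound w ltac:(lra)). assert (HA2 := Carg_bound u Hu).
    assert (HLw : 0 <= ln (Cmod w)) by (rewrite <- ln_1; apply ln_le; lra).
    assert (HLu : 0 <= ln (Cmod u)) by (rewrite <- ln_1; apply ln_le; lra).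
    assert (HLw2 : ln (Cmod w) <= ln (Cmod w + del)) by (apply ln_le; lra).
    assert (HLu2 : ln (Cmod u) <= ln (Cmod w + del)) by (apply ln_le; lra).
    assert (Q1 : - Re v * ln (Cmod w) <= Rabs (Re v) * ln (Cmod w + del)).
    { rewrite <- (Rabs_Ropp (Re v)). apply Rmult_le_Rabs. rewrite Rabs_pos_eq; auto. }
    assert (Q2 : Re v * ln (Cmod u) <= Rabs (Re v) * ln (Cmod w + del)).
    { apply Rmult_le_Rabs. rewrite Rabs_pos_eq; auto. }
    assert (Q3 : Im v * Im (Clog w) <= Rabs (Im v) * 2) by (apply Rmult_le_Rabs; auto).
    assert (Q4 : - Im v * Im (Clog u) <= Rabs (Im v) * 2).
    { rewrite <- (Rabs_Ropp (Im v)). apply Rmult_le_Rabs; auto. }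
    (* Uses [|w| >= 1]. Against this gain per unit of [n] stands the loss [del] from [e^(-n b)], and
       the balance is [-kap]. *)
    assert (Q5 : ln (Cmod w + del) - ln (Cmod w) <= ln (1 + del)).
    { rewrite <- ln_div by lra. apply ln_le. apply Rdiv_lt_0_compat; lra.
      apply (Rmult_le_reg_r (Cmod w)). lra. unfold Rdiv. rewrite Rmult_assoc, Rinv_l by lra. nra. }
    assert (Q6 : n * (ln (Cmod u) - ln (Cmod w)) <= n * ln (1 + del)) by (apply Rmult_le_compat_l; lra).
    rewrite (Rmult_comm (exp _)), Rmult_assoc, <- exp_plus. unfold K2. rewrite Rmult_assoc, <- exp_plus.
    apply Rmult_le_compat_l. apply Rabs_pos. apply exp_le. unfold C1, kap, b. lra. }
  set (Sm := Csum _ (S N)) in *.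
  (* Since [n w d = -n], the path from [b] over [w + del] to [w] splits into the local expansion,
     traversed backwards, and the vertical side [V]. *)
  match goal with |- Cmod ?Z <= _ => replace Z with
    ((RtoC n * w * d * (P * (Fprim n a (w + RtoC del) - Fprim n a w)) - (Sm - 1)) + RtoC n * (P * V))%C end.
  2: { rewrite <- HP. unfold V, d.
       set (F1 := Fprim n a (w + RtoC del)). set (F2 := Fprim n a w). set (F3 := Fprim n a (RtoC b)).
       set (X := (/ (wepow n w * Ccpow w v))%C). field. auto. }
  apply Rle_trans with (1 := Cmod_triangle _ _).
  unfold Rdiv. rewrite Rmult_plus_distr_r. apply Rplus_le_compat; auto.
  rewrite Cmod_mult, Cmod_RtoC_pos by lra.
  apply Rle_trans with (K2 * (n * exp (- kap * n))).
  apply (Rmult_le_compat_l n) in HPV; lra.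
  rewrite Rmult_assoc. apply Rmult_le_compat_l; auto.
Qed.

(** * The saddle weight and the separate regimes *)

Lemma modwe_exp (w : C) : w <> 0%C -> modwe w = exp (ln (Cmod w) + 1 - Re w).
Proof.
  intros Hw. unfold modwe. rewrite Cmod_mult, Cmod_Cexp.
  replace (ln (Cmod w) + 1 - Re w) with (ln (Cmod w) + (1 - Re w)) by ring.
  rewrite exp_plus, exp_ln by (apply Cmod_pos; auto). reflexivity.
Qed.

Lemma Cmod_inv_wepow (n : R) (w v : C) :
  Cmod (/ (wepow n w * Ccpow w v))%C =
  exp (- Re (v * Clog w)%C) * exp (- (ln (Cmod w) + 1 - Re w) * n).
Proof.
  unfold wepow, Ccpow. rewrite <- Cexp_plus, <- Cexp_opp, Cmod_Cexp, <- exp_plus. f_equal.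
  rewrite Re_opp, Re_plus. unfold Re at 1 3; simpl. unfold Re; ring.
Qed.

Lemma Csum_div_bounded (c : nat -> C) (N : nat) :
  exists B, 0 <= B /\ forall n, 1 <= n -> Cmod (Csum (fun r => c r / RtoC n ^ r)%C N) <= B.
Proof.
  induction N.
  - exists 0. split; [lra | ]. intros; simpl; rewrite Cmod_0; lra.
  - destruct IHN as [B [HB H]]. exists (B + Cmod (c N)). split.
    generalize (Cmod_ge_0 (c N)); lra.
    intros n Hn. simpl. apply Rle_trans with (1 := Cmod_triangle _ _). apply Rplus_le_compat; auto.
    rewrite Cmod_div, Cmod_pow, Cmod_RtoC_pos by (try apply Cpow_nz, RtoC_neq0; lra).
    assert (1 <= n ^ N) by (apply pow_R1_Rle; auto).
    apply (Rmult_le_reg_r (n ^ N)). lra. unfold Rdiv. rewrite Rmult_assoc, Rinv_l by lra.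
    generalize (Cmod_ge_0 (c N)); nra.
Qed.

Lemma sq2pin_bounds (n : R) : 1 <= n -> sqrt n <= Cmod (sq2pin n) <= 3 * n.
Proof.
  intros Hn. unfold sq2pin. rewrite Cmod_RtoC_pos by apply sqrt_pos.
  assert (HP := PI_RGT_0). assert (HP4 := PI_4). assert (HP1 := PI2_1). unfold PI2 in HP1.
  split. apply sqrt_le_1_alt. nra.
  rewrite <- (sqrt_square (3 * n)) by lra. apply sqrt_le_1_alt. nra.
Qed.

Lemma div_sqrt_pow (K n : R) (N : nat) : 1 <= n ->
  K / sqrt n ^ (2 * N + 1) = sqrt n * (K / n ^ S N).
Proof.
  intros Hn. assert (Hs := sqrt_ge_1 n Hn).
  replace (n ^ S N) with (sqrt n * sqrt n ^ (2 * N + 1)).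
  field. split. apply pow_nonzero; lra. lra.
  replace (sqrt n * sqrt n ^ (2 * N + 1)) with (sqrt n ^ (2 * S N)).
  rewrite pow_mult. f_equal. simpl. rewrite Rmult_1_r. apply sqrt_sqrt; lra.
  replace (2 * S N)%nat with (S (2 * N + 1)) by lia. reflexivity.
Qed.

(** The leading 1 of [S_n] supplies the Kronecker delta missing from the half-saddle expansion. *)
Lemma expansion_at_one (v : C) (N : nat) :
  exists K L : R, forall n : R, L <= n ->
     Cmod (Sn n 1 v -
           Csum (fun r => / (RtoC n ^ r) *
                   (rho r v + gam r v / RtoC 2 * sq2pin n))%C (S N))%C
     <= K / Rpower n (INR (S N) - / 2).
Proof.
  destruct (left_half_saddle v N) as [K [HK H]]. exists K, (Rabs (Re v) + 2).
  intros n Hn. destruct (n_large v n Hn) as [Hn1 Hn2]. specialize (H n Hn).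
  rewrite Rpower_half by auto. rewrite Sn_Eint, !Cmult_1_r by auto.
  apply Rle_trans with (2 := H). right; f_equal.
  set (Z := (RtoC n * (Cexp (RtoC n) * Eint n (RtoC n + v) 1))%C).
  rewrite (Csum_ext (fun r => / RtoC n ^ r * (1 * (rho r v - kdelta r) + gam r v / 2 * sq2pin n))%C
    (fun r => / RtoC n ^ r * (rho r v + gam r v / 2 * sq2pin n) - / RtoC n ^ r * kdelta r)%C)
    by (intros; ring).
  rewrite Csum_minus, Csum_kdelta. ring.
Qed.

(** Common source of the regimes with [Re w >= 1]. The endpoint error and the saddle error stay
    separate, because only the latter carries the weight, which may decay, oscillate or grow. *)
Lemma expansion_outer (w v : C) (N : nat) : 1 <= Re w -> w <> 1%C ->
  exists K, 0 <= K /\ forall n, Rabs (Re v) + 2 <= n ->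
    Cmod (Sn n w v
      - / (wepow n w * Ccpow w v) * (sq2pin n * Csum (fun r => gam r v / RtoC n ^ r) (S N))
      - Csum (fun r => Ucoef r w v / RtoC n ^ r) (S N))%C
    <= K / n ^ S N + Cmod (/ (wepow n w * Ccpow w v))%C * (K / sqrt n ^ (2 * N + 1)).
Proof.
  intros Hw Hw1. destruct (endpoint_outer w v N Hw Hw1) as [b [Hb [K1 [HK1 H1]]]].
  destruct (full_saddle v b N Hb) as [K2 [HK2 H2]].
  exists (K1 + K2). split; [lra | ]. intros n Hn. destruct (n_large v n Hn) as [Hn1 Hn2].
  specialize (H1 n Hn). specialize (H2 n Hn).
  set (P := (/ (wepow n w * Ccpow w v))%C) in *.
  set (G := (RtoC n * (Cexp (RtoC n) * Fprim n (RtoC n + v) (RtoC b)))%C) in *.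
  set (T := (sq2pin n * Csum (fun r => gam r v / RtoC n ^ r) (S N))%C) in *.
  set (U := Csum (fun r => Ucoef r w v / RtoC n ^ r)%C (S N)) in *.
  replace (Sn n w v - P * T - U)%C with ((Sn n w v - P * G - U) + P * (G - T))%C by ring.
  apply Rle_trans with (1 := Cmod_triangle _ _). rewrite Cmod_mult.
  assert (0 < / n ^ S N) by (apply Rinv_0_lt_compat, pow_lt; lra).
  assert (0 < / sqrt n ^ (2 * N + 1)) by (apply Rinv_0_lt_compat, pow_lt; generalize (sqrt_ge_1 n Hn1); lra).
  apply Rplus_le_compat.
  - apply Rle_trans with (1 := H1). unfold Rdiv; nra.
  - apply Rmult_le_compat_l. apply Cmod_ge_0. apply Rle_trans with (1 := H2). unfold Rdiv; nra.
Qed.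

(** The weight decays exponentially, so the entire saddle part joins the error and crude bounds by
    multiples of [n] suffice for the other factors. *)
Lemma expansion_X_outer (w v : C) (N : nat) : 1 <= Re w -> modwe w > 1 ->
  exists K L : R, forall n : R, L <= n ->
     Cmod (Sn n w v - Csum (fun r => Ucoef r w v / (RtoC n ^ r))%C (S N))%C
     <= K / n ^ (S N).
Proof.
  intros Hw HX. assert (Hw0 : w <> 0%C) by (apply Re_pos_neq0; lra).
  assert (Hw1 : w <> 1%C).
  { intros ->. rewrite modwe_exp, Cmod_1, ln_1 in HX by auto. simpl in HX.
    replace (0 + 1 - 1) with 0 in HX by ring. rewrite exp_0 in HX; lra. }
  rewrite modwe_exp in HX by auto. set (lam := ln (Cmod w) + 1 - Re w) in *.
  assert (Hlam : 0 < lam) by (apply exp_lt_inv; rewrite exp_0; lra).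
  destruct (expansion_outer w v N Hw Hw1) as [K [HK H]].
  destruct (exp_small lam (S N) Hlam) as [K2 [HK2 HE]].
  destruct (Csum_div_bounded (fun r => gam r v) (S N)) as [B [HB HBb]].
  set (c0 := exp (- Re (v * Clog w)%C)). assert (Hc0 : 0 < c0) by apply exp_pos.
  exists (K + c0 * (K + 3 * B) * K2), (Rabs (Re v) + 2). intros n Hn.
  destruct (n_large v n Hn) as [Hn1 Hn2]. specialize (H n Hn). specialize (HE n Hn1).
  specialize (HBb n Hn1). assert (Hsq := sq2pin_bounds n Hn1).
  set (P := (/ (wepow n w * Ccpow w v))%C) in *.
  assert (HP : Cmod P = c0 * exp (- lam * n)) by apply Cmod_inv_wepow.
  set (G := Csum (fun r => gam r v / RtoC n ^ r)%C (S N)) in *.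
  set (U := Csum (fun r => Ucoef r w v / RtoC n ^ r)%C (S N)) in *.
  replace (Sn n w v - U)%C with ((Sn n w v - P * (sq2pin n * G) - U) + P * (sq2pin n * G))%C by ring.
  apply Rle_trans with (1 := Cmod_triangle _ _). rewrite !Cmod_mult.
  assert (HP0 : 0 <= Cmod P) by apply Cmod_ge_0.
  assert (Hsn := sqrt_ge_1 n Hn1).
  assert (Q1 : K / sqrt n ^ (2 * N + 1) <= K * n).
  { unfold Rdiv. apply Rmult_le_compat_l; auto. apply Rle_trans with 1; [ | lra].
    rewrite <- Rinv_1. apply Rinv_le_contravar. lra. apply pow_R1_Rle; auto. }
  assert (Q2 : Cmod (sq2pin n) * Cmod G <= 3 * n * B).
  { apply Rmult_le_compat; try apply Cmod_ge_0; lra. }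
  assert (Q3 : Cmod P * (K / sqrt n ^ (2 * N + 1)) + Cmod P * (Cmod (sq2pin n) * Cmod G)
     <= c0 * (K + 3 * B) * (n * exp (- lam * n))).
  { apply Rle_trans with (Cmod P * (K * n + 3 * n * B)).
    rewrite <- Rmult_plus_distr_l. apply Rmult_le_compat_l; auto. lra.
    rewrite HP. right; ring. }
  assert (Q4 : c0 * (K + 3 * B) * (n * exp (- lam * n)) <= c0 * (K + 3 * B) * (K2 / n ^ S N)).
  { apply Rmult_le_compat_l; auto. apply Rmult_le_pos; lra. }
  replace ((K + c0 * (K + 3 * B) * K2) / n ^ S N) with (K / n ^ S N + c0 * (K + 3 * B) * (K2 / n ^ S N))
    by (unfold Rdiv; ring).
  lra.
Qed.

Lemma expansion_T (w v : C) (N : nat) : regT w ->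
  exists K L : R, forall n : R, L <= n ->
     Cmod (Sn n w v -
           Csum (fun r => / (RtoC n ^ r) *
                   (Ucoef r w v +
                    gam r v * (Cexp (RtoC n * Ci * RtoC (phi w)) / Ccpow w v)
                    * sq2pin n))%C (S N))%C
     <= K / Rpower n (INR (S N) - / 2).
Proof.
  intros [HT Hw]. assert (Hw0 : w <> 0%C) by (apply Re_pos_neq0; lra).
  assert (Hw1 : w <> 1%C). { intros ->. simpl in Hw; lra. }
  assert (Hlam : ln (Cmod w) + 1 - Re w = 0).
  { rewrite modwe_exp in HT by auto. apply exp_inv. rewrite exp_0; auto. }
  destruct (expansion_outer w v N) as [K [HK H]]. lra. auto.
  set (c0 := exp (- Re (v * Clog w)%C)). assert (Hc0 : 0 < c0) by apply exp_pos.
  exists (K + c0 * K), (Rabs (Re v) + 2). intros n Hn.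
  destruct (n_large v n Hn) as [Hn1 Hn2]. specialize (H n Hn). rewrite Rpower_half by auto.
  assert (HP : Cmod (/ (wepow n w * Ccpow w v))%C = c0).
  { rewrite Cmod_inv_wepow, Hlam. replace (-0 * n) with 0 by ring. rewrite exp_0. fold c0. ring. }
  (* On this curve [ln |w| = Re w - 1], so [log w + 1 - w] is purely imaginary and equal to
     [-i phi(w)]. *)
  assert (HP2 : (/ (wepow n w * Ccpow w v))%C = (Cexp (RtoC n * Ci * RtoC (phi w)) / Ccpow w v)%C).
  { unfold Cdiv, wepow, Ccpow. rewrite <- Cexp_plus, <- !Cexp_opp, <- Cexp_plus. f_equal.
    unfold phi.
    replace (Clog w) with ((RtoC (Re w - 1) + Ci * RtoC (Carg w))%C) at 1.
    - apply C_eq; unfold Re, Im; simpl; ring.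
    - apply C_eq; unfold Clog, Re, Im; simpl; unfold Re in Hlam; lra. }
  rewrite HP in H.
  assert (HD := div_pow_le_div_sqrt K n N HK Hn1).
  apply Rle_trans with (K / n ^ S N + c0 * (K / sqrt n ^ (2 * N + 1))).
  2: { replace ((K + c0 * K) / sqrt n ^ (2 * N + 1)) with
         (K / sqrt n ^ (2 * N + 1) + c0 * (K / sqrt n ^ (2 * N + 1))) by (unfold Rdiv; ring). lra. }
  apply Rle_trans with (2 := H). right; f_equal. rewrite HP2.
  set (X := (Cexp (RtoC n * Ci * RtoC (phi w)) / Ccpow w v)%C).
  rewrite (Csum_ext _ (fun r => Ucoef r w v / RtoC n ^ r + X * sq2pin n * (gam r v / RtoC n ^ r))%C)
    by (intros; unfold Cdiv; ring).
  rewrite Csum_plus, Csum_scal. ring.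
Qed.

(** Here the weight grows exponentially: the [U_r] sum and the endpoint error are bounded, hence
    small relative to it. *)
Lemma expansion_Z (w v : C) (N : nat) : regZ w ->
  exists K L : R, forall n : R, L <= n ->
     Cmod (Sn n w v -
           sq2pin n / (wepow n w * Ccpow w v) *
           Csum (fun r => gam r v / (RtoC n ^ r))%C (S N))%C
     <= Cmod (sq2pin n / (wepow n w * Ccpow w v))%C * (K / n ^ (S N)).
Proof.
  intros [HZ Hw]. assert (Hw0 : w <> 0%C) by (apply Re_pos_neq0; lra).
  assert (Hw1 : w <> 1%C). { intros ->. simpl in Hw; lra. }
  rewrite modwe_exp in HZ by auto. set (lam := ln (Cmod w) + 1 - Re w) in *.
  assert (Hlam : 0 < - lam) by (assert (lam < 0) by (apply exp_lt_inv; rewrite exp_0; lra); lra).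
  destruct (expansion_outer w v N) as [K [HK H]]. lra. auto.
  destruct (exp_small (- lam) (S N) Hlam) as [K2 [HK2 HE]].
  destruct (Csum_div_bounded (fun r => Ucoef r w v) (S N)) as [B [HB HBb]].
  set (c0 := exp (- Re (v * Clog w)%C)). assert (Hc0 : 0 < c0) by apply exp_pos.
  exists (K + (K + B) / c0 * K2), (Rabs (Re v) + 2). intros n Hn.
  destruct (n_large v n Hn) as [Hn1 Hn2]. specialize (H n Hn). specialize (HE n Hn1).
  specialize (HBb n Hn1). assert (Hsq := sq2pin_bounds n Hn1). assert (Hsn := sqrt_ge_1 n Hn1).
  assert (HP : Cmod (/ (wepow n w * Ccpow w v))%C = c0 * exp (- lam * n)) by apply Cmod_inv_wepow.
  unfold Cdiv at 1 3. set (P := (/ (wepow n w * Ccpow w v))%C) in *.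
  set (G := Csum (fun r => gam r v / RtoC n ^ r)%C (S N)) in *.
  set (U := Csum (fun r => Ucoef r w v / RtoC n ^ r)%C (S N)) in *.
  replace (Sn n w v - sq2pin n * P * G)%C with ((Sn n w v - P * (sq2pin n * G) - U) + U)%C by ring.
  apply Rle_trans with (1 := Cmod_triangle _ _). rewrite Cmod_mult.
  assert (HP0 : 0 <= Cmod P) by apply Cmod_ge_0.
  rewrite div_sqrt_pow in H by auto.
  assert (Hin : 0 < / n ^ S N) by (apply Rinv_0_lt_compat, pow_lt; lra).
  assert (HKn : 0 <= K / n ^ S N) by (apply Rmult_le_pos; lra).
  assert (Hn1' : 1 <= n ^ S N) by (apply pow_R1_Rle; auto).
  assert (Q1 : K / n ^ S N <= K).
  { unfold Rdiv. assert (/ n ^ S N <= 1) by (rewrite <- Rinv_1; apply Rinv_le_contravar; lra). nra. }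
  (* The factor [sqrt(2 PI n) >= sqrt n] taken out in front restores the half power that the saddle
     error lacks. *)
  assert (Q2 : Cmod P * (sqrt n * (K / n ^ S N)) <= Cmod (sq2pin n) * Cmod P * (K / n ^ S N)).
  { rewrite <- Rmult_assoc. apply Rmult_le_compat_r; auto. rewrite Rmult_comm.
    apply Rmult_le_compat_r; lra. }
  (* [c0 / |P|] decays exponentially, so a constant may be traded for a multiple of
     [|P| / n^(N+1)]. *)
  assert (Q3 : 1 <= Cmod P * / c0 * (K2 / n ^ S N)).
  { rewrite HP. assert (He : exp (- lam * n) * exp (- - lam * n) = 1).
    { rewrite <- exp_plus. replace (- lam * n + - - lam * n) with 0 by ring. apply exp_0. }
    assert (0 < exp (- lam * n)) by apply exp_pos. assert (0 < exp (- - lam * n)) by apply exp_pos.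
    assert (HE2 : exp (- - lam * n) <= K2 / n ^ S N) by nra.
    replace (c0 * exp (- lam * n) * / c0) with (exp (- lam * n)) by (field; lra). nra. }
  assert (Q4 : K + B <= Cmod (sq2pin n) * Cmod P * ((K + B) / c0 * (K2 / n ^ S N))).
  { replace (Cmod (sq2pin n) * Cmod P * ((K + B) / c0 * (K2 / n ^ S N))) with
      ((K + B) * (Cmod (sq2pin n) * (Cmod P * / c0 * (K2 / n ^ S N)))) by (unfold Rdiv; ring).
    rewrite <- (Rmult_1_r (K + B)) at 1. apply Rmult_le_compat_l. lra. nra. }
  replace (Cmod (sq2pin n) * Cmod P * ((K + (K + B) / c0 * K2) / n ^ S N)) with
    (Cmod (sq2pin n) * Cmod P * (K / n ^ S N) + Cmod (sq2pin n) * Cmod P * ((K + B) / c0 * (K2 / n ^ S N)))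
    by (unfold Rdiv; ring).
  lra.
Qed.

(* "f(n) = g(n) + O(h(n)) as real n -> oo" is rendered as:
   exists K N, forall real n >= N, |f(n) - g(n)| <= K * h(n). *)
Theorem theorem5p3 (v : C) (RR : nat) (HR : (1 <= RR)%nat) :
  (exists K N : R, forall n : R, N <= n ->
     Cmod (Sn n 1 v -
           Csum (fun r => / (RtoC n ^ r) *
                   (rho r v + gam r v / RtoC 2 * sq2pin n))%C RR)%C
     <= K / Rpower n (INR RR - / 2))
  /\
  (forall w : C, regX w \/ regY w \/ regS w ->
   exists K N : R, forall n : R, N <= n ->
     Cmod (Sn n w v - Csum (fun r => Ucoef r w v / (RtoC n ^ r))%C RR)%C
     <= K / n ^ RR)
  /\
  (forall w : C, regT w ->
   exists K N : R, forall n : R, N <= n ->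
     Cmod (Sn n w v -
           Csum (fun r => / (RtoC n ^ r) *
                   (Ucoef r w v +
                    gam r v * (Cexp (RtoC n * Ci * RtoC (phi w)) / Ccpow w v)
                    * sq2pin n))%C RR)%C
     <= K / Rpower n (INR RR - / 2))
  /\
  (forall w : C, regZ w ->
   exists K N : R, forall n : R, N <= n ->
     Cmod (Sn n w v -
           sq2pin n / (wepow n w * Ccpow w v) *
           Csum (fun r => gam r v / (RtoC n ^ r))%C RR)%C
     <= Cmod (sq2pin n / (wepow n w * Ccpow w v))%C * (K / n ^ RR)).
Proof.
  destruct RR as [ | N]; [lia | ].
  split; [ | split; [ | split]].
  - apply expansion_at_one.
  (* The split is by [Re w] and not by region: [Y], [S] and part of [X] lie in [Re w < 1], and only
     points of [X] remain. *)
  - intros w Hw. destruct (Rlt_dec (Re w) 1) as [H1 | H1].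
    + destruct (endpoint_inner w v N H1) as [K [_ H]]. exists K, (Rabs (Re v) + 2). exact H.
    + apply expansion_X_outer. lra.
      destruct Hw as [HX | [[_ HY] | [_ HS]]]; [exact HX | lra | lra].
  - intros w Hw. apply expansion_T; auto.
  - intros w Hw. apply expansion_Z; auto.
Qed.
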